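(* Let $B$ be a body and let $P$ be a $G_{2A}$-structure on $B$, i.e. the structure given by two transverse one-dimensional distributions $L_1$, $L_2$ (so $L_1\cap L_2=0$ at every point) and a volume form $\Omega$. Then $P$ is integrable if and only if the two-dimensional distribution $L_1\oplus L_2$ is involutive and $\tau(Y_1,Y_2,Y_3)$ vanishes for an arbitrary adapted local frame $Y_1,Y_2,Y_3$, where $$\tau(Y_1,Y_2,Y_3)=Y_1(\alpha)+Y_2(h)+\alpha h-\alpha\beta,$$ the local functions $\alpha,\beta,h$ being defined by $[Y_1,Y_2]=\alpha Y_1+\beta Y_2$ and $\mathcal{L}_{Y_1}\Omega=h\,\Omega$.
   Context: A body is a $3$-dimensional smooth manifold which can be covered with one chart. $G_{2A}\subset GL(3,\mathbb{R})$ is the isotropy group of the subspaces $\langle e_3\rangle$, $\langle e_2\rangle$ and the tensor $e^1\wedge e^2\wedge e^3$, where $(e_i)$ is the canonical basis of $\mathbb{R}^3$ and $(e^i)$ its dual basis. The corresponding $G_{2A}$-structure $P$ is the set of linear frames $(v_1,v_2,v_3)$ at points $x\in B$ such that $v_3$ spans $(L_1)_x$, $v_2$ spans $(L_2)_x$ and $\Omega(v_1,v_2,v_3)=1$. A $G$-structure $P$ is integrable if around each point there are local coordinates whose coordinate frame is a section of $P$. In the definition of $\tau$, an adapted local frame is a local frame of vector fields $Y_1,Y_2,Y_3$ with $Y_i\in L_i$ for $i=1,2$ and $\Omega(Y_1,Y_2,Y_3)=1$. $\mathcal{L}$ denotes the Lie derivative. *)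

(* Defs.v *)
From mathcomp Require Import all_boot all_order all_algebra.
From mathcomp Require Import all_classical all_reals topology normedtype derive.
Set Implicit Arguments.
Unset Strict Implicit.
Unset Printing Implicit Defensive.
Import Order.TTheory GRing.Theory Num.Theory.
Import numFieldNormedType.Exports.
Local Open Scope classical_set_scope.
Local Open Scope ring_scope.

Section Smooth.
Context {R : realType} {W : normedModType R}.
Implicit Types (U : set 'rV[R]_3) (f : 'rV[R]_3 -> W).

Definition partial (i : 'I_3) f : 'rV[R]_3 -> W := 'D_(delta_mx 0 i) f.

(* Meant for [U] open: existence and continuity on [U] of all iterated partial
   derivatives of order at most [n]. *)
Fixpoint Ck (n : nat) U f : Prop :=
  (forall y, U y -> {for y, continuous f}) /\
  if n is m.+1 then
    forall i : 'I_3,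
      (forall y, U y -> derivable f y (delta_mx 0 i)) /\ Ck m U (partial i f)
  else True.

Definition smooth U f : Prop := forall n, Ck n U f.

End Smooth.

(* A 3-manifold covered by one chart: a space with a homeomorphism [chart] onto
   an open subset of R^3; its smooth structure is the one generated by [chart]. *)
Record body (R : realType) := Body {
  body_space :> topologicalType;
  chart : body_space -> 'rV[R]_3;
  chart_inj : injective chart;
  chart_continuous : continuous chart;
  chart_open : forall V : set body_space, open V -> open (chart @` V)
}.

Section Body.
Context {R : realType} {B : body R}.

(* [f] read in the global chart, i.e. f \o chart^-1, extended by 0 outside of
   the image of the chart. *)
Definition in_chart {W : normedModType R} (f : B -> W) : 'rV[R]_3 -> W :=
  fun y => xget 0 [set f x | x in @chart R B @^-1` [set y]].

Lemma in_chartE {W : normedModType R} (f : B -> W) (x : B) :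
  in_chart f (chart x) = f x.
Proof.
rewrite /in_chart; case: xgetP => [w _ [x' /= /chart_inj -> //]|].
by move=> /(_ (f x)) []; exists x.
Qed.

Definition smooth_on {W : normedModType R} (V : set B) (f : B -> W) : Prop :=
  smooth (@chart R B @` V) (in_chart f).

(* The global chart trivializes the tangent bundle: a tangent vector at a point
   of B is given by its components in that chart, hence a vector field by a
   map into R^3. *)
Definition vector_field : Type := B -> 'rV[R]_3.

Implicit Types (X Y Z : vector_field) (V : set B).

(* The derivative X(f) of [f] along [X]; for a vector-valued [f], it is taken
   componentwise. *)
Definition vder {W : normedModType R} X (f : B -> W) : B -> W :=
  fun x => 'D_(X x) (in_chart f) (chart x).

Definition lie_bracket X Y : vector_field := fun x => vder X Y x - vder Y X x.

Definition distribution : Type := B -> {vspace 'rV[R]_3}.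

Implicit Types (L D : distribution).

Definition section_of V D X : Prop := forall x, V x -> X x \in D x.

Definition smooth_distribution (k : nat) D : Prop :=
  (forall x, \dim (D x) = k) /\
  forall x, exists (V : set B) (X : 'I_k -> vector_field),
    [/\ open V, V x, (forall i, smooth_on V (X i)) &
        forall y, V y -> D y = (\sum_(i < k) <[X i y]>)%VS].

Definition involutive_distribution D : Prop :=
  forall V X Y, open V -> smooth_on V X -> smooth_on V Y ->
    section_of V D X -> section_of V D Y -> section_of V D (lie_bracket X Y).

Definition transverse L1 L2 : Prop := forall x, (L1 x :&: L2 x = 0)%VS.

Definition dsum L1 L2 : distribution := fun x => (L1 x + L2 x)%VS.

Definition trilinear_form : Type :=
  B -> 'rV[R]_3 -> 'rV[R]_3 -> 'rV[R]_3 -> R.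

Implicit Types Omega : trilinear_form.

Record volume_form Omega : Prop := VolumeForm {
  vol_linear1 : forall x v w, scalar (fun u => Omega x u v w);
  vol_linear2 : forall x u w, scalar (fun v => Omega x u v w);
  vol_linear3 : forall x u v, scalar (fun w => Omega x u v w);
  vol_alt12 : forall x u w, Omega x u u w = 0;
  vol_alt23 : forall x u v, Omega x u v v = 0;
  vol_alt13 : forall x u v, Omega x u v u = 0;
  vol_smooth : forall u v w, smooth_on setT (fun x => Omega x u v w : R^o);
  vol_neq0 : forall x, exists u v w, Omega x u v w != 0
}.

Definition eval_form Omega X Y Z : B -> R^o :=
  fun x => Omega x (X x) (Y x) (Z x).

(* (L_X Omega)(Z1, Z2, Z3), by the Leibniz rule for covariant tensors. *)
Definition lie_derivative X Omega Z1 Z2 Z3 : B -> R^o := fun x =>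
  vder X (eval_form Omega Z1 Z2 Z3) x
  - eval_form Omega (lie_bracket X Z1) Z2 Z3 x
  - eval_form Omega Z1 (lie_bracket X Z2) Z3 x
  - eval_form Omega Z1 Z2 (lie_bracket X Z3) x.

(* L_X Omega = h Omega on V *)
Definition lie_derivative_eq V X Omega (h : B -> R^o) : Prop :=
  forall Z1 Z2 Z3, smooth_on V Z1 -> smooth_on V Z2 -> smooth_on V Z3 ->
    forall x, V x ->
      lie_derivative X Omega Z1 Z2 Z3 x = h x * eval_form Omega Z1 Z2 Z3 x.

Definition linear_frame (v1 v2 v3 : 'rV[R]_3) : Prop :=
  basis_of fullv [:: v1; v2; v3].

Definition frame_set : Type :=
  B -> 'rV[R]_3 -> 'rV[R]_3 -> 'rV[R]_3 -> Prop.

Definition G2A_structure L1 L2 Omega : frame_set := fun x v1 v2 v3 =>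
  [/\ linear_frame v1 v2 v3, L1 x = <[v3]>%VS, L2 x = <[v2]>%VS &
      Omega x v1 v2 v3 = 1].

(* [psi] is a chart of B with domain [V] (compatible with the global chart) and
   [psi_inv] is its inverse. *)
Definition local_coordinates V (psi : B -> 'rV[R]_3) (psi_inv : 'rV[R]_3 -> B)
    : Prop :=
  [/\ open V, open (psi @` V), {in V, cancel psi psi_inv},
      smooth_on V psi & smooth (psi @` V) (@chart R B \o psi_inv)].

(* The coordinate vector field d/dpsi_i. *)
Definition coordinate_field (psi : B -> 'rV[R]_3) (psi_inv : 'rV[R]_3 -> B)
    (i : 'I_3) : vector_field :=
  fun x => partial i (@chart R B \o psi_inv) (psi x).

Definition integrable_structure (P : frame_set) : Prop :=
  forall x, exists V psi psi_inv,
    [/\ local_coordinates V psi psi_inv, V x &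
        forall y, V y -> P y (coordinate_field psi psi_inv 0 y)
                             (coordinate_field psi psi_inv 1 y)
                             (coordinate_field psi psi_inv 2 y)].

Definition local_frame V Y1 Y2 Y3 : Prop :=
  [/\ open V, smooth_on V Y1, smooth_on V Y2, smooth_on V Y3 &
      forall x, V x -> linear_frame (Y1 x) (Y2 x) (Y3 x)].

(* Y1 spans L1 and Y2 spans L2 here, whereas in [G2A_structure] the line L1 is
   spanned by the third vector of the frame. *)
Definition adapted_local_frame L1 L2 Omega V Y1 Y2 Y3 : Prop :=
  [/\ local_frame V Y1 Y2 Y3, section_of V L1 Y1, section_of V L2 Y2 &
      forall x, V x -> Omega x (Y1 x) (Y2 x) (Y3 x) = 1].

Definition tau Y1 Y2 (alpha beta h : B -> R^o) : B -> R^o := fun x =>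
  vder Y1 alpha x + vder Y2 h x + alpha x * h x - alpha x * beta x.

(* [alpha], [beta] and [h] are uniquely determined on [V] by the frame. *)
Definition tau_vanishes L1 L2 Omega : Prop :=
  forall V Y1 Y2 Y3, adapted_local_frame L1 L2 Omega V Y1 Y2 Y3 ->
  forall alpha beta h : B -> R^o,
    (forall x, V x ->
       lie_bracket Y1 Y2 x = alpha x *: Y1 x + beta x *: Y2 x) ->
    lie_derivative_eq V Y1 Omega h ->
  forall x, V x -> tau Y1 Y2 alpha beta h x = 0.

End Body.

Arguments vector_field {R} B.
Arguments distribution {R} B.
Arguments trilinear_form {R} B.
Arguments frame_set {R} B.

(* Main.v *)
(* If P is integrable, then in coordinates p with L1 = <d_2>, L2 = <d_1> and
   Omega = dp_0 /\ dp_1 /\ dp_2 an adapted frame has Y1 = f d_2 and Y2 = g d_1,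
   whence alpha = - Y2(f) / f, beta = Y1(g) / g, h = d_2 f, and tau vanishes.

   Conversely, Frobenius' theorem gives a common first integral p_0 of L1 and L2;
   together with a first integral p_1 of L1 and a first integral p_2 of L2 it
   yields coordinates where L1 = <d_2> and L2 = <d_1>. If r is the density of
   Omega there, the adapted frame (d_2, d_1, - d_0 / r) has alpha = beta = 0 and
   h = d_2 r / r, so tau = 0 says that d_1 d_2 log r = 0, that is,
   r = A(p_0, p_1) B(p_0, p_2). Replacing p_1 and p_2 by primitives of A and B
   keeps L1 and L2 and makes the density equal to 1.

   First integrals come from a scalar equation depending smoothly on parameters
   (Picard iteration, then a Gronwall estimate for each derivative) and from the
   inverse function theorem (Newton iteration). *)

(* Frobenius' theorem is brought down to scalar equations because a scalar linearized equation is
   solved explicitly by an integrating factor: smooth dependence on initial values then follows, by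
   induction on the order, from that of primitives with parameters. To reach scalar equations, [Y1]
   and [Y2] are recombined into [Z] and [W], each annihilating one of two linear coordinates. Once
   [Z] is a multiple of a coordinate field, involutivity says that the slope of [W] does not depend
   on that coordinate, which leaves an equation in two variables.

   Smoothness is stated with partial derivatives only; the link with increments is the exact formula
   f y - f x = sum (y_l - x_l) slope_l, with slopes that are values of partial derivatives at
   intermediate points. It serves the chain rule, the linearized equation and Newton's iteration
   alike. Functions known near a point are made globally continuous by a retraction onto a closed
   cube.

   The density r may be negative, so log r is never formed: d_1 (d_2 r / r) = 0 replaces d_1 d_2 log
   r = 0. *)
Require Import Defs.
From mathcomp Require Import all_boot all_order all_algebra.
From mathcomp Require Import all_classical all_reals topology normedtype derive.
From mathcomp Require Import interval_inference sequences realfun exp ring lra.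
From mathcomp Require Import measure lebesgue_measure lebesgue_integral ftc.
Set Implicit Arguments.
Unset Strict Implicit.
Unset Printing Implicit Defensive.
Import Order.TTheory GRing.Theory Num.Theory.
Import numFieldNormedType.Exports.
Local Open Scope classical_set_scope.
Local Open Scope ring_scope.

(** * Cubes, change of one coordinate, and the mean value theorem in three variables *)

Section Boxes.
Context {R : realType}.
Notation E := 'rV[R]_3.
Implicit Types (a x y : E) (i j k l : 'I_3) (r s e : R) (f g : E -> R^o).

Lemma ord3P (P : 'I_3 -> Prop) : P 0 -> P 1 -> P 2 -> forall l, P l.
Proof.
move=> p0 p1 p2 [[|[|[|//]]] hl].
- by rewrite (_ : Ordinal hl = 0) //; apply: val_inj.
- by rewrite (_ : Ordinal hl = 1) //; apply: val_inj.
- by rewrite (_ : Ordinal hl = 2) //; apply: val_inj.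
Qed.

Definition e_ i : E := delta_mx 0 i.

Definition upd x k s : E := \row_l (if l == k then s else x 0 l).

Lemma updE x k s l : upd x k s 0 l = if l == k then s else x 0 l.
Proof. by rewrite mxE. Qed.

Lemma upd_same x k s : upd x k s 0 k = s.
Proof. by rewrite updE eqxx. Qed.

Lemma upd_other x k s l : l != k -> upd x k s 0 l = x 0 l.
Proof. by rewrite updE => /negbTE ->. Qed.

Lemma upd_id x k : upd x k (x 0 k) = x.
Proof. by apply/rowP => l; rewrite updE; case: eqP => // ->. Qed.

Lemma upd_upd x k s t : upd (upd x k s) k t = upd x k t.
Proof. by apply/rowP => l; rewrite !updE; case: eqP. Qed.

Lemma upd_comm x j k s t : j != k ->
  upd (upd x j s) k t = upd (upd x k t) j s.
Proof.
move=> jk; apply/rowP => l; rewrite !updE.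
by case: (eqVneq l k) => // ->; rewrite eq_sym (negbTE jk).
Qed.

Lemma add_e_upd x k h : h *: e_ k + x = upd x k (h + x 0 k).
Proof.
by apply/rowP => l; rewrite updE !mxE /=; case: eqP => [->|_];
  rewrite ?mulr1 ?mulr0 ?add0r.
Qed.

(** Cubes are the balls of the sup norm ([ballE]). They suit partial derivatives: moving one
    coordinate towards that of the centre stays inside. *)
Definition box a r : set E := [set x | forall l, `|x 0 l - a 0 l| < r].

Lemma ballE a r x : 0 < r -> ball a r x = box a r x.
Proof.
move=> r0; rewrite propeqE; split => [[_ H] l|H].
  by have := H 0 l; rewrite /ball/= distrC.
by split=> // i l; rewrite (ord1 i) /ball /= distrC; apply: H.
Qed.

Lemma nbhs_boxP a (P : set E) :
  nbhs a P <-> exists2 r : R, 0 < r & forall x, box a r x -> P x.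
Proof.
split => [/nbhs_ballP[r /= r0 H]|[r r0 H]].
  by exists r => // x ax; apply: H; rewrite ballE.
by apply/nbhs_ballP; exists r => //= x; rewrite ballE //; apply: H.
Qed.

Lemma box_center a r : 0 < r -> box a r a.
Proof. by move=> r0 l; rewrite subrr normr0. Qed.

Lemma boxS a r s : r <= s -> box a r `<=` box a s.
Proof. by move=> rs x H l; apply: lt_le_trans rs; apply: H. Qed.

Lemma box_gt0 a r x : box a r x -> 0 < r.
Proof. by move=> /(_ 0); apply: le_lt_trans. Qed.

Lemma box_sub a r x : box a r x -> exists2 s : R, 0 < s & box x s `<=` box a r.
Proof.
move=> H; exists (\big[Num.min/1]_l (r - `|x 0 l - a 0 l|)).
  by elim/big_ind: _ => // [u v u0 v0|l _]; rewrite ?lt_min ?u0// subr_gt0.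
move=> y Hy l; have := Hy l; rewrite (bigD1 l) //= lt_min => /andP[+ _].
rewrite ltrBrDr; apply: le_lt_trans.
rewrite (_ : y 0 l - a 0 l = (y 0 l - x 0 l) + (x 0 l - a 0 l)); last by ring.
exact: ler_normD.
Qed.

Lemma box_forall a (P : 'I_3 -> E -> Prop) :
  (forall l, exists2 r : R, 0 < r & forall x, box a r x -> P l x) ->
  exists2 r : R, 0 < r & forall x, box a r x -> forall l, P l x.
Proof.
move=> H; have [r0 r00 H0] := H 0; have [r1 r10 H1] := H 1.
have [r2 r20 H2] := H 2; exists (Num.min r0 (Num.min r1 r2)).
  by rewrite !lt_min r00 r10.
move=> x bx; apply: ord3P; [apply: H0|apply: H1|apply: H2];
  by apply: boxS bx; rewrite !ge_min lexx ?orbT.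
Qed.

Lemma box_open a r : open (box a r).
Proof.
by rewrite openE => x /box_sub[s s0 H]; apply/nbhs_boxP; exists s.
Qed.

Lemma box_nbhs a r : 0 < r -> nbhs a (box a r).
Proof. by move=> r0; apply/nbhs_boxP; exists r. Qed.

(** The interval with unordered ends, so that increments of either sign need no case distinction. *)
Definition btw (a b c : R) := (a <= c <= b) || (b <= c <= a).

Lemma btwl (a b : R) : btw a b a.
Proof. by rewrite /btw lexx /= andbT; exact: le_total. Qed.

Lemma btwr (a b : R) : btw a b b.
Proof. by rewrite /btw lexx /= andbT; exact: le_total. Qed.

Lemma btw_dist (a b c : R) : btw a b c -> `|c - a| <= `|b - a|.
Proof.
case/orP => /andP[h1 h2].
  by rewrite !ger0_norm; lra.
by rewrite !ler0_norm; lra.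
Qed.

Lemma btw_norm (a b c d r : R) :
  `|a - d| < r -> `|b - d| < r -> btw a b c -> `|c - d| < r.
Proof. by rewrite !ltr_norml /btw; lra. Qed.

(** The hull is a box and not a segment, since the path from [x] to [y] used for the mean value
    theorem changes one coordinate at a time. *)
Definition sbox x y : set E := [set z | forall l, btw (x 0 l) (y 0 l) (z 0 l)].

Lemma sbox_box a r x y z : box a r x -> box a r y -> sbox x y z -> box a r z.
Proof. by move=> hx hy hz l; apply: btw_norm (hx l) (hy l) (hz l). Qed.

Lemma continuous_boxP f x : {for x, continuous f} <->
  forall e : R, 0 < e -> exists2 d : R, 0 < d & forall y, box x d y -> `|f y - f x| < e.
Proof.
split => [/(@cvgrPdist_lt _ R^o) H e e0|H].
  have /nbhs_boxP[d d0 Hd] := H _ e0; exists d => // y /Hd.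
  by rewrite distrC.
apply/(@cvgrPdist_lt _ R^o E (nbhs x) _ f (f x)) => e e0; apply/nbhs_boxP.
by have [d d0 Hd] := H _ e0; exists d => // y /Hd; rewrite distrC.
Qed.

Definition coord l : E -> R^o := fun y => y 0 l.

Lemma coord_continuous3 l x : {for x, continuous (coord l)}.
Proof. by apply/continuous_boxP => e e0; exists e => // y /(_ l). Qed.

Lemma derive_upd f x k :
  (fun h : R => h^-1 *: (f (h *: e_ k + x) - f x)) =
  (fun h : R => h^-1 *: (f (upd x k (h *: (1 : R^o) + x 0 k)) -
                         f (upd x k (x 0 k)))).
Proof. by apply/funext => h; rewrite add_e_upd upd_id scaler1. Qed.

Lemma derivable_upd f x k : derivable f x (e_ k) <->
  derivable (fun s : R^o => f (upd x k s)) (x 0 k) 1.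
Proof. by rewrite /derivable derive_upd. Qed.

Lemma partial_upd f x k :
  partial k f x = 'D_1 (fun s : R^o => f (upd x k s)) (x 0 k).
Proof. by rewrite /partial /derive derive_upd. Qed.

Lemma is_derive_upd f x k s : derivable f (upd x k s) (e_ k) ->
  is_derive (s : R^o) (1 : R^o) (fun s : R^o => f (upd x k s)) (partial k f (upd x k s)).
Proof.
have E : (fun t : R^o => f (upd (upd x k s) k t)) = (fun t => f (upd x k t)).
  by apply/funext => t; rewrite upd_upd.
move=> /derivable_upd; rewrite upd_same E => H; apply: DeriveDef => //.
by rewrite partial_upd E upd_same.
Qed.

Lemma is_derive_partial f x k d :
  is_derive (x 0 k : R^o) (1 : R^o) (fun s : R^o => f (upd x k s)) d ->
  derivable f x (e_ k) /\ partial k f x = d.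
Proof. by case=> H <-; split; [apply/derivable_upd|rewrite partial_upd]. Qed.

Lemma mvt_btw (f df : R^o -> R^o) (a b : R) :
  (forall x : R, btw a b x -> is_derive (x : R^o) (1 : R^o) f (df x)) ->
  exists2 c : R, btw a b c & f b - f a = df c * (b - a).
Proof.
wlog ab : a b / a <= b.
  move=> H Hd; have [ab|/ltW ba] := leP a b; first exact: H.
  have [|c cab E] := H b a ba; first by move=> x xba; apply: Hd; rewrite /btw orbC.
  by exists c; [rewrite /btw orbC|rewrite -opprB E -mulrN opprB].
move=> Hd; have [x|x|c cab E] := @MVT_segment R f df a b ab.
- rewrite in_itv /= => /andP[h1 h2]; apply: Hd.
  by rewrite /btw (ltW h1) (ltW h2).
- apply: derivable_within_continuous => y; rewrite in_itv /= => h.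
  by have [] := Hd y _; rewrite /btw ?h.
- by exists c => //; rewrite in_itv /= in cab; rewrite /btw cab.
Qed.

Lemma mvt_upd f x k s t :
  (forall u, btw s t u -> derivable f (upd x k u) (e_ k)) ->
  exists2 c, btw s t c &
    f (upd x k t) - f (upd x k s) = partial k f (upd x k c) * (t - s).
Proof.
move=> H; apply: (@mvt_btw (fun s : R^o => f (upd x k s))
  (fun s : R^o => partial k f (upd x k s))) => u hu.
exact/is_derive_upd/H.
Qed.

Lemma sum3 (V : nmodType) (F : 'I_3 -> V) : \sum_l F l = F 0 + F 1 + F 2.
Proof.
rewrite !big_ord_recl big_ord0 addr0 addrA.
by congr (F _ + F _ + F _); apply/val_inj.
Qed.

(** The path x, p1, p2, y replaces the coordinates one by one; the one-variable theorem applies to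
    each leg and yields one intermediate point per coordinate. *)
Lemma mvt3 f x y :
  (forall z k, sbox x y z -> derivable f z (e_ k)) ->
  exists xi : 'I_3 -> E, (forall l, sbox x y (xi l)) /\
    f y - f x = \sum_l (y 0 l - x 0 l) * partial l f (xi l).
Proof.
move=> H.
pose p1 := upd x 0 (y 0 0); pose p2 := upd p1 1 (y 0 1).
have p3 : upd p2 2 (y 0 2) = y.
  by apply/rowP; apply: ord3P; rewrite !updE.
have [c0 b0 E0] : exists2 c, btw (x 0 0) (y 0 0) c &
    f p1 - f x = partial 0 f (upd x 0 c) * (y 0 0 - x 0 0).
  rewrite -{2}(upd_id x 0); apply: mvt_upd => u hu; apply: H.
  by apply: ord3P; rewrite updE //= ?btwl.
have [c1 b1 E1] : exists2 c, btw (x 0 1) (y 0 1) c &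
    f p2 - f p1 = partial 1 f (upd p1 1 c) * (y 0 1 - x 0 1).
  have q1 : upd p1 1 (x 0 1) = p1 by apply/rowP; apply: ord3P; rewrite !updE.
  have [u hu|c cb] := @mvt_upd f p1 1 (x 0 1) (y 0 1); last first.
    by rewrite q1; exists c.
  by apply: H; apply: ord3P; rewrite ?updE //= ?updE ?btwl ?btwr.
have [c2 b2 E2] : exists2 c, btw (x 0 2) (y 0 2) c &
    f y - f p2 = partial 2 f (upd p2 2 c) * (y 0 2 - x 0 2).
  have q2 : upd p2 2 (x 0 2) = p2 by apply/rowP; apply: ord3P; rewrite !updE.
  have [u hu|c cb] := @mvt_upd f p2 2 (x 0 2) (y 0 2); last first.
    by rewrite q2 p3; exists c.
  by apply: H; apply: ord3P; rewrite ?updE //= ?updE //= ?updE ?btwl ?btwr.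
exists (fun l => if l == 0 then upd x 0 c0 else
                 if l == 1 then upd p1 1 c1 else upd p2 2 c2); split.
  apply: ord3P => /=; apply: ord3P;
    by rewrite ?updE //= ?updE //= ?updE //= ?updE ?btwl ?btwr.
rewrite sum3.
rewrite /= !(mulrC (y _ _ - _)) -E0 -E1 -E2; ring.
Qed.

End Boxes.

(** * Differential calculus for [Ck]: algebra, chain rule, symmetry of second derivatives *)

Section Calculus.
Context {R : realType}.
Notation E := 'rV[R]_3.
Implicit Types (a x y v : E) (i j k l : 'I_3) (r s : R) (f g : E -> R^o).
Implicit Types (U V : set E) (T : E -> E) (n m : nat).

Lemma eq_Ck (W : normedModType R) n U (f g : E -> W) : open U ->
  (forall y, U y -> f y = g y) -> Ck n U f -> Ck n U g.
Proof.
move=> oU; elim: n f g => [|n IH] f g fg /= [cf Hf].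
  split => // y Uy; have nfg : {near y, f =1 g}.
    by apply: filterS fg _; exact: open_nbhs_nbhs.
  rewrite /prop_for /continuous_at -fg //.
  by apply: cvg_trans (cf y Uy); exact: (@near_eq_cvg _ _ (nbhs y) _ _ _ nfg).
have nfg y : U y -> {near y, f =1 g}.
  by move=> Uy; apply: filterS fg _; exact: open_nbhs_nbhs.
split => [y Uy|i].
  rewrite /prop_for /continuous_at -fg //.
  by apply: cvg_trans (cf y Uy); exact: (@near_eq_cvg _ _ (nbhs y) _ _ _ (nfg y Uy)).
have [df Cf] := Hf i; split => [y Uy|].
  by apply: near_eq_derivable (df y Uy); exact: nfg.
by apply: IH Cf => y Uy; apply: near_eq_derive; exact: nfg.
Qed.

Lemma Ck_continuous (W : normedModType R) n U (f : E -> W) : Ck n U f ->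
  forall y, U y -> {for y, continuous f}.
Proof. by case: n => [|n] []. Qed.

Lemma CkS (W : normedModType R) n U (f : E -> W) : Ck n.+1 U f -> Ck n U f.
Proof.
elim: n f => [|n IH] f; first by case.
by case=> cf H; split => // i; have [? ?] := H i; split => //; exact: IH.
Qed.

Lemma Ck_subset (W : normedModType R) n U V (f : E -> W) : V `<=` U ->
  Ck n U f -> Ck n V f.
Proof.
move=> VU; elim: n f => [|n IH] f /= [cf H]; first by split=> // y /VU/cf.
split=> [y /VU/cf //|i]; have [? ?] := H i; split; last exact: IH.
by move=> y /VU; auto.
Qed.

Lemma Ck_partial n U f i : Ck n.+1 U f -> Ck n U (partial i f).
Proof. by move=> [_ /(_ i)[]]. Qed.

Lemma Ck_derivable n U f i y : Ck n.+1 U f -> U y -> derivable f y (e_ i).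
Proof. by move=> [_ /(_ i)[+ _]]; apply. Qed.

(** The form used in all inductions on the order: a formula for the derivatives, valid on [U], is
    enough to raise the class by one. *)
Lemma Ck_step n U f : open U -> (forall y, U y -> {for y, continuous f}) ->
  (forall i, exists g, (forall y, U y -> derivable f y (e_ i) /\
     partial i f y = g y) /\ Ck n U g) -> Ck n.+1 U f.
Proof.
move=> oU cf H; split => // i; have [g [dg Cg]] := H i; split.
  by move=> y /dg[].
by apply: eq_Ck Cg => // y /dg[].
Qed.

Lemma Ck_cst n U (c : R) : Ck n U (fun=> c : R^o).
Proof.
elim: n c => [|n IH] c.
  by split => // y _; exact: cst_continuous.
split=> [y _|i]; first exact: cst_continuous.
split=> [y _|]; first exact: derivable_cst.
rewrite (_ : partial i _ = fun=> 0); first exact: IH.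
by apply/funext => y; exact: derive_cst.
Qed.

Lemma partial_coord i l y : derivable (coord l : E -> R^o) y (e_ i) /\
  partial i (coord l) y = (l == i)%:R.
Proof.
apply: is_derive_partial; rewrite /coord.
have [->|li] := eqVneq l i.
  rewrite (_ : (fun _ => _) = (id : R^o -> R^o)) /=; first exact: is_derive_id.
  by apply/funext => s /=; rewrite upd_same.
rewrite (_ : (fun _ => _) = (fun=> y 0 l : R^o)) /=; first exact: is_derive_cst.
by apply/funext => s /=; rewrite upd_other.
Qed.

Lemma Ck_coord n U l : open U -> Ck n U (coord l : E -> R^o).
Proof.
move=> oU; case: n => [|n].
  by split => // y _; exact: coord_continuous3.
apply: Ck_step => // [y _|i]; first exact: coord_continuous3.
exists (fun=> (l == i)%:R); split; last exact: Ck_cst.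
by move=> y _; exact: partial_coord.
Qed.

Lemma CkD n U f g : open U -> Ck n U f -> Ck n U g ->
  Ck n U (fun y => f y + g y : R^o).
Proof.
move=> oU; elim: n f g => [|n IH] f g Cf Cg.
  split => // y Uy.
  by apply: (@continuousD _ R^o); [case: Cf|case: Cg] => + _; apply.
apply: Ck_step => // [y Uy|i].
  by apply: (@continuousD _ R^o); apply: Ck_continuous Uy; eassumption.
exists (fun y => partial i f y + partial i g y); split; last first.
  by apply: IH; exact: Ck_partial.
move=> y Uy; have df := Ck_derivable (i := i) Cf Uy; have dg := Ck_derivable (i := i) Cg Uy.
by split; [exact: (derivableD df dg)|exact: (deriveD df dg)].
Qed.

Lemma CkM n U f g : open U -> Ck n U f -> Ck n U g ->
  Ck n U (fun y => f y * g y : R^o).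
Proof.
move=> oU; elim: n f g => [|n IH] f g Cf Cg.
  split => // y Uy.
  by apply: (@continuousM R E); [case: Cf|case: Cg] => + _; apply.
apply: Ck_step => // [y Uy|i].
  by apply: (@continuousM R E); apply: Ck_continuous Uy; eassumption.
exists (fun y => f y * partial i g y + g y * partial i f y); split; last first.
  by apply: CkD => //; apply: IH; do ?[exact: Ck_partial|exact: CkS].
move=> y Uy; have df := Ck_derivable (i := i) Cf Uy; have dg := Ck_derivable (i := i) Cg Uy.
by split; [exact: (derivableM df dg)|exact: (deriveM df dg)].
Qed.

Lemma CkN n U f : open U -> Ck n U f -> Ck n U (fun y => - f y : R^o).
Proof.
move=> oU Cf; apply: (@eq_Ck _ _ _ (fun y => (-1) * f y)) => //.
  by move=> y _; rewrite mulN1r.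
by apply: CkM => //; exact: Ck_cst.
Qed.

Lemma CkV n U f : open U -> (forall y, U y -> f y != 0) -> Ck n U f ->
  Ck n U (fun y => (f y)^-1 : R^o).
Proof.
move=> oU f0; elim: n => [|n IH] Cf.
  split => // y Uy; apply: (@continuousV R E); first exact: f0.
  by case: Cf => + _; apply.
apply: Ck_step => // [y Uy|i].
  by apply: (@continuousV R E); [exact: f0|apply: Ck_continuous Cf _ Uy].
exists (fun y => - ((f y)^-1 * ((f y)^-1 * partial i f y))); split; last first.
  by apply: CkN => //; do 2![apply: CkM; rewrite //; first exact/IH/CkS];
    exact: Ck_partial.
move=> y Uy; have df := Ck_derivable (i := i) Cf Uy.
split; first exact: (derivableV (f0 y Uy) df).
rewrite /partial (deriveV (f0 y Uy) df).
by rewrite mulrA -mulNr; congr (- _ * _); rewrite -invfM -expr2.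
Qed.

Lemma Ck_exp n U f : open U -> Ck n U f -> Ck n U (fun y => expR (f y) : R^o).
Proof.
move=> oU; have cont g y : {for y, continuous g} ->
    {for y, continuous (fun y => expR (g y) : R^o)}.
  by move=> cg; apply: continuous_comp => //; exact: continuous_expR.
elim: n => [|n IH] Cf.
  by split => // y Uy; apply: cont; apply: Ck_continuous Cf _ Uy.
apply: Ck_step => // [y Uy|i].
  by apply: cont; apply: Ck_continuous Cf _ Uy.
exists (fun y => expR (f y) * partial i f y); split; last first.
  by apply: CkM => //; [exact/IH/CkS|exact: Ck_partial].
move=> y Uy; have df := Ck_derivable (i := i) Cf Uy.
apply: is_derive_partial.
have /derivable_upd H := df; rewrite partial_upd.
have -> : expR (f y) = expR (f (upd y i (y 0 i))) by rewrite upd_id.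
have := @is_derive1_comp _ (expR : R^o -> R^o)
  (fun s : R^o => f (upd y i s)) (y 0 i) (expR (f (upd y i (y 0 i))))
  ('D_1 (fun s : R^o => f (upd y i s)) (y 0 i)).
by move=> H1; exact: (H1 (is_derive_expR _) (derivableP H)).
Qed.

Lemma Ck_sum n U (I : Type) (s : seq I) (P : pred I) (F : I -> E -> R^o) :
  open U -> (forall p, Ck n U (F p)) ->
  Ck n U (fun y => \sum_(p <- s | P p) F p y : R^o).
Proof.
move=> oU H; elim: s => [|p s IH].
  by apply: eq_Ck (@Ck_cst n U 0) => // y _; rewrite big_nil.
have C : Ck n U (fun y => F p y + \sum_(p <- s | P p) F p y) by exact: CkD.
case Pi : (P p).
  by apply: eq_Ck C => // y _; rewrite big_cons Pi.
by apply: eq_Ck IH => // y _; rewrite big_cons Pi.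
Qed.

Lemma Ck_prod n U (I : Type) (s : seq I) (F : I -> E -> R^o) :
  open U -> (forall p, Ck n U (F p)) ->
  Ck n U (fun y => \prod_(p <- s) F p y : R^o).
Proof.
move=> oU H; elim: s => [|p s IH].
  by apply: eq_Ck (@Ck_cst n U 1) => // y _; rewrite big_nil.
have C : Ck n U (fun y => F p y * \prod_(p <- s) F p y) by exact: CkM.
by apply: eq_Ck C => // y _; rewrite big_cons.
Qed.

Lemma Ck_det n U m (A : E -> 'M[R]_m) :
  open U -> (forall p q, Ck n U (fun y => A y p q : R^o)) ->
  Ck n U (fun y => \det (A y) : R^o).
Proof.
move=> oU H; rewrite /determinant; apply: Ck_sum => // s.
by apply: CkM => //; [exact: Ck_cst|exact: Ck_prod].
Qed.

(** Cramer's formula: the entries of the inverse are signed minors divided by the determinant. *)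
Lemma Ck_invmx n U m (A : E -> 'M[R]_m) p q :
  open U -> (forall p q, Ck n U (fun y => A y p q : R^o)) ->
  (forall y, U y -> \det (A y) != 0) ->
  Ck n U (fun y => invmx (A y) p q : R^o).
Proof.
move=> oU H d0.
apply: (@eq_Ck _ _ _ (fun y => (\det (A y))^-1 *
   ((-1) ^+ (q + p) * \det (row' q (col' p (A y)))))) => //.
  by move=> y Uy; rewrite /invmx unitmxE unitfE d0 // !mxE.
apply: CkM => //; first by apply: CkV => //; exact: Ck_det.
apply: CkM => //; first exact: Ck_cst.
apply: Ck_det => // i' j'.
by apply: eq_Ck (H (lift q i') (lift p j')) => // y _; rewrite !mxE.
Qed.

(** A choice of the intermediate values of [mvt3], made for the three indices at once. The default
    point [x] lies in [sbox x y], so [slope_sbox] holds unconditionally. *)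
Definition slope f x y l : R :=
  partial l f (xget (fun=> x) [set xi : 'I_3 -> E |
    (forall l, sbox x y (xi l)) /\
    f y - f x = \sum_l (y 0 l - x 0 l) * partial l f (xi l)] l).

Lemma slopeE f x y : (forall z k, sbox x y z -> derivable f z (e_ k)) ->
  f y - f x = \sum_l (y 0 l - x 0 l) * slope f x y l.
Proof.
move=> /mvt3 [xi H]; rewrite /slope; case: xgetP => [z _ [_ <-] //|H'].
by case: (H' xi).
Qed.

Lemma slope_sbox f x y l : exists2 z, sbox x y z & slope f x y l = partial l f z.
Proof.
rewrite /slope; case: xgetP => [z _ [H _]|_]; first by exists (z l).
by exists x => // l'; exact: btwl.
Qed.

Lemma slope_lim f a l : {for a, continuous (partial l f)} ->
  forall e : R, 0 < e -> exists2 d : R, 0 < d &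
    forall x y, box a d x -> box a d y -> `|slope f x y l - partial l f a| < e.
Proof.
move=> /continuous_boxP H e /H[d d0 Hd]; exists d => // x y ax ay.
by have [z xyz ->] := slope_sbox f x y l; apply: Hd; exact: sbox_box xyz.
Qed.

Definition C1at f a := (\forall y \near a, forall k, derivable f y (e_ k)) /\
  forall k, {for a, continuous (partial k f)}.

Lemma C1at_Ck n U f y : open U -> Ck n.+1 U f -> U y -> C1at f y.
Proof.
move=> oU Cf Uy; split=> [|k].
  have : nbhs y U by exact: open_nbhs_nbhs.
  by apply: filterS => z Uz k; exact: Ck_derivable Cf Uz.
by apply: Ck_continuous Uy; exact: Ck_partial Cf.
Qed.

(** The difference quotient of f along c is the sum of the quotients of the coordinates of c times
    slopes of f, and the slopes tend to the partial derivatives by their continuity. Total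
    differentiability is bypassed. *)
Lemma is_derive_curve f (c : R^o -> E) (t : R^o) (d : 'I_3 -> R) :
  C1at f (c t) ->
  (forall l, is_derive t (1 : R^o) (fun s => c s 0 l : R^o) (d l)) ->
  is_derive t (1 : R^o) (fun s => f (c s)) (\sum_l d l * partial l f (c t)).
Proof.
move=> [Df cf] Dc.
have cc l : {for t, continuous (fun s => c s 0 l : R^o)}.
  by apply: differentiable_continuous; apply/derivable1_diffP; case: (Dc l).
have box_c r : 0 < r -> \forall h \near 0^', box (c t) r (c (h + t)).
  move=> r0; near=> h => l; move: l; near: h; apply: filter_forall => l.
  have /(@cvgrPdist_lt _ R^o)/(_ _ r0) := cc l.
  move=> /nbhs_ballP[q /= q0 Hq]; near=> h; rewrite distrC; apply: Hq.
  rewrite /ball /= opprD addrCA subrr addr0 normrN.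
  by near: h; exact: dnbhs0_lt.
suff L : (fun h : R => h^-1 *: (f (c (h *: (1:R^o) + t)) - f (c t))) @ 0^' -->
    (\sum_l d l * partial l f (c t) : R^o).
  apply: DeriveDef; first by apply/cvg_ex; eexists; exact: L.
  by apply: cvg_lim => //; exact: L.
have /nbhs_boxP[r r0 Hr] := Df.
pose F l (h : R) : R^o := (h^-1 *: (c (h *: (1:R^o) + t) 0 l - c t 0 l : R^o))
  * slope f (c t) (c (h + t)) l.
have HF l : F l h @[h --> 0^'] --> (d l * partial l f (c t) : R^o).
  apply: (@cvgM R _ 0^').
    have [Dl <-] := Dc l; exact: Dl.
  apply/cvgrPdist_lt => e e0; have [q q0 Hq] := slope_lim (cf l) e0.
  near=> h; rewrite distrC; apply: Hq; first exact: box_center.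
  by near: h; exact: box_c.
rewrite sum3; apply: cvg_trans (cvgD (cvgD (HF 0) (HF 1)) (HF 2)).
apply: near_eq_cvg; near=> h.
have bh : box (c t) r (c (h + t)) by near: h; exact: box_c.
rewrite -[LHS]/(F 0 h + F 1 h + F 2 h) -(sum3 (fun l => F l h)) /F !scaler1 slopeE.
  by rewrite scaler_sumr; apply: eq_bigr => l _; rewrite /GRing.scale /= mulrA.
by move=> z k hz; apply: Hr; apply: sbox_box hz => //; exact: box_center.
Unshelve. all: by end_near. Qed.

Lemma is_derive_line (W : normedModType R) (F : E -> W) y v w :
  is_derive (0 : R^o) (1 : R^o) (fun h : R^o => F (h *: v + y)) w <-> is_derive y v F w.
Proof.
have E : (fun h : R => h^-1 *: (F ((h *: (1:R^o) + 0) *: v + y) - F ((0:R^o) *: v + y)))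
   = (fun h : R => h^-1 *: (F (h *: v + y) - F y)).
  by apply/funext => h; rewrite addr0 scaler1 scale0r add0r.
by split=> -[H <-]; apply: DeriveDef;
  rewrite /derivable /derive ?E -?E //; move: H; rewrite /derivable ?E -?E.
Qed.

Lemma is_derive_dir f y v : C1at f y ->
  is_derive y v f (\sum_l v 0 l * partial l f y).
Proof.
move=> Cf; apply/is_derive_line.
have e : (0 : R^o) *: v + y = y by rewrite scale0r add0r.
rewrite -{2}e; apply: (@is_derive_curve f (fun h : R^o => h *: v + y) 0).
  by rewrite e.
move=> l.
rewrite (_ : (fun _ => _) = (fun s : R^o => v 0 l * s + y 0 l)).
  have H1 : is_derive (0:R^o) (1:R^o) (v 0 l *: (id : R^o -> R^o)) (v 0 l *: (1:R^o)).
    exact: is_deriveZ.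
  have := is_deriveD H1 (is_derive_cst (y 0 l : R^o) (0 : R^o) (1 : R^o)).
  by rewrite addr0 (_ : v 0 l *: (1:R^o) = v 0 l) //; exact: mulr1.
by apply/funext => s; rewrite !mxE mulrC.
Qed.

Lemma is_derive_comp3 f T y v (d : 'I_3 -> R) : C1at f (T y) ->
  (forall l, is_derive y v (fun z => T z 0 l : R^o) (d l)) ->
  is_derive y v (fun z => f (T z)) (\sum_l d l * partial l f (T y)).
Proof.
move=> Cf HT; apply/is_derive_line.
have e : (0 : R^o) *: v + y = y by rewrite scale0r add0r.
rewrite -{2}e; apply: (@is_derive_curve f (fun h : R^o => T (h *: v + y)) 0).
  by rewrite e.
by move=> l; apply/is_derive_line.
Qed.

Lemma continuous_comp3 f T y :
  (forall l, {for y, continuous (fun z => T z 0 l : R^o)}) ->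
  {for T y, continuous f} -> {for y, continuous (fun z => f (T z))}.
Proof.
move=> cT /continuous_boxP cf; apply/continuous_boxP => e /cf[d d0 Hd].
have [q q0 Hq] : exists2 q : R, 0 < q &
    forall z, box y q z -> forall l, `|T z 0 l - T y 0 l| < d.
  by apply: box_forall => l; have /continuous_boxP/(_ d d0) := cT l.
by exists q => // z /Hq; exact: Hd.
Qed.

(** The induction generalizes f: the derivatives of the composite involve [partial l f] composed
    with the same [T], one order lower. *)
Lemma Ck_comp n U V f T : open U -> open V -> (forall y, U y -> V (T y)) ->
  (forall l, Ck n U (fun z => T z 0 l : R^o)) -> Ck n V f ->
  Ck n U (fun z => f (T z)).
Proof.
move=> oU oV UV; elim: n f => [|n IH] f CT Cf.
  split => // y Uy; apply: continuous_comp3 => [l|].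
    exact: Ck_continuous (CT l) _ Uy.
  exact: Ck_continuous Cf _ (UV _ Uy).
apply: Ck_step => // [y Uy|i].
  apply: continuous_comp3 => [l|].
    exact: Ck_continuous (CT l) _ Uy.
  exact: Ck_continuous Cf _ (UV _ Uy).
exists (fun y => \sum_l partial i (fun z => T z 0 l : R^o) y * partial l f (T y)).
split; last first.
  apply: Ck_sum => // l; apply: CkM => //; first exact: Ck_partial.
  by apply: IH; [move=> l'; exact: CkS|exact: Ck_partial].
move=> y Uy; have := @is_derive_comp3 f T y (e_ i) _ (C1at_Ck oV Cf (UV _ Uy)).
move=> /(_ (fun l => partial i (fun z => T z 0 l : R^o) y)) [|//].
by move=> l; apply/derivableP; exact: Ck_derivable (CT l) Uy.
Qed.

Let dist_le_mid (p q c e : R) : `|c - p| < e / 2 -> `|c - q| < e / 2 ->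
  `|p - q| <= e.
Proof. by rewrite !ltr_norml ler_norml; lra. Qed.

Let mul_hh (P h : R) : P * h * h = h * h * P.
Proof. ring. Qed.

Let second_difference_uniq (A B C D P Q h : R) : 0 < h ->
  A - B - (C - D) = h * h * P -> A - C - (B - D) = h * h * Q -> Q = P.
Proof.
move=> h0 E1 E2; have hn : h * h != 0 by rewrite mulf_neq0 // gt_eqF.
by apply: (mulfI hn); rewrite -E1 -E2; ring.
Qed.

(** Two mean value theorems: one in direction i for the difference of f between the levels a_j + h
    and a_j, then one in direction j for [partial i f]. *)
Lemma second_difference f a i j h : i != j -> 0 < h ->
  (forall x, box a (h + h) x -> [/\ derivable f x (e_ i), derivable f x (e_ j) &
    derivable (partial i f) x (e_ j)]) ->
  exists2 x, box a (h + h) x &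
    f (upd (upd a i (a 0 i + h)) j (a 0 j + h)) - f (upd a i (a 0 i + h))
    - (f (upd a j (a 0 j + h)) - f a) = h * h * partial j (partial i f) x.
Proof.
move=> ij h0 H; have ji : j != i by rewrite eq_sym.
have bx s t : btw (a 0 i) (a 0 i + h) s -> btw (a 0 j) (a 0 j + h) t ->
    box a (h + h) (upd (upd a i s) j t).
  move=> bs bt l; rewrite !updE.
  case: eqP => [->|_]; last case: eqP => [->|_].
  - by move: bt; rewrite /btw ltr_norml; lra.
  - by move: bs; rewrite /btw ltr_norml; lra.
  - by rewrite subrr normr0; lra.
pose G (s : R^o) : R^o := f (upd (upd a i s) j (a 0 j + h)) - f (upd a i s).
have updj s : upd a i s = upd (upd a i s) j (a 0 j).
  apply/rowP => l; rewrite !updE; case: (eqVneq l j) => [->|//].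
  by rewrite (negbTE ji).
pose dG (s : R^o) : R^o := partial i f (upd (upd a i s) j (a 0 j + h))
  - partial i f (upd a i s).
have [s bs|c cb E1] := @mvt_btw _ G dG (a 0 i) (a 0 i + h).
  apply: is_deriveB.
    under [X in is_derive _ _ X _]eq_fun do rewrite upd_comm //.
    rewrite upd_comm //; apply: is_derive_upd; rewrite -upd_comm //.
    by have [] := H _ (bx s (a 0 j + h) bs (btwr _ _)).
  apply: is_derive_upd; rewrite updj.
  by have [] := H _ (bx s (a 0 j) bs (btwl _ _)).
have [t bt|q qb E2] := @mvt_upd _ (partial i f) (upd a i c) j (a 0 j) (a 0 j + h).
  by have [] := H _ (bx c t cb bt).
exists (upd (upd a i c) j q); first exact: bx.
move: E1; rewrite /G /dG upd_id; rewrite -updj in E2; rewrite E2 => ->.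
rewrite (addrAC (a 0 j)) subrr add0r (addrAC (a 0 i)) subrr add0r.
exact: mul_hh.
Qed.

(** Schwarz's theorem. The second difference is symmetric in i and j, so the two mixed derivatives
    take a common value at two points near [a]; continuity at [a] brings them within any e. *)
Lemma partial_comm U f i j a : open U -> Ck 2 U f -> U a ->
  partial i (partial j f) a = partial j (partial i f) a.
Proof.
move=> oU Cf Ua; have [->//|ij] := eqVneq i j.
have ji : j != i by rewrite eq_sym.
apply/eqP; rewrite -subr_eq0 -normr_le0; apply/ler_addgt0Pl => e e0; rewrite addr0.
have cij k l : {for a, continuous (partial k (partial l f))}.
  by apply: Ck_continuous Ua; do 2!apply: Ck_partial; exact: Cf.
have e2 : 0 < e / 2 by lra.
have /continuous_boxP/(_ _ e2)[d1 d10 H1] := cij i j.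
have /continuous_boxP/(_ _ e2)[d2 d20 H2] := cij j i.
have /nbhs_boxP[d3 d30 H3] : nbhs a U by exact: open_nbhs_nbhs.
(* [second_difference] places its point in the cube of radius h + h, hence half of the smallest
   radius. *)
have [h [h0 hd1 hd2 hd3]] : exists h : R,
    [/\ 0 < h, h + h <= d1, h + h <= d2 & h + h <= d3].
  have d0 : 0 < Num.min d1 (Num.min d2 d3) by rewrite !lt_min d10 d20.
  exists (Num.min d1 (Num.min d2 d3) / 2).
  by rewrite -splitr divr_gt0 // !ge_min !lexx !orbT.
have [x bx|x xb Ex] := @second_difference f a i j h ij h0.
  have Ux : U x by apply: H3; apply: boxS bx.
  split; [exact: (Ck_derivable (i := i) Cf Ux)|exact: (Ck_derivable (i := j) Cf Ux)|].
  exact: (Ck_derivable (i := j) (Ck_partial i Cf) Ux).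
have [y By|y yb Ey] := @second_difference f a j i h ji h0.
  have Ux : U y by apply: H3; apply: boxS By.
  split; [exact: (Ck_derivable (i := j) Cf Ux)|exact: (Ck_derivable (i := i) Cf Ux)|].
  exact: (Ck_derivable (i := i) (Ck_partial j Cf) Ux).
have eq : partial i (partial j f) y = partial j (partial i f) x.
  by rewrite (upd_comm a _ _ ji) in Ey; exact: (second_difference_uniq h0 Ex Ey).
have A := H1 y (boxS hd1 yb); have B := H2 x (boxS hd2 xb).
by rewrite eq in A; exact: (dist_le_mid A B).
Qed.

End Calculus.

(** * Primitives, a Gronwall estimate, and Picard's theorem in one variable *)

Section OneVariable.
Context {R : realType}.
Implicit Types (f F phi : R^o -> R^o) (c r s t K M B : R).

Lemma primitive_right f (A : R) : continuous f ->
  exists F, forall t, A < t -> is_derive (t : R^o) (1 : R^o) F (f t).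
Proof.
move=> cf.
exists (fun t => (\int[@lebesgue_measure R]_(s in `[A, t]) f s)%R) => t At.
have ts : t < t + 1 by rewrite ltrDl.
have int : (@lebesgue_measure R).-integrable `[A, t + 1] (EFin \o f).
  apply: continuous_compact_integrable; first exact: segment_compact.
  exact: continuous_subspaceT.
have [d e] := continuous_FTC1_closed ts int At (cf t).
by apply: DeriveDef; [exact: d|rewrite -derive1E; exact: e].
Qed.

(** [primitive_right] only reaches the right of a base point. The left side comes from the primitive
    of s |-> f (- s), reflected; both candidates have derivative f on ]c - 1, c + 1[, so they agree
    there up to a constant and can be glued at c. *)
Lemma primitive f c : continuous f ->
  exists F, F c = 0 /\ forall t, is_derive (t : R^o) (1 : R^o) F (f t).
Proof.
move=> cf.
have [G HG] := primitive_right (c - 1) cf.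
have cfN : continuous (fun s : R^o => f (- s)).
  move=> s; apply: (@continuous_comp _ _ _ (fun s : R^o => - s) f); last exact: cf.
  exact: opp_continuous.
have [H0 HH0] := primitive_right (- c - 1) cfN.
pose H (t : R^o) : R^o := - H0 (- t).
have HH t : t < c + 1 -> is_derive (t : R^o) (1 : R^o) H (f t).
  move=> tc; have t' : - c - 1 < - t by rewrite -opprD ltrN2.
  have D := HH0 _ t'; rewrite opprK in D.
  have E : is_derive (t : R^o) (1 : R^o) (fun t : R^o => H0 (- t)) (f t * (-1)).
    exact: (@is_derive1_comp _ H0 (fun t : R^o => - t)).
  by have := is_deriveN E; rewrite mulrN1 opprK.
have agree t : c - 1 < t -> t < c + 1 -> G t - G c = H t - H c.
  move=> t1 t2.
  have [x xt|x _] := @mvt_btw _ (G - H) (fun=> 0) c t.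
    rewrite -(subrr (f x)); apply: is_deriveB; [apply: HG|apply: HH];
      by move: xt; rewrite /btw => /orP[]/andP[*]; lra.
  rewrite mul0r => /eqP; rewrite subr_eq0 => /eqP.
  rewrite -[(G - H) t]/(G t - H t) -[(G - H) c]/(G c - H c).
  by move: (G t) (H t) (G c) (H c) => p q p' q' /= e; apply/eqP; lra.
pose F (t : R^o) : R^o := if c <= t then G t - G c else H t - H c.
have FG t : c - 1 < t -> F t = G t - G c.
  move=> t1; rewrite /F; case: leP => // tc; rewrite agree //.
  by apply: lt_trans tc _; rewrite ltrDl.
have FH t : t < c + 1 -> F t = H t - H c.
  move=> t1; rewrite /F; case: leP => // tc; rewrite agree //.
  by apply: lt_le_trans tc; rewrite ltrBlDr ltrDl.
exists F; split; first by rewrite FG ?subrr // ltrBlDr ltrDl.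
move=> t; have [tc|tc] := ltP (c - 1) t.
  have D : is_derive (t : R^o) (1 : R^o) (G - cst (G c)) (f t - 0).
    by apply: is_deriveB; exact: HG.
  rewrite subr0 in D; apply: near_eq_is_derive D.
  near=> s; rewrite FG //; near: s; exact: lt_nbhsr.
have tc' : t < c + 1 by apply: le_lt_trans tc _; lra.
have D : is_derive (t : R^o) (1 : R^o) (H - cst (H c)) (f t - 0).
  by apply: is_deriveB; exact: HH.
rewrite subr0 in D; apply: near_eq_is_derive D.
near=> s; rewrite FH //; near: s; exact: lt_nbhsl.
Unshelve. all: by end_near. Qed.

(** No exponential: at a point where |phi| is maximal the mean value theorem gives max <= |phi c| +
    r (K max + B), and r K <= 1/2 lets half of the maximum be absorbed, whence the factor 2. *)
Lemma gronwall_small phi (dphi : R -> R) c r K B : 0 <= r -> r * K <= 1 / 2 ->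
  0 <= K -> 0 <= B ->
  (forall t, `|t - c| <= r -> is_derive (t : R^o) (1 : R^o) phi (dphi t)) ->
  (forall t, `|t - c| <= r -> `|dphi t| <= K * `|phi t| + B) ->
  forall t, `|t - c| <= r -> `|phi t| <= 2 * (`|phi c| + r * B).
Proof.
move=> r0 rK K0 B0 Hd Hb.
have inb t : (t \in `[c - r, c + r]) = (`|t - c| <= r).
  by rewrite in_itv /= ler_distl.
have cr : c - r <= c + r by lra.
have cphi : {within `[c - r, c + r], continuous (fun t : R => `|phi t| : R)}.
  have : {within `[c - r, c + r], continuous phi}.
    apply: derivable_within_continuous => t; rewrite inb => /Hd; by case.
  by move=> cp t; apply: continuous_comp (cp t) _; exact: norm_continuous.
have [t0] := EVT_max cr cphi; rewrite inb => t0r Hmax.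
have [x xt|x xt E] := @mvt_btw _ phi dphi c t0.
  by apply: Hd; apply: le_trans (btw_dist xt) t0r.
have xr : `|x - c| <= r by apply: le_trans (btw_dist xt) t0r.
have key : `|phi t0| <= `|phi c| + (K * `|phi t0| + B) * r.
  have := ler_normD (phi c) (phi t0 - phi c); rewrite (addrC (phi c)) subrK.
  move=> /le_trans; apply; rewrite lerD2l E normrM.
  apply: ler_pM => //; apply: le_trans (Hb _ xr) _.
  by rewrite lerD2r; apply: ler_wpM2l => //; apply: Hmax; rewrite inb.
move=> t tr; have := Hmax t; rewrite inb => /(_ tr).
have aux (p q b : R) : 0 <= p -> p <= q + (K * p + b) * r -> p <= 2 * (q + r * b).
  move=> p0 h.
  have : r * K * p <= 1 / 2 * p by apply: ler_wpM2r.
  have E1 : (K * p + b) * r = r * K * p + r * b by ring.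
  by move: h; rewrite E1; lra.
move=> /le_trans; apply; exact: aux.
Qed.

(** With q_n the sum of the remaining steps, the intervals [u_n - q_n, u_n + q_n] are nested; the
    limit is the supremum of their left ends. *)
Lemma geometric_limit (u : nat -> R) C : 0 <= C ->
  (forall n, `|u n.+1 - u n| <= C / 2 ^+ n) ->
  exists l, forall n, `|u n - l| <= 2 * C / 2 ^+ n.
Proof.
move=> C0 Hu.
pose q n : R := 2 * C / 2 ^+ n.
have qS n : q n.+1 + C / 2 ^+ n = q n.
  rewrite /q exprS; have : (2 ^+ n : R) != 0 by rewrite expf_neq0.
  by move: (2 ^+ n : R) => p p0; field.
have q0 n : 0 <= q n by rewrite /q divr_ge0 ?mulr_ge0 // exprn_ge0.
have up n m : u n - q n <= u (n + m)%N - q (n + m)%N.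
  elim: m => [|m IH]; first by rewrite addn0.
  apply: le_trans IH _; rewrite addnS.
  by have := Hu (n + m)%N; rewrite -(qS (n + m)%N) ler_norml; lra.
have dn n m : u (n + m)%N + q (n + m)%N <= u n + q n.
  elim: m => [|m IH]; first by rewrite addn0.
  apply: le_trans IH; rewrite addnS.
  by have := Hu (n + m)%N; rewrite -(qS (n + m)%N) ler_norml; lra.
have cross n m : u n - q n <= u m + q m.
  have := up n m; have := dn m n; rewrite (addnC m n); have := q0 (n + m)%N; lra.
pose S := [set x | exists n, x = u n - q n].
have S0 : S !=set0 by exists (u 0%N - q 0%N), 0%N.
have ubS n : ubound S (u n + q n) by move=> _ [m ->]; exact: cross.
exists (sup S) => n; rewrite -/(q n) ler_norml.
have := sup_upper_bound (conj S0 (ex_intro _ _ (ubS 0%N))).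
move=> /(_ (u n - q n)) /(_ (ex_intro _ n erefl)).
have := ge_sup S0 (ubS n); lra.
Qed.

Lemma geometric_small (C e : R) : 0 <= C -> 0 < e -> exists n, C / 2 ^+ n <= e.
Proof.
move=> C0 e0; exists (Num.bound (C / e)).
have := archi_boundP (divr_ge0 C0 (ltW e0)).
rewrite ltr_pdivrMr // ler_pdivrMr ?exprn_gt0 // => /ltW /le_trans; apply.
rewrite (mulrC e) ler_pM2r // -natrX ler_nat.
exact/ltnW/ltn_expl.
Qed.

(** The 1-Lipschitz retraction of the line onto [c - r, c + r]; composing with it turns local
    hypotheses into global ones. *)
Definition clamp c r s : R := Num.max (c - r) (Num.min (c + r) s).

Lemma clamp_dist c r s : 0 <= r -> `|clamp c r s - c| <= r.
Proof.
move=> r0; rewrite /clamp ler_distl; case: (lerP (c + r) s) => h1.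
  by case: (lerP (c - r) (c + r)) => h2; lra.
by case: (lerP (c - r) s) => h2; lra.
Qed.

Lemma clamp_id c r s : `|s - c| <= r -> clamp c r s = s.
Proof.
rewrite /clamp ler_distl => /andP[h1 h2].
by rewrite (min_idPr _) // (max_idPr _).
Qed.

Lemma clamp_lip c r s t : `|clamp c r s - clamp c r t| <= `|s - t|.
Proof.
have maxl (a x y : R) : `|Num.max a x - Num.max a y| <= `|x - y|.
  have h1 := ler_norm (x - y); have h2 := ler_norm (y - x); rewrite distrC in h2.
  move: (`|x - y| : R) h1 h2 => w h1 h2; rewrite ler_norml.
  by case: (lerP a x) => h3; case: (lerP a y) => h4; lra.
have minl (a x y : R) : `|Num.min a x - Num.min a y| <= `|x - y|.
  have h1 := ler_norm (x - y); have h2 := ler_norm (y - x); rewrite distrC in h2.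
  move: (`|x - y| : R) h1 h2 => w h1 h2; rewrite ler_norml.
  by case: (lerP a x) => h3; case: (lerP a y) => h4; lra.
exact: le_trans (maxl _ _ _) (minl _ _ _).
Qed.

Lemma lipschitz_continuous1 f M :
  (forall s t, `|f s - f t| <= M * `|s - t|) -> continuous f.
Proof.
move=> H t; apply/cvgrPdist_lt => e e0.
have M1 : 0 < `|M| + 1 by rewrite ltr_wpDl.
near=> s; apply: le_lt_trans (H t s) _.
apply: (@le_lt_trans _ _ ((`|M| + 1) * `|t - s|)).
  apply: ler_wpM2r => //; apply: le_trans (ler_norm M) _.
  by rewrite lerDl.
rewrite mulrC -ltr_pdivlMr //; near: s; apply: cvgr_dist_lt => //.
by rewrite divr_gt0.
Unshelve. all: by end_near. Qed.

(** The bounds on psi are global, which clamping the right-hand side makes possible, so the iterates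
    never leave its domain. Since r K <= 1/2, consecutive iterates differ by at most M r / 2^n. *)
Lemma picard (psi : R -> R -> R) c y0 r K M : 0 < r -> 0 <= K -> 0 <= M ->
  r * K <= 1 / 2 ->
  (forall s u v, `|psi s u - psi s v| <= K * `|u - v|) ->
  (forall s u, `|psi s u| <= M) ->
  (forall y : R^o -> R^o, continuous y -> continuous (fun s : R^o => psi s (y s) : R^o)) ->
  exists y : R^o -> R^o, y c = y0 /\
    forall s, `|s - c| < r -> is_derive (s : R^o) (1 : R^o) y (psi s (y s)).
Proof.
move=> r0 K0 M0 rK lip bd cont.
have prim (y : R^o -> R^o) : continuous y -> exists F : R^o -> R^o, F c = y0 /\
    forall t : R, is_derive (t : R^o) (1 : R^o) F (psi t (y t)).
  move=> /cont/(@primitive _ c)[F [F0 HF]].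
  exists (F + cst (y0 : R^o)); split.
    by rewrite -[LHS]/(F c + y0) F0 add0r.
  move=> t; have := is_deriveD (HF t) (is_derive_cst (y0 : R^o) (t : R^o) (1 : R^o)).
  by rewrite addr0.
have dist_mvt (F G : R^o -> R^o) (dF dG : R -> R) (C t : R) :
    F c = y0 -> G c = y0 -> `|t - c| <= r ->
    (forall s, `|s - c| <= r -> `|dF s - dG s| <= C) ->
    (forall s : R, is_derive (s : R^o) (1 : R^o) F (dF s)) ->
    (forall s : R, is_derive (s : R^o) (1 : R^o) G (dG s)) -> `|F t - G t| <= C * r.
  move=> F0 G0 tr HC HF HG.
  have D (s : R) : btw c t s -> is_derive (s : R^o) (1 : R^o) (F - G) (dF s - dG s).
    by move=> _; apply: is_deriveB.
  have [x xt] := @mvt_btw _ (F - G) (fun s => dF s - dG s) c t D.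
  rewrite -[(F - G) t]/(F t - G t) -[(F - G) c]/(F c - G c) F0 G0 subrr subr0 => ->.
  have xr : `|x - c| <= r by apply: le_trans (btw_dist xt) tr.
  by rewrite normrM; apply: ler_pM => //; exact: HC.
have [Y [Y0 [Yc [YS Yd]]]] : exists Y : nat -> R^o -> R^o,
    Y 0%N = (fun=> y0) /\ (forall n, continuous (Y n)) /\
    (forall n, Y n c = y0) /\
    (forall n (t : R), is_derive (t : R^o) (1 : R^o) (Y n.+1) (psi t (Y n t))).
  (* An iterate must carry its continuity, without which the next primitive does not exist. *)
  pose T := {y : R^o -> R^o | continuous y /\ y c = y0}.
  have next (y : T) : {z : T | forall t : R,
      is_derive (t : R^o) (1 : R^o) (sval z) (psi t (sval y t))}.
    case: y => y [cy yc]; apply: cid; have [F [F0 HF]] := prim y cy.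
    have cF : continuous F.
      move=> t; apply: differentiable_continuous; apply/derivable1_diffP.
      by case: (HF t).
    by exists (exist _ F (conj cF F0)).
  have init : continuous (fun _ : R^o => y0 : R^o) /\ y0 = y0.
    by split => // u; exact: cst_continuous.
  pose Z := fix Z n : T := if n is m.+1 then sval (next (Z m))
                           else exist _ (fun _ : R^o => y0 : R^o) init.
  exists (fun n => sval (Z n)); split=> //; split; last split.
  - by move=> n; case: (svalP (Z n)).
  - by move=> n; case: (svalP (Z n)).
  - by move=> n t; exact: (svalP (next (Z n))).
have C0 : 0 <= M * r by rewrite mulr_ge0 // ltW.
have step n t : `|t - c| <= r -> `|Y n.+1 t - Y n t| <= M * r / 2 ^+ n.
  elim: n t => [|n IH] t tr.
    rewrite expr0 divr1.
    apply: (@dist_mvt _ _ (fun s => psi s (Y 0%N s)) (fun=> 0)) => //.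
    - by move=> s _; rewrite subr0.
    - by move=> s; rewrite Y0; exact: is_derive_cst.
  apply: le_trans (_ : K * (M * r / 2 ^+ n) * r <= _).
    apply: (@dist_mvt _ _ (fun s => psi s (Y n.+1 s)) (fun s => psi s (Y n s))) => //.
    by move=> s sr; apply: le_trans (lip _ _ _) _; apply: ler_wpM2l => //; exact: IH.
  have : r * K * (M * r / 2 ^+ n) <= 1 / 2 * (M * r / 2 ^+ n).
    by apply: ler_wpM2r => //; rewrite divr_ge0 // exprn_ge0.
  rewrite exprS; have : (2 ^+ n : R) != 0 by rewrite expf_neq0.
  move: (2 ^+ n : R) => p p0.
  have -> : M * r / (2 * p) = 1 / 2 * (M * r / p) by field.
  by have -> : K * (M * r / p) * r = r * K * (M * r / p) by ring.
(* The iterates are only controlled at distance at most r from c. Reading them through [clamp] gives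
   a limit defined everywhere and M-Lipschitz, hence continuous. *)
have lim t : exists l, forall n, `|Y n (clamp c r t) - l| <= 2 * (M * r) / 2 ^+ n.
  by apply: geometric_limit => // n; apply: step; exact/clamp_dist/ltW.
have [y Hy] := choice lim.
have Ylip n s t : `|Y n s - Y n t| <= M * `|s - t|.
  case: n => [|n]; first by rewrite Y0 subrr normr0 mulr_ge0.
  have [x _ ->] := @mvt_btw _ (Y n.+1) (fun x => psi x (Y n x)) t s (fun x _ => Yd n x).
  by rewrite normrM ler_wpM2r.
have small (p q : R) : (forall n, p <= q + 4 * (M * r) / 2 ^+ n) -> p <= q.
  move=> H; apply/ler_addgt0Pr => e e0.
  have [n Hn] : exists n, 4 * (M * r) / 2 ^+ n <= e.
    by apply: geometric_small => //; rewrite mulr_ge0.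
  by apply: le_trans (H n) _; rewrite lerD2l.
have ylip s t : `|y s - y t| <= M * `|s - t|.
  apply: small => n.
  have A := Hy s n; have B := Hy t n.
  have D := le_trans (Ylip n (clamp c r s) (clamp c r t))
    (ler_wpM2l M0 (clamp_lip c r s t)).
  move: A B D; move: (Y n (clamp c r s)) (Y n (clamp c r t)) (M * `|s - t|) => p q w.
  have -> : 4 * (M * r) / 2 ^+ n = 2 * (2 * (M * r) / 2 ^+ n) by ring.
  by rewrite !ler_norml; move: (2 * (M * r) / 2 ^+ n) (y s) (y t) => k ys yt; lra.
have cy : continuous y := lipschitz_continuous1 ylip.
(* The solution is the primitive z of the right-hand side along the limit y; it is differentiable by
   construction, and [zy] identifies it with y near c. *)
have [z [z0 Hz]] := prim y cy.
have tri (u v w A k : R) : `|u - v| <= A -> `|u - w| <= 1 / 2 * k ->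
    A <= 1 / 2 * k -> `|v - w| <= 2 * k by rewrite !ler_norml; lra.
have zy t : `|t - c| <= r -> z t = y t.
  move=> tr; apply/eqP; rewrite -subr_eq0 -normr_le0; apply: small => n.
  rewrite add0r.
  have A : `|Y n.+1 t - z t| <= K * (2 * (M * r) / 2 ^+ n) * r.
    apply: (@dist_mvt _ _ (fun s => psi s (Y n s)) (fun s => psi s (y s))) => //.
    move=> s sr; apply: le_trans (lip _ _ _) _; apply: ler_wpM2l => //.
    by have := Hy s n; rewrite clamp_id.
  have B := Hy t n.+1; rewrite clamp_id // in B.
  have D : r * K * (2 * (M * r) / 2 ^+ n) <= 1 / 2 * (2 * (M * r) / 2 ^+ n).
    by apply: ler_wpM2r => //; rewrite divr_ge0 ?mulr_ge0 ?exprn_ge0 // ltW.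
  move: A B D; rewrite exprS; have : (2 ^+ n : R) != 0 by rewrite expf_neq0.
  move: (2 ^+ n : R) => p p0.
  have -> : 2 * (M * r) / (2 * p) = 1 / 2 * (2 * (M * r) / p) by field.
  have -> : K * (2 * (M * r) / p) * r = r * K * (2 * (M * r) / p) by ring.
  have -> : 4 * (M * r) / p = 2 * (2 * (M * r) / p) by ring.
  exact: tri.
exists z; split => // s sr; rewrite zy; first exact: Hz.
exact: ltW.
Qed.

End OneVariable.

(** * Primitives in one coordinate, with smooth dependence on the others *)

Section ParametricPrimitive.
Context {R : realType}.
Notation E := 'rV[R]_3.
Implicit Types (a x y z : E) (i j k l : 'I_3) (r s t e h : R) (f g F H : E -> R^o).

Definition cbox a r : set E := [set x | forall l, `|x 0 l - a 0 l| <= r].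

Lemma box_cbox a r x : box a r x -> cbox a r x.
Proof. by move=> H l; apply/ltW/H. Qed.

Lemma cbox_box a r s x : r < s -> cbox a r x -> box a s x.
Proof. by move=> rs H l; apply: le_lt_trans rs; apply: H. Qed.

Lemma box_shrink a r x : box a r x -> exists s : R, [/\ 0 < s, s < r & box a s x].
Proof.
move=> bx.
have H l : exists2 s : R, 0 < s & s < r /\ `|x 0 l - a 0 l| < s.
  exists ((`|x 0 l - a 0 l| + r) / 2).
    by rewrite divr_gt0 // ltr_wpDl // (box_gt0 bx).
  by have := bx l; move: (`|x 0 l - a 0 l|) => w hw; split; lra.
have [s0 s00 [s0r h0]] := H 0; have [s1 s10 [s1r h1]] := H 1.
have [s2 s20 [s2r h2]] := H 2.
exists (Num.max s0 (Num.max s1 s2)); split.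
- by rewrite !lt_max s00.
- by rewrite !gt_max s0r s1r.
- by apply: ord3P; rewrite !lt_max ?h0 ?h1 ?h2 ?orbT.
Qed.

Definition clampb a r x : E := \row_l clamp (a 0 l) r (x 0 l).

Lemma clampb_cbox a r x : 0 <= r -> cbox a r (clampb a r x).
Proof. by move=> r0 l; rewrite mxE; exact: clamp_dist. Qed.

Lemma clampb_id a r x : cbox a r x -> clampb a r x = x.
Proof. by move=> H; apply/rowP => l; rewrite mxE clamp_id. Qed.

Lemma clampb_continuous a r l x :
  {for x, continuous (fun y => clampb a r y 0 l : R^o)}.
Proof.
apply/continuous_boxP => e e0; exists e => // y yx; rewrite !mxE.
exact: le_lt_trans (clamp_lip _ _ _ _) (yx l).
Qed.

(** The strict inequality leaves an open cube around the closed one on which f is still continuous;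
    the new function agrees with f on [cbox a r]. *)
Lemma continuous_clampb f a r s : 0 <= r -> r < s ->
  (forall y, box a s y -> {for y, continuous f}) ->
  forall x, {for x, continuous (fun y => f (clampb a r y))}.
Proof.
move=> r0 rs cf x; apply: continuous_comp3 => [l|].
  exact: clampb_continuous.
by apply: cf; apply: cbox_box rs _; exact: clampb_cbox.
Qed.

Lemma cbox_compact a r : compact (cbox a r).
Proof.
have -> : cbox a r =
    [set v : E | forall i, [set` `[a 0 i - r, a 0 i + r]] (v ord0 i)].
  by apply/seteqP; split => x H i; have := H i; rewrite /= in_itv /= ler_distl.
apply: (@rV_compact R 3 (fun i => [set` `[a 0 i - r, a 0 i + r]])) => i.
exact: segment_compact.
Qed.

(** Uniform continuity in which only [x] is confined to the compact cube. *)
Lemma uniform_cbox f a r e : (forall x, {for x, continuous f}) -> 0 < e ->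
  exists2 d : R, 0 < d &
    forall x y, cbox a r x -> box x d y -> `|f y - f x| < e.
Proof.
move=> cf e0; have /compact_near_coveringP H := @cbox_compact a r.
have e2 : 0 < e / 2 by rewrite divr_gt0.
have := H R (0^'+) (fun d x => forall y, box x d y -> `|f y - f x| < e) _.
case=> [x _|d /= d0 Hd].
  have /continuous_boxP/(_ _ e2)[q q0 Hq] := cf x.
  exists (box x (q / 2), [set d | d < q / 2]) => /=.
    split; first by apply: box_nbhs; rewrite divr_gt0.
    by apply: nbhs_right_lt; rewrite divr_gt0.
  move=> [z d] /= [zx dq] y yz.
  have A := Hq z (boxS _ zx); have B : `|f y - f x| < e / 2.
    apply: Hq => l; have := yz l; have := zx l; rewrite !ltr_norml.
    by move: (y 0 l) (z 0 l) (x 0 l) => ? ? ?; lra.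
  have : q / 2 <= q by rewrite ler_pdivrMr // ler_pMr // ler1n.
  move=> /A; move: B; rewrite !ltr_norml.
  by move: (f y) (f z) (f x) => ? ? ?; lra.
(* The property holds for the positive numbers at distance less than d from 0, so d itself is
   excluded. *)
exists (d / 2); first by rewrite divr_gt0.
move=> x y cx yx; apply: (Hd (d / 2) _ _ _ cx y yx) => /=.
  rewrite sub0r normrN gtr0_norm ?divr_gt0 //.
  by rewrite ltr_pdivrMr // ltr_pMr // ltr1n.
by rewrite divr_gt0.
Qed.

Lemma bounded_cbox f a r : (forall x, {for x, continuous f}) -> 0 <= r ->
  exists2 M : R, 0 <= M & forall x, cbox a r x -> `|f x| <= M.
Proof.
move=> cf r0.
have [|x|c _ Hc] := @compact_EVT_max E R (fun x => `|f x| : R) (cbox a r) _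
  (@cbox_compact a r).
- by exists a => l; rewrite subrr normr0.
- apply: continuous_subspaceT => {}x.
  by apply: continuous_comp (cf x) _; exact: norm_continuous.
- by exists `|f c| => // x cx; apply: Hc; rewrite inE.
Qed.

Lemma Ck_local n (W : normedModType R) U (f : E -> W) :
  (forall y, U y -> exists V, [/\ open V, V y & Ck n V f]) -> Ck n U f.
Proof.
elim: n f => [|n IH] f H.
  by split => // y /H[V [_ Vy Cf]]; exact: Ck_continuous Cf _ Vy.
split=> [y /H[V [_ Vy Cf]]|i]; first exact: Ck_continuous Cf _ Vy.
split=> [y /H[V [_ Vy [_ /(_ i)[Cf _]]]]|]; first exact: Cf.
apply: IH => y /H[V [oV Vy [_ /(_ i)[_ Cf]]]].
by exists V; split.
Qed.

Lemma partial_epsilon f x i (c : R) :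
  (forall e, 0 < e -> exists2 d : R, 0 < d & forall h, `|h| < d ->
     `|f (upd x i (h + x 0 i)) - f x - h * c| <= e * `|h|) ->
  derivable f x (e_ i) /\ partial i f x = c.
Proof.
move=> H.
suff L : h^-1 *: (f (h *: e_ i + x) - f x) @[h --> 0^'] --> (c : R^o).
  by split; [apply/cvg_ex; exists (c : R^o)|exact: cvg_lim L].
apply/cvgrPdist_le => e e0; have [d d0 Hd] := H e e0.
near=> h.
have h0 : h != 0 by near: h; exact: nbhs_dnbhs_neq.
have hd : `|h| < d by near: h; exact: dnbhs0_lt.
rewrite add_e_upd distrC.
have -> : h^-1 *: (f (upd x i (h + x 0 i)) - f x : R^o) - c =
    h^-1 * (f (upd x i (h + x 0 i)) - f x - h * c).
  by rewrite mulrBr mulrA mulVf // mul1r.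
rewrite normrM normfV mulrC ler_pdivrMr ?normr_gt0 //.
exact: Hd.
Unshelve. all: by end_near. Qed.

(** One primitive is chosen on every line parallel to the axis k. *)
Lemma parametric_primitive k a g : (forall x, {for x, continuous g}) ->
  exists F, (forall x, F (upd x k (a 0 k)) = 0) /\
    forall x, derivable F x (e_ k) /\ partial k F x = g x.
Proof.
move=> cg.
have Hx x : exists P : R^o -> R^o, P (a 0 k) = 0 /\
    forall t : R, is_derive (t : R^o) (1 : R^o) P (g (upd x k t)).
  apply: primitive => t; apply/(@cvgrPdist_lt _ R^o) => e e0.
  have /continuous_boxP/(_ e e0)[d d0 Hd] := cg (upd x k t).
  near=> s; rewrite distrC; apply: Hd => l; rewrite !updE.
  case: (l == k); last by rewrite subrr normr0.
  by rewrite distrC; near: s; exact: cvgr_dist_lt.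
have [P HP] := choice Hx.
(* [upd x k 0] labels the line through x: all points of a line use the same choice of P, so F is a
   primitive along it. *)
exists (fun x => P (upd x k 0) (x 0 k)); split.
  by move=> x; rewrite upd_upd upd_same; case: (HP (upd x k 0)).
move=> x; apply: is_derive_partial.
have -> : (fun s : R^o => P (upd (upd x k s) k 0) (upd x k s 0 k)) = P (upd x k 0).
  by apply/funext => s; rewrite upd_upd upd_same.
have [_ /(_ (x 0 k))] := HP (upd x k 0).
by rewrite upd_upd upd_id.
Unshelve. all: by end_near. Qed.

Lemma box_upd a r x k t : box a r x -> btw (a 0 k) (x 0 k) t ->
  box a r (upd x k t).
Proof.
move=> bx bt l; rewrite updE; case: eqP => [->|_]; last exact: bx.
exact: le_lt_trans (btw_dist bt) (bx k).
Qed.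

Section Box.
Variables (k : 'I_3) (a : E) (r : R) (f F : E -> R^o).
Hypotheses
  (dF : forall x, box a r x -> derivable F x (e_ k) /\ partial k F x = f x)
  (F0 : forall x, box a r x -> F (upd x k (a 0 k)) = 0).

(** The increment is split at [upd y k (x 0 k)]: along the axis k it is bounded by sup |f|, and
    across it by uniform continuity of f, because both primitives vanish at a_k. *)
Lemma primitive_continuous : (forall x, box a r x -> {for x, continuous f}) ->
  forall x, box a r x -> {for x, continuous F}.
Proof.
move=> cf x bx; apply/continuous_boxP => e e0.
have [s [s0 sr sx]] := box_shrink bx.
have cg := continuous_clampb (ltW s0) sr cf.
have [M M0 HM] := @bounded_cbox _ a s cg (ltW s0).
have e1 : 0 < e / 2 / s by rewrite !divr_gt0.
have [d1 d10 Hd1] := @uniform_cbox _ a s _ cg e1.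
have [d2 d20 Hd2] := box_sub sx.
have e2 : 0 < e / 2 / (M + 1) by rewrite !divr_gt0 // ltr_wpDl.
have [d [d0 dd1 dd2 dd3]] : exists d : R,
    [/\ 0 < d, d <= d1, d <= d2 & d <= e / 2 / (M + 1)].
  exists (Num.min d1 (Num.min d2 (e / 2 / (M + 1)))).
  by rewrite !lt_min d10 d20 e2 !ge_min !lexx !orbT.
exists d => // y yx.
have sy : box a s y by apply: Hd2; apply: boxS yx.
have sz : box a s (upd y k (x 0 k)).
  by move=> l; rewrite updE; case: eqP => [->|_]; [exact: sx|exact: sy].
have A : `|F y - F (upd y k (x 0 k))| <= M * d.
  have st t : btw (x 0 k) (y 0 k) t -> box a s (upd y k t).
    move=> bt l; rewrite updE; case: eqP => [->|_]; last exact: sy.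
    exact: btw_norm (sx k) (sy k) bt.
  have [t bt|t bt] := @mvt_upd _ F y k (x 0 k) (y 0 k).
    by apply: (dF _).1; apply: boxS (ltW sr) _ (st t bt).
  rewrite upd_id => ->; move: st => /(_ t bt) st.
  rewrite (dF (boxS (ltW sr) st)).2 normrM; apply: ler_pM => //; last exact/ltW/yx.
  by have := HM _ (box_cbox st); rewrite clampb_id //; exact: box_cbox.
have B : `|F (upd y k (x 0 k)) - F x| <= e / 2 / s * s.
  pose phi (t : R^o) : R^o := F (upd y k t) - F (upd x k t).
  have D t : btw (a 0 k) (x 0 k) t ->
      is_derive (t : R^o) (1 : R^o) phi (f (upd y k t) - f (upd x k t)).
    move=> bt.
    have by_ : box a r (upd y k t).
      apply: boxS (ltW sr) _ _ => l; rewrite updE; case: eqP => [->|_].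
        exact: le_lt_trans (btw_dist bt) (sx k).
      exact: sy.
    have bx_ := box_upd bx bt.
    rewrite -(dF by_).2 -(dF bx_).2.
    by apply: is_deriveB; apply: is_derive_upd; [case: (dF by_)|case: (dF bx_)].
  have [t bt] := mvt_btw D.
  rewrite /phi upd_id F0; last exact: boxS (ltW sr) _ _.
  rewrite F0 // subrr subr0 => ->; rewrite normrM; apply: ler_pM => //; last first.
    exact/ltW/sx.
  have cx := box_cbox (box_upd sx bt).
  have cy : cbox a s (upd y k t).
    move=> l; rewrite updE; case: eqP => [->|_]; last exact/ltW/sy.
    exact: le_trans (btw_dist bt) (ltW (sx k)).
  have := Hd1 (upd x k t) (upd y k t) cx; rewrite !clampb_id // => H; apply/ltW/H.
  move=> l; rewrite !updE; case: eqP => _; first by rewrite subrr normr0.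
  exact: lt_le_trans (yx l) dd1.
have C : M * d < e / 2.
  have : M * d <= M * (e / 2 / (M + 1)) by apply: ler_wpM2l.
  move=> /le_lt_trans; apply.
  rewrite mulrA ltr_pdivrMr ?ltr_wpDl //.
  by rewrite mulrC ltr_pM2l ?divr_gt0 // ltrDl.
rewrite mulfVK ?gt_eqF // in B.
have -> : F y - F x = F y - F (upd y k (x 0 k)) + (F (upd y k (x 0 k)) - F x).
  by rewrite addrA subrK.
apply: le_lt_trans (ler_normD _ _) _; rewrite (splitr e).
exact: ltr_leD (le_lt_trans A C) B.
Qed.

(** Differentiation under the integral sign. Along the line in direction k the error F X - F x - h H
    x starts from 0, and its derivative is h times a variation of [partial i f], uniformly small. *)
Lemma primitive_partial i H : i != k ->
  (forall x, box a r x -> derivable f x (e_ i)) ->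
  (forall x, box a r x -> {for x, continuous (partial i f)}) ->
  (forall x, box a r x -> derivable H x (e_ k) /\ partial k H x = partial i f x) ->
  (forall x, box a r x -> H (upd x k (a 0 k)) = 0) ->
  forall x, box a r x -> derivable F x (e_ i) /\ partial i F x = H x.
Proof.
move=> ik df cf dH H0 x bx; apply: partial_epsilon => e e0.
have [s [s0 sr sx]] := box_shrink bx.
have cg := continuous_clampb (ltW s0) sr cf.
have e1 : 0 < e / s by rewrite divr_gt0.
have [d1 d10 Hd1] := @uniform_cbox _ a s _ cg e1.
have [d2 d20 Hd2] := box_sub sx.
have [d [d0 dd1 dd2]] : exists d : R, [/\ 0 < d, d <= d1 & d <= d2].
  by exists (Num.min d1 d2); rewrite lt_min d10 d20 !ge_min !lexx !orbT.
exists d => // h hd.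
set X := upd x i (h + x 0 i).
have sX : box a s X.
  apply: Hd2 => l; rewrite updE; case: eqP => [->|_].
    by rewrite addrK; exact: lt_le_trans dd2.
  by rewrite subrr normr0.
have Xk : X 0 k = x 0 k by rewrite upd_other // eq_sym.
pose phi (t : R^o) : R^o := F (upd X k t) - F (upd x k t) - h * H (upd x k t).
pose dphi (t : R) : R := f (upd X k t) - f (upd x k t) - h * partial i f (upd x k t).
have bX t : btw (a 0 k) (x 0 k) t -> box a s (upd X k t).
  by move=> bt; apply: box_upd => //; rewrite Xk.
have D t : btw (a 0 k) (x 0 k) t -> is_derive (t : R^o) (1 : R^o) phi (dphi t).
  move=> bt; have b1 := boxS (ltW sr) (bX t bt); have b2 := box_upd bx bt.
  rewrite /dphi -(dF b1).2 -(dF b2).2 -(dH _ b2).2.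
  apply: is_deriveB; first apply: is_deriveB.
  - by apply: is_derive_upd; case: (dF b1).
  - by apply: is_derive_upd; case: (dF b2).
  - by apply: (@is_deriveZ _ _ _ (fun t : R^o => H (upd x k t)) h);
      apply: is_derive_upd; case: (dH _ b2).
have [t bt] := mvt_btw D.
rewrite /phi upd_id F0; last exact: boxS (ltW sr) _ _.
rewrite F0 // H0 // subrr mulr0 !subr0 -{1}Xk upd_id => ->.
have st := box_upd sx bt.
have mv : f (upd X k t) - f (upd x k t) =
    f (upd (upd x k t) i (h + x 0 i)) - f (upd (upd x k t) i (x 0 i)).
  rewrite /X upd_comm //; congr (_ - f _).
  by rewrite upd_comm 1?eq_sym // upd_id.
have bu u : btw (x 0 i) (h + x 0 i) u -> box (upd x k t) d (upd (upd x k t) i u).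
  move=> bu l; rewrite updE; case: eqP => [->|_]; last by rewrite subrr normr0.
  rewrite upd_other //; apply: le_lt_trans (btw_dist bu) _.
  by rewrite addrK.
have bu2 u : btw (x 0 i) (h + x 0 i) u -> box a s (upd (upd x k t) i u).
  move=> hu l; rewrite updE; case: eqP => [->|_]; last exact: st.
  apply: btw_norm (sx i) _ hu; by have := sX i; rewrite upd_same.
have [u hu|u hu E] := @mvt_upd _ f (upd x k t) i (x 0 i) (h + x 0 i).
  by apply: df; apply: boxS (ltW sr) _ (bu2 u hu).
rewrite /dphi mv E addrK (mulrC _ h) -mulrBr !normrM mulrC mulrA.
rewrite (_ : e * `|h| = s * `|h| * (e / s)); last first.
  by rewrite [RHS]mulrC mulrA divfK ?gt_eqF.
apply: ler_pM => //; first by rewrite ler_wpM2r // ltW.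
have := Hd1 (upd x k t) (upd (upd x k t) i u) (box_cbox st).
rewrite !clampb_id //; first by move=> Q; apply/ltW/Q; apply: boxS (bu u hu).
- exact: box_cbox.
- by apply: box_cbox; exact: bu2.
Qed.

End Box.

(** Along k the derivative of F is f; along i != k it is the primitive of [partial i f], to which
    the induction applies. The cube shrinks since [partial i f] has to be clamped before it is
    integrated, and [Ck_local] recovers the whole cube. *)
Lemma Ck_primitive n k a r f F : 0 < r ->
  (forall x, box a r x -> derivable F x (e_ k) /\ partial k F x = f x) ->
  (forall x, box a r x -> F (upd x k (a 0 k)) = 0) ->
  Ck n (box a r) f -> Ck n (box a r) F.
Proof.
elim: n r f F => [|n IH] r f F r0 dF F0 Cf.
  have := primitive_continuous dF F0 (Ck_continuous Cf).
  by move=> C; split.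
apply: Ck_local => y /box_shrink[s [s0 sr ys]].
exists (box a s); split => //; first exact: box_open.
have sub := boxS (a := a) (ltW sr).
have {}Cf' := Ck_subset sub Cf.
apply: Ck_step => [|x bx|i].
- exact: box_open.
- apply: (primitive_continuous dF F0); last exact: sub.
  by move=> z; exact: Ck_continuous Cf z.
have [->|ik] := eqVneq i k.
  by exists f; split; [move=> x /sub/dF|exact: CkS].
have cf x : box a r x -> {for x, continuous (partial i f)}.
  by move=> bx; apply: Ck_continuous bx; exact: Ck_partial Cf.
have [H [H0 dH]] := parametric_primitive k a (continuous_clampb (ltW s0) sr cf).
have dH' x : box a s x -> derivable H x (e_ k) /\ partial k H x = partial i f x.
  by move=> bx; have := dH x; rewrite clampb_id //; exact: box_cbox.
exists H; split; last first.
  by apply: IH dH' _ _ => //; exact: Ck_partial Cf'.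
have A x : box a s x -> derivable F x (e_ k) /\ partial k F x = f x by move=> /sub/dF.
have B x : box a s x -> F (upd x k (a 0 k)) = 0 by move=> /sub/F0.
have C x : box a s x -> derivable f x (e_ i).
  by move=> bx; exact: (Ck_derivable (i := i) Cf' bx).
have D x : box a s x -> {for x, continuous (partial i f)} by move=> /sub/cf.
have G x : box a s x -> H (upd x k (a 0 k)) = 0 by [].
have := primitive_partial A B ik C D dH' G.
by [].
Qed.

End ParametricPrimitive.

(** * Scalar differential equations and smooth dependence on initial values *)

Section ScalarODE.
Context {R : realType}.
Notation E := 'rV[R]_3.
Implicit Types (a x y z : E) (i j k l : 'I_3) (r s t e h : R) (f g F H : E -> R^o).

Lemma sbox_cbox a r x y z : cbox a r x -> cbox a r y -> sbox x y z -> cbox a r z.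
Proof.
have aux (u v w d : R) : `|u - d| <= r -> `|v - d| <= r -> btw u v w -> `|w - d| <= r.
  by rewrite !ler_norml /btw; lra.
by move=> hx hy hz l; apply: aux (hx l) (hy l) (hz l).
Qed.

Lemma sbox_box_left d x y z : box x d y -> sbox x y z -> box x d z.
Proof. by move=> hy hz l; apply: le_lt_trans (btw_dist (hz l)) (hy l). Qed.

Lemma C1_lipschitz f a r K : (forall x l, cbox a r x -> derivable f x (e_ l)) ->
  (forall x l, cbox a r x -> `|partial l f x| <= K) ->
  forall x y, cbox a r x -> cbox a r y ->
    `|f y - f x| <= K * \sum_l `|y 0 l - x 0 l|.
Proof.
move=> df bf x y cx cy; rewrite slopeE; last first.
  by move=> z l hz; apply: df; exact: sbox_cbox hz.
apply: le_trans (ler_norm_sum _ _ _) _; rewrite mulr_sumr; apply: ler_sum => l _.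
rewrite normrM mulrC; apply: ler_wpM2r => //.
have [z hz ->] := slope_sbox f x y l; apply: bf; exact: sbox_cbox hz.
Qed.

Section Flow.
Variables (j k : 'I_3) (a : E) (R0 : R) (m : E -> R^o).
Hypotheses (jk : j != k) (R0_gt0 : 0 < R0) (m_smooth : smooth (box a R0) m).

(** [h x] is the value at time x_k of the solution that starts from x_j at time a_k, the third
    coordinate being a parameter. The constants are kept because the regularity estimates reuse
    them: [fd_rhoK] is the smallness that [gronwall_small] asks for. *)
Record flow_data (r0 K M rho : R) (h : E -> R^o) : Prop := FlowData {
  fd_r0 : 0 < r0;
  fd_r0R : r0 < R0;
  fd_K : 0 <= K;
  fd_M : 0 <= M;
  fd_rho : 0 < rho;
  fd_rhoK : rho * K <= 1 / 2;
  fd_bound : forall x, cbox a r0 x -> `|m x| <= M;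
  fd_partial : forall x l, cbox a r0 x -> `|partial l m x| <= K;
  fd_init : forall x, h (upd x k (a 0 k)) = x 0 j;
  fd_box : forall x, box a rho x -> box a r0 (upd x j (h x));
  fd_ode : forall x, box a rho x ->
    derivable h x (e_ k) /\ partial k h x = m (upd x j (h x))
}.

Lemma flow_exists : exists r0 K M rho (h : E -> R^o), flow_data r0 K M rho h.
Proof.
pose r0 := R0 / 2.
have r00 : 0 < r0 by rewrite divr_gt0.
have r0R : r0 < R0 by rewrite /r0 ltr_pdivrMr // ltr_pMr // ltr1n.
have cm := continuous_clampb (ltW r00) r0R (Ck_continuous (m_smooth 0%N)).
have [M M0 HM] := @bounded_cbox _ _ a r0 cm (ltW r00).
have HM' x : cbox a r0 x -> `|m x| <= M.
  by move=> cx; have := HM x cx; rewrite clampb_id.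
have bl l : exists2 K : R, 0 <= K & forall x, cbox a r0 x -> `|partial l m x| <= K.
  have cl := continuous_clampb (ltW r00) r0R
    (Ck_continuous (Ck_partial l (m_smooth 1%N))).
  have [K K0 HK] := @bounded_cbox _ _ a r0 cl (ltW r00).
  by exists K => // x cx; have := HK x cx; rewrite clampb_id.
have [K K0 HK] : exists2 K : R, 0 <= K &
    forall x l, cbox a r0 x -> `|partial l m x| <= K.
  have [K0 K00 H0] := bl 0; have [K1 K10 H1] := bl 1; have [K2 K20 H2] := bl 2.
  exists (K0 + K1 + K2); first by rewrite !addr_ge0.
  move=> x l cx; move: l; apply: ord3P.
  - by apply: le_trans (H0 x cx) _; rewrite -addrA lerDl addr_ge0.
  - by apply: le_trans (H1 x cx) _; rewrite (addrC K0) -addrA lerDl addr_ge0.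
  - by apply: le_trans (H2 x cx) _; rewrite lerDr addr_ge0.
have dm x l : cbox a r0 x -> derivable m x (e_ l).
  by move=> cx; apply: (Ck_derivable (i := l) (m_smooth 1%N)); exact: cbox_box r0R cx.
(* The first bound ensures convergence of the iteration; the second keeps a solution of speed at
   most M inside the cube of radius r0 during the time rho. *)
have [rho [rho0 rhoK rhoM]] : exists rho : R,
    [/\ 0 < rho, rho * K <= 1 / 2 & rho + M * rho < r0].
  have p1 : 0 < 1 / 2 / (K + 1) by rewrite !divr_gt0 // ltr_wpDl.
  have p2 : 0 < r0 / (2 + M) by rewrite divr_gt0 // ltr_wpDr.
  exists (Num.min (1 / 2 / (K + 1)) (r0 / (2 + M))); split.
  - by rewrite lt_min p1.
  - apply: (@le_trans _ _ (1 / 2 / (K + 1) * K)).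
      by apply: ler_wpM2r => //; rewrite ge_min lexx.
    rewrite mulrAC ler_pdivrMr ?ltr_wpDl //; apply: ler_wpM2l; first by lra.
    by rewrite lerDl.
  - apply: (@le_lt_trans _ _ (r0 / (2 + M) * (1 + M))).
      have : Num.min (1 / 2 / (K + 1)) (r0 / (2 + M)) <= r0 / (2 + M).
        by rewrite ge_min lexx orbT.
      move: (Num.min _ _) => w wle; have -> : w + M * w = w * (1 + M) by ring.
      by apply: ler_wpM2r => //; rewrite addr_ge0.
    rewrite mulrAC ltr_pdivrMr ?ltr_wpDr // ltr_pM2l // ltrD2r.
    by rewrite ltr1n.
(* Clamping makes m globally bounded and Lipschitz, as [picard] requires; by [h_box] the solution
   stays where nothing is clamped. *)
pose mt x : R := m (clampb a r0 x).
have mt_lip x y : `|mt y - mt x| <= K * \sum_l `|y 0 l - x 0 l|.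
  apply: le_trans (C1_lipschitz dm HK (clampb_cbox a x (ltW r00))
    (clampb_cbox a y (ltW r00))) _.
  apply: ler_wpM2l => //; apply: ler_sum => l _.
  by rewrite !mxE; exact: clamp_lip.
have Hx x : exists y : R^o -> R^o, y (a 0 k) = x 0 j /\ forall s : R,
    `|s - a 0 k| < rho -> is_derive (s : R^o) (1 : R^o) y (mt (upd (upd x k s) j (y s))).
  apply: (@picard R (fun s u => mt (upd (upd x k s) j u)) (a 0 k) (x 0 j) rho K M) => //.
  - move=> s u v; apply: le_trans (mt_lip _ _) _; apply: ler_wpM2l => //.
    rewrite (bigD1 j) //= big1 ?addr0 ?upd_same // => l lj.
    by rewrite !(upd_other _ _ lj) subrr normr0.
  - by move=> s u; apply: HM'; exact: clampb_cbox (ltW r00).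
  - move=> y cy s; apply/(@cvgrPdist_lt _ R^o) => e e0.
    have /continuous_boxP/(_ e e0)[d d0 Hd] := cm (upd (upd x k s) j (y s)).
    near=> u; rewrite distrC; apply: Hd => l; rewrite !updE.
    case: (l == j).
      by rewrite distrC; near: u; apply: cvgr_dist_lt d0; exact: cy.
    case: (l == k); last by rewrite subrr normr0.
    by rewrite distrC; near: u; exact: cvgr_dist_lt.
have [P HP] := choice Hx.
pose h x : R^o := P (upd x k 0) (x 0 k).
have hE x : (fun s : R^o => h (upd x k s)) = P (upd x k 0).
  by apply/funext => s; rewrite /h upd_upd upd_same.
have h_init x : h (upd x k (a 0 k)) = x 0 j.
  by rewrite -[LHS]/((fun s : R^o => h (upd x k s)) (a 0 k)) hE (HP _).1 upd_other.
have h_ode x : box a rho x ->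
    derivable h x (e_ k) /\ partial k h x = mt (upd x j (h x)).
  move=> bx; apply: is_derive_partial; rewrite hE.
  have := (HP (upd x k 0)).2 _ (bx k).
  by rewrite -hE upd_upd upd_id.
have h_bd x : box a rho x -> `|h x - x 0 j| <= M * rho.
  move=> bx; rewrite -(h_init x) -{1}(upd_id x k).
  have [t bt|t bt ->] := @mvt_upd _ h x k (a 0 k) (x 0 k).
    exact: (h_ode _ (box_upd bx bt)).1.
  rewrite (h_ode _ (box_upd bx bt)).2 normrM; apply: ler_pM => //; last exact/ltW/bx.
  by apply: HM'; exact: clampb_cbox (ltW r00).
have h_box x : box a rho x -> box a r0 (upd x j (h x)).
  move=> bx l; rewrite updE; case: eqP => [->|_]; last first.
    apply: lt_trans (bx l) _; apply: le_lt_trans rhoM.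
    by rewrite lerDl mulr_ge0 // ltW.
  rewrite -(subrKA (x 0 j)); apply: le_lt_trans (ler_normD _ _) _.
  by apply: lt_trans rhoM; rewrite addrC; apply: ltr_leD; [exact: bx|exact: h_bd].
exists r0, K, M, rho, h; split => // x bx.
have := h_ode x bx; rewrite /mt clampb_id //; exact/box_cbox/h_box.
Unshelve. all: by end_near. Qed.

Section Regularity.
Variables (r0 K M rho : R) (h : E -> R^o).
Hypothesis fd : flow_data r0 K M rho h.
Let T x : E := upd x j (h x).

Let Tcbox x : box a rho x -> cbox a r0 (T x).
Proof. by move=> bx; apply: box_cbox; exact: (fd_box fd). Qed.

Let dm x l : cbox a r0 x -> derivable m x (e_ l).
Proof.
move=> cx; apply: (Ck_derivable (i := l) (m_smooth 1%N)).
exact: cbox_box (fd_r0R fd) cx.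
Qed.

Let cr t x : btw (a 0 k) (x 0 k) t -> box a rho x -> box a rho (upd x k t).
Proof. by move=> bt bx; exact: box_upd. Qed.

Let dist_btw (t : R) x : `|t - a 0 k| <= `|x 0 k - a 0 k| -> box a rho x ->
  box a rho (upd x k t).
Proof.
move=> ht bx l; rewrite updE; case: eqP => [->|_]; last exact: bx.
exact: le_lt_trans ht (bx k).
Qed.

(** Gronwall's estimate for the difference of two solutions observed at the same time. *)
Lemma flow_lipschitz x y : box a rho x -> box a rho y -> x 0 k = y 0 k ->
  `|h y - h x| <= 3 * \sum_l `|y 0 l - x 0 l|.
Proof.
move=> bx by_ xy; set D := \sum_l _.
have D0 : 0 <= D by apply: sumr_ge0.
pose r := `|x 0 k - a 0 k|.
have ry : r = `|y 0 k - a 0 k| by rewrite /r xy.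
have rrho : r < rho by exact: bx.
pose phi (t : R^o) : R^o := h (upd y k t) - h (upd x k t).
pose dphi (t : R) : R := m (T (upd y k t)) - m (T (upd x k t)).
have Hd t : `|t - a 0 k| <= r -> is_derive (t : R^o) (1 : R^o) phi (dphi t).
  move=> tr; have b1 := dist_btw tr bx; rewrite ry in tr.
  have b2 := dist_btw tr by_; have [d1 e1] := fd_ode fd b1; have [d2 e2] := fd_ode fd b2.
  rewrite /dphi /T -e1 -e2; apply: is_deriveB; exact: is_derive_upd.
have Hb t : `|t - a 0 k| <= r -> `|dphi t| <= K * `|phi t| + K * D.
  move=> tr; have b1 := dist_btw tr bx; rewrite ry in tr; have b2 := dist_btw tr by_.
  apply: le_trans (C1_lipschitz dm (fd_partial fd) (Tcbox b1) (Tcbox b2)) _.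
  rewrite -mulrDr; apply: ler_wpM2l; first exact: fd_K fd.
  rewrite (bigD1 j) //= /T !upd_same; apply: lerD => //.
  rewrite /D [leRHS](bigD1 j) //= ler_wpDl //; apply: ler_sum => l lj.
  rewrite !(upd_other _ _ lj) !updE; case: (l == k) => //.
  by rewrite subrr normr0.
have rK : r * K <= 1 / 2.
  by apply: le_trans (fd_rhoK fd); apply: ler_wpM2r; [exact: fd_K fd|exact: ltW].
have := gronwall_small (normr_ge0 _) rK (fd_K fd) (mulr_ge0 (fd_K fd) D0) Hd Hb.
move=> /(_ (x 0 k) (lexx _)); rewrite /phi {1}xy !upd_id !(fd_init fd) => H.
apply: le_trans H _.
(* The estimate is 2 (D + r K D), at most 2 (D + D / 2) = 3 D. *)
have A : `|y 0 j - x 0 j| <= D.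
  by rewrite /D (bigD1 j) //= lerDl; apply: sumr_ge0.
have B : r * (K * D) <= 1 / 2 * D by rewrite mulrA; apply: ler_wpM2r.
by move: A B; rewrite /r; move: (`|y 0 j - x 0 j|) (`|x 0 k - a 0 k| * (K * D)) => u v; lra.
Qed.

(** The point z has the time of x and the other coordinates of y. From x to z, [flow_lipschitz] over
    three coordinates costs 3 * 3 d = 9 d; from z to y only time moves, at speed at most M. *)
Lemma flow_continuous x : box a rho x -> {for x, continuous h}.
Proof.
move=> bx; apply/continuous_boxP => e e0.
have [d1 d10 Hd1] := box_sub bx.
have M0 := fd_M fd.
have e1 : 0 < e / (9 + M + 1) by rewrite divr_gt0 // ltr_wpDl // addr_ge0.
exists (Num.min d1 (e / (9 + M + 1))); first by rewrite lt_min d10.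
move=> y yx.
have yx1 : box x d1 y by apply: boxS yx; rewrite ge_min lexx.
have yx2 : box x (e / (9 + M + 1)) y by apply: boxS yx; rewrite ge_min lexx orbT.
move: yx2; set d := e / _ => yx2.
have by_ := Hd1 _ yx1.
pose z := upd y k (x 0 k).
have bz : box a rho z by move=> l; rewrite updE; case: eqP => [->|_]; [exact: bx|exact: by_].
have A : `|h z - h x| <= 9 * d.
  apply: le_trans (flow_lipschitz bx bz _) _; first by rewrite upd_same.
  have -> : 9 * d = 3 * (d + d + d) by ring.
  apply: ler_wpM2l => //; rewrite sum3.
  have Z l : `|z 0 l - x 0 l| <= d.
    rewrite updE; case: eqP => [->|_]; last exact/ltW/yx2.
    by rewrite subrr normr0; apply/ltW/e1.
  by do ?apply: lerD.
have B : `|h y - h z| <= M * d.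
  have bt t : btw (x 0 k) (y 0 k) t -> box a rho (upd y k t).
    move=> bt l; rewrite updE; case: eqP => [->|_]; last exact: by_.
    exact: btw_norm (bx k) (by_ k) bt.
  rewrite -{1}(upd_id y k).
  have [t ht|t ht ->] := @mvt_upd _ h y k (x 0 k) (y 0 k).
    exact: (fd_ode fd (bt _ ht)).1.
  rewrite (fd_ode fd (bt _ ht)).2 normrM; apply: ler_pM => //; last exact/ltW/yx2.
  by apply: (fd_bound fd); exact: (Tcbox (bt _ ht)).
have -> : h y - h x = (h y - h z) + (h z - h x) by rewrite subrKA.
apply: le_lt_trans (ler_normD _ _) _.
apply: (@le_lt_trans _ _ (M * d + 9 * d)); first exact: lerD.
rewrite -mulrDl /d mulrCA gtr_pMr // ltr_pdivrMr ?mul1r.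
  by rewrite addrC ltrDl.
by rewrite ltr_wpDl // addr_ge0.
Qed.

(* [v] solves the linearized equation, with the initial value of d_i h. *)
Lemma flow_partial i (v : E -> R^o) s : i != k -> 0 < s -> s <= rho ->
  (forall x, box a s x -> {for x, continuous v}) ->
  (forall x, box a s x -> v (upd x k (a 0 k)) = (i == j)%:R) ->
  (forall x, box a s x -> derivable v x (e_ k) /\ partial k v x =
     partial j m (T x) * v x + (if i == j then 0 else partial i m (T x))) ->
  forall x, box a s x -> derivable h x (e_ i) /\ partial i h x = v x.
Proof.
move=> ik s0 srho cv v0 dv x bx; apply: partial_epsilon => e e0.
have [q [q0 qs qx]] := box_shrink bx.
have cvt := continuous_clampb (ltW q0) qs cv.
have [B B0 HB] := @bounded_cbox _ _ a q cvt (ltW q0).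
have rho0 := fd_rho fd.
(* Gronwall's estimate will return 2 rho |eta| e' (B + 1), which is e |eta| for this e'. *)
have e1 : 0 < e / (2 * rho * (B + 1)).
  by rewrite divr_gt0 // !mulr_gt0 // ltr_wpDl.
set e' := e / _ in e1.
have ul l : exists2 d : R, 0 < d & forall y z, cbox a r0 y -> cbox a r0 z ->
    box y d z -> `|partial l m z - partial l m y| < e'.
  have cl := continuous_clampb (ltW (fd_r0 fd)) (fd_r0R fd)
    (Ck_continuous (Ck_partial l (m_smooth 1%N))).
  have [d d0 Hd] := @uniform_cbox _ _ a r0 _ cl e1.
  exists d => // y z cy cz yz; have := Hd y z cy yz.
  by rewrite !clampb_id.
have [dj dj0 Hj] := ul j; have [di di0 Hi] := ul i.
have [d2 d20 Hd2] := box_sub qx.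
(* By [flow_lipschitz] the unknown moves by at most 3 |eta|, so 3 d has to fit in the moduli of
   continuity of the derivatives of m. *)
have [d [d0 dd1 dd2 dd3]] : exists d : R,
    [/\ 0 < d, 3 * d <= dj, 3 * d <= di & d <= d2].
  exists (Num.min (dj / 3) (Num.min (di / 3) d2)).
  have p3 : 0 < (3 : R) by [].
  rewrite !lt_min !divr_gt0 // -!(mulrC _ 3) -!ler_pdivlMr //.
  by rewrite !ge_min !lexx !orbT.
exists d => // eta etad; set X := upd x i (eta + x 0 i).
have Xl l : X 0 l - x 0 l = if l == i then eta else 0.
  by rewrite updE; case: eqP => [->|_]; rewrite ?addrK ?subrr.
have bX : box a q X.
  apply: Hd2 => l; rewrite Xl; case: eqP => _; last by rewrite normr0.
  exact: lt_le_trans dd3.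
have Xk : X 0 k = x 0 k by rewrite upd_other // eq_sym.
have bxr : box a rho x by exact: boxS bx.
have bXr : box a rho X by apply: boxS bX; exact: ltW (lt_le_trans qs srho).
pose r := `|x 0 k - a 0 k|.
have rrho : r < rho by exact: bxr.
(* The error of the first-order expansion, followed along the solution; it is 0 at the initial time
   by the initial value of v. *)
pose phi (t : R^o) : R^o := h (upd X k t) - h (upd x k t) - eta * v (upd x k t).
pose b (t : R) : R := if i == j then 0 else partial i m (T (upd x k t)).
pose dphi (t : R) : R := m (T (upd X k t)) - m (T (upd x k t))
  - eta * (partial j m (T (upd x k t)) * v (upd x k t) + b t).
have bxt t : `|t - a 0 k| <= r -> box a q (upd x k t).
  move=> tr l; rewrite updE; case: eqP => [->|_]; last exact: qx.
  exact: le_lt_trans tr (qx k).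
have Hd t : `|t - a 0 k| <= r -> is_derive (t : R^o) (1 : R^o) phi (dphi t).
  move=> tr; have b1 := dist_btw tr bxr.
  have b2 : box a rho (upd X k t) by apply: dist_btw => //; rewrite Xk.
  have b3 := boxS (ltW qs) (bxt t tr).
  have [D1 E1] := fd_ode fd b1; have [D2 E2] := fd_ode fd b2.
  have [D3 E3] := dv _ b3.
  rewrite /dphi /b -E3 /T -E1 -E2; apply: is_deriveB; first apply: is_deriveB.
  - exact: is_derive_upd.
  - exact: is_derive_upd.
  - by apply: (@is_deriveZ _ _ _ (fun t : R^o => v (upd x k t)) eta);
      exact: is_derive_upd.
have Hb t : `|t - a 0 k| <= r -> `|dphi t| <= K * `|phi t| + `|eta| * e' * (B + 1).
  move=> tr; have b1 := dist_btw tr bxr.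
  have b2 : box a rho (upd X k t) by apply: dist_btw => //; rewrite Xk.
  have Xt l : upd X k t 0 l - upd x k t 0 l = if l == i then eta else 0.
    rewrite (updE X) (updE x); case: eqP => [->|_]; last exact: Xl.
    by rewrite subrr eq_sym (negbTE ik).
  have sumX : \sum_l `|upd X k t 0 l - upd x k t 0 l| = `|eta|.
    rewrite (bigD1 i) //= Xt eqxx big1 ?addr0 // => l li.
    by rewrite Xt (negbTE li) normr0.
  have lip : `|h (upd X k t) - h (upd x k t)| <= 3 * `|eta|.
    by rewrite -sumX; apply: flow_lipschitz => //; rewrite !upd_same.
  have TX : box (T (upd x k t)) (3 * d) (T (upd X k t)).
    have e3 : 3 * `|eta| < 3 * d by rewrite ltr_pM2l.
    move=> l; rewrite /T !(updE _ j); case: eqP => [_|_].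
      exact: le_lt_trans lip e3.
    rewrite Xt; apply: le_lt_trans e3; case: eqP => _; last by rewrite normr0 mulr_ge0.
    by rewrite ler_peMl // ler1n.
  pose sl l := slope m (T (upd x k t)) (T (upd X k t)) l.
  have slK l : `|sl l| <= K.
    rewrite /sl; have [z hz ->] := slope_sbox m (T (upd x k t)) (T (upd X k t)) l.
    by apply: (fd_partial fd); apply: sbox_cbox hz; exact: Tcbox.
  have sle l dl : 3 * d <= dl -> (forall y z, cbox a r0 y -> cbox a r0 z ->
      box y dl z -> `|partial l m z - partial l m y| < e') ->
      `|sl l - partial l m (T (upd x k t))| <= e'.
    move=> ddl Hl; rewrite /sl.
    have [z hz ->] := slope_sbox m (T (upd x k t)) (T (upd X k t)) l.
    apply/ltW/Hl; [exact: Tcbox|by apply: sbox_cbox hz; exact: Tcbox|].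
    by apply: boxS ddl _ _; exact: sbox_box_left hz.
  have dE : m (T (upd X k t)) - m (T (upd x k t)) =
      (h (upd X k t) - h (upd x k t)) * sl j + (if i == j then 0 else eta * sl i).
    rewrite slopeE; last first.
      by move=> z l hz; apply: dm; apply: sbox_cbox hz; exact: Tcbox.
    rewrite (bigD1 j) //= /T !upd_same; congr (_ + _).
    have [ij|ij] := eqVneq i j.
      rewrite big1 // => l lj; rewrite !(upd_other _ _ lj) Xt ij (negbTE lj).
      by rewrite mul0r.
    rewrite (bigD1 i) //= big1 ?addr0.
      by rewrite !(upd_other _ _ ij) Xt eqxx.
    move=> l /andP[lj li]; rewrite !(upd_other _ _ lj) Xt (negbTE li).
    by rewrite mul0r.
  have B1 : `|v (upd x k t)| <= B.
    have cq := box_cbox (bxt t tr); have := HB _ cq; by rewrite clampb_id.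
  have Sj := sle j dj dd1 Hj; have Si := sle i di dd2 Hi; have Kj := slK j.
  move: dE B1 Sj Si Kj; rewrite /dphi /phi /b => ->.
  move: (h (upd X k t)) (h (upd x k t)) (v (upd x k t)) => p p' w.
  move: (partial j m _) (partial i m _) (sl j) (sl i) => mj mi sj si wB Sj Si Kj.
  (* The term in phi carries the slope sj, bounded by K, as Gronwall's estimate needs; what remains
     is eta times deviations of slopes from derivatives at one point, each at most e'. *)
  have -> : (p - p') * sj + (if i == j then 0 else eta * si) -
      eta * (mj * w + (if i == j then 0 else mi)) =
      sj * (p - p' - eta * w) + (eta * (w * (sj - mj)) +
        (if i == j then 0 else eta * (si - mi))).
    by case: (i == j); ring.
  apply: le_trans (ler_normD _ _) _; apply: lerD.
    by rewrite normrM; apply: ler_wpM2r.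
  apply: le_trans (ler_normD _ _) _; rewrite (mulrDr _ B 1) mulr1; apply: lerD.
    rewrite !normrM -mulrA ler_wpM2l // mulrC.
    by apply: ler_pM.
  case: (i == j); first by rewrite normr0 mulr_ge0 // ltW.
  by rewrite normrM ler_wpM2l.
have rK : r * K <= 1 / 2.
  by apply: le_trans (fd_rhoK fd); apply: ler_wpM2r; [exact: fd_K fd|exact: ltW].
have Q0 : 0 <= `|eta| * e' * (B + 1).
  by apply: mulr_ge0; [apply: mulr_ge0 => //; exact: ltW|exact: addr_ge0].
have := gronwall_small (normr_ge0 _) rK (fd_K fd) Q0 Hd Hb.
move=> /(_ (x 0 k) (lexx _)); rewrite /phi -{1}Xk !upd_id !(fd_init fd) v0 //.
have -> : X 0 j - x 0 j - eta * (i == j)%:R = 0.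
  by rewrite Xl eq_sym; case: (i == j); rewrite ?mulr1 ?mulr0 subrr.
rewrite normr0 add0r => H; apply: le_trans H _.
have -> : e * `|eta| = 2 * (rho * (`|eta| * e' * (B + 1))).
  rewrite /e'; have : B + 1 != 0 by rewrite gt_eqF // ltr_wpDl.
  have : rho != 0 by rewrite gt_eqF.
  by move=> *; field; apply/andP.
by apply: ler_wpM2l => //; apply: ler_wpM2r => //; exact: ltW.
Qed.

(** If h is C^n, so are the coefficients of the linearized equation and, by [Ck_primitive], its
    explicit solution. By [flow_partial] this solution is a partial derivative of h, which is
    therefore C^(n+1). Half of rho leaves room for clamping. *)
Lemma flow_smooth : smooth (box a (rho / 2)) h.
Proof.
pose s := rho / 2; rewrite -/s.
have rho0 := fd_rho fd.
have s0 : 0 < s by rewrite divr_gt0.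
have srho : s < rho by rewrite /s ltr_pdivrMr // ltr_pMr // ltr1n.
have sub := boxS (a := a) (ltW srho).
have oB := @box_open R.
have TR x : box a rho x -> box a R0 (T x).
  by move=> bx; apply: boxS (ltW (fd_r0R fd)) _ (fd_box fd bx).
have CT n U : open U -> Ck n U h -> forall l, Ck n U (fun z => T z 0 l : R^o).
  move=> oU Ch l; have [->|lj] := eqVneq l j.
    by apply: eq_Ck Ch => // z _; rewrite /T upd_same.
  by apply: eq_Ck (@Ck_coord _ n U l oU) => // z _; rewrite /T upd_other.
have CmT n g : smooth (box a R0) g -> Ck n (box a s) h ->
    Ck n (box a s) (fun z => g (T z)).
  move=> Sg Ch; apply: (@Ck_comp _ n (box a s) (box a R0)) => //.
  - by move=> x /sub/TR.
  - exact: CT.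
have Sp l : smooth (box a R0) (partial l m) by move=> n; apply: Ck_partial.
have cont g : smooth (box a R0) g ->
    forall x, {for x, continuous (fun y => g (T (clampb a s y)))}.
  move=> Sg; apply: (@continuous_clampb _ (fun y => g (T y)) a s rho) => //.
    exact: ltW.
  move=> x bx; apply: continuous_comp3 => [l|].
    have C0 : Ck 0 (box a rho) h by split => // y; exact: flow_continuous.
    exact: Ck_continuous (CT _ _ (oB _ _) C0 l) _ bx.
  exact: Ck_continuous (Sg 0%N) _ (TR _ bx).
have prim g : (forall x, {for x, continuous g}) -> exists F : E -> R^o,
    [/\ forall x, F (upd x k (a 0 k)) = 0,
        forall x, derivable F x (e_ k) /\ partial k F x = g x,
        forall x, {for x, continuous F} &
        forall n f, (forall x, box a s x -> g x = f x) ->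
          Ck n (box a s) f -> Ck n (box a s) F].
  move=> cg; have [F [F0 dF]] := parametric_primitive k a cg.
  exists F; split => // [x|n f gf Cf].
    have [r bx] : exists r, box a r x.
      exists (\sum_l `|x 0 l - a 0 l| + 1) => l.
      rewrite (bigD1 l) //= -addrA ltrDl ltr_wpDl //.
      by apply: sumr_ge0.
    by apply: (@primitive_continuous _ k a r g F) => // *; exact: dF.
  apply: (@Ck_primitive _ n k a s f F) => // x bx.
  by rewrite -gf.
have [IA [IA0 dIA cIA CIA]] := prim _ (cont _ (Sp j)).
pose b i x : R^o := if i == j then 0 else partial i m (T x).
have cb i x : {for x, continuous (fun y => b i (clampb a s y))}.
  rewrite /b; case: (i == j); first exact: cst_continuous.
  exact: (cont _ (Sp i)).
have cexpN x : {for x, continuous (fun y => expR (- IA y) : R^o)}.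
  apply: continuous_comp; last exact: continuous_expR.
  by apply: (@continuousN _ R^o); exact: cIA.
have cc i x : {for x, continuous (fun y => b i (clampb a s y) * expR (- IA y) : R^o)}.
  by apply: (@continuousM R E); [exact: cb|exact: cexpN].
have V i : exists v : E -> R^o, [/\ forall x, v (upd x k (a 0 k)) = (i == j)%:R,
    forall x, box a s x -> derivable v x (e_ k) /\ partial k v x =
      partial j m (T x) * v x + b i x &
    forall n, Ck n (box a s) h -> Ck n (box a s) v].
  have [IC [IC0 dIC _ CIC]] := prim _ (cc i).
  (* Variation of constants: IA is a primitive of the linear coefficient, IC one of the source term
     times exp (- IA), and both vanish at the initial time. *)
  exists (fun x => expR (IA x) * (IC x + (i == j)%:R)); split.
  - by move=> x; rewrite IA0 IC0 expR0 mul1r add0r.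
  - move=> x bx; apply: is_derive_partial.
    have [D1 E1] := dIA x; have [D2 E2] := dIC x.
    rewrite -{1 2}(upd_id x k) in D1 D2.
    have H1 := is_derive_upd (s := x 0 k) D1; have H2 := is_derive_upd (s := x 0 k) D2.
    rewrite upd_id E1 clampb_id in H1; last exact: box_cbox.
    rewrite upd_id E2 clampb_id in H2; last exact: box_cbox.
    have H3 : is_derive (x 0 k : R^o) (1 : R^o)
        (fun t : R^o => expR (IA (upd x k t)) : R^o) (expR (IA x) * partial j m (T x)).
      have := @is_derive1_comp _ (expR : R^o -> R^o) (fun t : R^o => IA (upd x k t))
        (x 0 k) (expR (IA (upd x k (x 0 k)))) (partial j m (T x)).
      by move=> /(_ (is_derive_expR _) H1); rewrite upd_id.
    have H4 := is_deriveD H2 (is_derive_cst ((i == j)%:R : R^o) (x 0 k : R^o) (1 : R^o)).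
    have [D5 E5] := is_deriveM H3 H4.
    apply: DeriveDef; first exact: D5.
    apply: etrans E5 _.
    rewrite -[(_ + cst _) _]/(IC (upd x k (x 0 k)) + (i == j)%:R) upd_id.
    rewrite addr0 /GRing.scale /= expRN.
    have : expR (IA x) != 0 by rewrite gt_eqF // expR_gt0.
    move: (expR (IA x)) (partial j m (T x)) (IC x) (b i x) ((i == j)%:R) => w p q c u w0.
    by field.
  move=> n Ch.
  have C1 : Ck n (box a s) IA.
    apply: CIA (CmT n _ (Sp j) Ch) => x bx.
    by rewrite clampb_id //; exact: box_cbox.
  apply: CkM => //; first exact: Ck_exp.
  apply: CkD => //; last exact: Ck_cst.
  apply: (CIC n (fun x => b i x * expR (- IA x))).
    by move=> x bx; rewrite clampb_id //; exact: box_cbox.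
  apply: CkM => //; last by apply: Ck_exp => //; exact: CkN.
  rewrite /b; case: (i == j); first exact: Ck_cst.
  exact: CmT.
have Ch0 : Ck 0 (box a s) h by split => // x /sub; exact: flow_continuous.
elim=> [//|n IH]; apply: Ck_step => // [x /sub bx|i]; first exact: flow_continuous.
have [->|ik] := eqVneq i k.
  exists (fun x => m (T x)); split; last exact: CmT.
  by move=> x /sub/(fd_ode fd).
have [v [v0 dv Cv]] := V i; exists v; split; last exact: Cv.
apply: flow_partial => //; first exact: ltW.
exact: Ck_continuous (Cv _ Ch0).
Qed.

End Regularity.
End Flow.

(* The coordinate of index [k] is the time and the one of index [j] the unknown,
   so that [x 0 j] holds the initial value of [h]. *)
Lemma scalar_ode j k a U (m : E -> R^o) : j != k -> open U -> U a -> smooth U m ->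
  exists rho (h : E -> R^o), [/\ 0 < rho, smooth (box a rho) h,
    forall x, h (upd x k (a 0 k)) = x 0 j,
    forall x, box a rho x -> U (upd x j (h x)) &
    forall x, box a rho x -> partial k h x = m (upd x j (h x))].
Proof.
move=> jk oU Ua Sm.
have /nbhs_boxP[R0 R00 HU] : nbhs a U by exact: open_nbhs_nbhs.
have Sm' : smooth (box a R0) m by move=> n; apply: Ck_subset (Sm n).
have [r0 [K [M [rho [h fd]]]]] := flow_exists jk R00 Sm'.
have rho0 := fd_rho fd.
have sub : box a (rho / 2) `<=` box a rho.
  by apply: boxS; rewrite ler_pdivrMr // ler_pMr // ler1n.
exists (rho / 2), h; split.
- by rewrite divr_gt0.
- exact: flow_smooth fd.
- exact: fd_init fd.
- move=> x /sub bx; apply: HU; apply: boxS (ltW (fd_r0R fd)) _ (fd_box fd bx).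
- by move=> x /sub/(fd_ode fd)[].
Qed.

End ScalarODE.

(** * Inverse function theorem and local first integrals *)

Section InverseFunction.
Context {R : realType}.
Notation E := 'rV[R]_3.
Implicit Types (a v w x y z : E) (i j k l : 'I_3) (r s t e h : R) (A B J : 'M[R]_3).

Definition norm1 v : R := \sum_l `|v 0 l|.

Lemma norm1D v w : norm1 (v + w) <= norm1 v + norm1 w.
Proof.
by rewrite /norm1 -big_split; apply: ler_sum => l _; rewrite mxE; exact: ler_normD.
Qed.

Lemma norm1N v : norm1 (- v) = norm1 v.
Proof. by apply: eq_bigr => l _; rewrite mxE normrN. Qed.

Lemma norm1_coord v l : `|v 0 l| <= norm1 v.
Proof. by rewrite /norm1 (bigD1 l) //= lerDl; exact: sumr_ge0. Qed.

Lemma norm1_le v e : (forall l, `|v 0 l| <= e) -> norm1 v <= 3 * e.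
Proof.
move=> H; rewrite /norm1 sum3 (_ : 3 * e = e + e + e); last by ring.
by do ?apply: lerD.
Qed.

Lemma norm1_mul v A e : 0 <= e -> (forall i l, `|A i l| <= e) ->
  norm1 (v *m A) <= 3 * e * norm1 v.
Proof.
move=> e0 H.
rewrite (_ : 3 * e * norm1 v = \sum_(l < 3) (e * norm1 v)); last first.
  by rewrite sum3; ring.
apply: ler_sum => l _; rewrite mxE; apply: le_trans (ler_norm_sum _ _ _) _.
rewrite mulr_sumr; apply: ler_sum => i _; rewrite normrM mulrC.
exact: ler_wpM2r.
Qed.

Lemma norm1_eq0 v : norm1 v <= 0 -> v = 0.
Proof.
move=> H; apply/rowP => l; rewrite mxE; apply/eqP; rewrite -normr_le0.
exact: le_trans (norm1_coord v l) H.
Qed.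

Lemma entry_bound A : exists2 c : R, 0 < c & forall i l, `|A i l| <= c.
Proof.
exists (\sum_i \sum_l `|A i l| + 1).
  by rewrite ltr_wpDl //; do 2!apply: sumr_ge0 => ? _.
move=> i l; rewrite (bigD1 i) //= (bigD1 l) //= -!addrA lerDl.
by rewrite !addr_ge0 //; do ?[apply: sumr_ge0 => ? _].
Qed.

Lemma unitmx_inj J : (forall v, v *m J = 0 -> v = 0) -> J \in unitmx.
Proof.
move=> H; rewrite -row_free_unit -kermx_eq0; apply/eqP/row_matrixP => i.
by rewrite row0; apply: H; rewrite -row_mul mulmx_ker row0.
Qed.

(** With c a bound of the entries of J^-1, v - v A J^-1 = v (J - A) J^-1 costs 3 c * 3 d, which is
    1/2 for d = 1 / (18 c). Absorbing this half leaves |v| <= 2 * 3 c |v A|, whence C = 6 c. *)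
Lemma perturbed_inverse J : J \in unitmx -> exists d C : R,
  [/\ 0 < d, 0 < C & forall A, (forall i l, `|A i l - J i l| <= d) ->
    (forall v, norm1 v <= C * norm1 (v *m A)) /\
    (forall v, norm1 (v - v *m A *m invmx J) <= 1 / 2 * norm1 v)].
Proof.
move=> uJ; have [c c0 Hc] := entry_bound (invmx J).
have d0 : 0 < 1 / (18 * c) by rewrite divr_gt0 // mulr_gt0.
exists (1 / (18 * c)), (6 * c); split=> // [|A HA]; first by rewrite mulr_gt0.
have key v : norm1 (v - v *m A *m invmx J) <= 1 / 2 * norm1 v.
  have -> : v - v *m A *m invmx J = (v *m (J - A)) *m invmx J.
    by rewrite mulmxBr mulmxBl mulmxK.
  apply: le_trans (norm1_mul _ (ltW c0) Hc) _.
  have : norm1 (v *m (J - A)) <= 3 * (1 / (18 * c)) * norm1 v.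
    apply: norm1_mul; first exact: ltW.
    by move=> i l; rewrite !mxE distrC.
  have c3 : 0 <= 3 * c by rewrite mulr_ge0 // ltW.
  move=> /(ler_wpM2l c3) /le_trans; apply.
  rewrite (_ : 3 * c * (3 * (1 / (18 * c)) * norm1 v) = 1 / 2 * norm1 v) //.
  by field; rewrite gt_eqF.
split=> // v.
have H1 := key v; have H2 := norm1_mul (v *m A) (ltW c0) Hc.
have := norm1D (v - v *m A *m invmx J) (v *m A *m invmx J); rewrite subrK => H3.
have E6 : 6 * c * norm1 (v *m A) = 2 * (3 * c * norm1 (v *m A)) by ring.
rewrite E6; move: H1 H2 H3; move: (norm1 v) (3 * c * _) (norm1 (v - _)) (norm1 (_ *m invmx J)).
by move=> p q p' q'; lra.
Qed.

(** The transpose of the usual Jacobian matrix: vectors are rows, and the derivative along v is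
    [v *m jac T x]. *)
Definition jac (T : E -> E) x : 'M[R]_3 :=
  \matrix_(i, l) partial i (fun z => T z 0 l : R^o) x.

Section Local.
Variables (T : E -> E) (a : E) (U : set E).
Hypotheses (oU : open U) (Ua : U a)
  (sT : forall l, smooth U (fun x => T x 0 l : R^o))
  (uJ : jac T a \in unitmx).

(** The slope matrix makes the increments of T exactly linear ([AE]), and it is close to the
    Jacobian ([A_close]). *)
Let A x y : 'M[R]_3 := \matrix_(i, l) slope (fun z => T z 0 l : R^o) x y i.

Let AE x y : (forall z, sbox x y z -> U z) -> T y - T x = (y - x) *m A x y.
Proof.
move=> H; apply/rowP => l; rewrite !mxE.
rewrite -[LHS]/((fun z => T z 0 l : R^o) y - (fun z => T z 0 l : R^o) x).
rewrite slopeE; last first.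
  by move=> z i hz; apply: (Ck_derivable (i := i) (sT l 1%N)); exact: H.
by apply: eq_bigr => i _; rewrite !mxE.
Qed.

Let A_close x e : U x -> 0 < e -> exists2 d : R, 0 < d &
  forall y z, box x d y -> box x d z -> forall i l, `|A y z i l - jac T x i l| <= e.
Proof.
move=> Ux e0.
have H i l : exists2 d : R, 0 < d & forall y, box x d y -> forall z, box x d z ->
    `|A y z i l - jac T x i l| <= e.
  have [|d d0 Hd] := @slope_lim _ (fun z => T z 0 l : R^o) x i _ e e0.
    apply: Ck_continuous Ux; exact: Ck_partial (sT l 1%N).
  by exists d => // y hy z hz; rewrite !mxE; apply/ltW/Hd.
have Hi i : exists2 d : R, 0 < d & forall y, box x d y -> forall l z, box x d z ->
    `|A y z i l - jac T x i l| <= e.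
  have [d0 d00 H0] := H i 0; have [d1 d10 H1] := H i 1; have [d2 d20 H2] := H i 2.
  exists (Num.min d0 (Num.min d1 d2)); first by rewrite !lt_min d00 d10.
  move=> y hy; apply: ord3P => z hz; [apply: H0|apply: H1|apply: H2];
    (apply: boxS hy + apply: boxS hz); by rewrite !ge_min lexx ?orbT.
have [d0 d00 H0] := Hi 0; have [d1 d10 H1] := Hi 1; have [d2 d20 H2] := Hi 2.
exists (Num.min d0 (Num.min d1 d2)); first by rewrite !lt_min d00 d10.
move=> y z hy hz; apply: ord3P => l; [apply: H0|apply: H1|apply: H2];
  (apply: boxS hy + apply: boxS hz); by rewrite !ge_min lexx ?orbT.
Qed.

Let jac_slope x : jac T x = A x x.
Proof.
apply/matrixP => i l; rewrite !mxE.
have [z hz ->] := slope_sbox (fun z => T z 0 l : R^o) x x i; congr partial.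
apply/rowP => k; have := hz k; rewrite /btw -!eq_le orbb => /eqP ->.
by [].
Qed.

(** Injectivity comes from the invertibility of the slope matrices near [jac T a], surjectivity from
    Newton's iteration with the derivative frozen at [a], and smoothness of S from the formula for
    its derivative. *)
Lemma inverse_function : exists V r (S : E -> E),
  [/\ open V, V a, V `<=` U & 0 < r] /\
  [/\ forall x, V x -> box (T a) r (T x) /\ S (T x) = x,
      forall y, box (T a) r y -> V (S y) /\ T (S y) = y,
      forall l, smooth (box (T a) r) (fun y => S y 0 l : R^o) &
      forall x, V x -> jac T x \in unitmx].
Proof.
have [d [C [d0 C0 HC]]] := perturbed_inverse uJ.
have [q1 q10 Hq1] := A_close Ua d0.
have /nbhs_boxP[q2 q20 Hq2] : nbhs a U by exact: open_nbhs_nbhs.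
have [q [q0 qq1 qq2]] : exists q : R, [/\ 0 < q, q <= q1 & q <= q2].
  by exists (Num.min q1 q2); rewrite lt_min q10 q20 !ge_min !lexx !orbT.
have qU x : box a q x -> U x by move=> /(boxS qq2)/Hq2.
have qA x y : box a q x -> box a q y -> T y - T x = (y - x) *m A x y.
  by move=> hx hy; apply: AE => z hz; apply: qU; exact: sbox_box hz.
have qd x y : box a q x -> box a q y -> forall i l, `|A x y i l - jac T a i l| <= d.
  by move=> /(boxS qq1) hx /(boxS qq1) hy; exact: Hq1.
have lip x y : box a q x -> box a q y -> norm1 (y - x) <= C * norm1 (T y - T x).
  by move=> hx hy; rewrite qA //; case: (HC _ (qd _ _ hx hy)).
have Tinj x y : box a q x -> box a q y -> T x = T y -> x = y.
  move=> hx hy Txy; apply/eqP; rewrite eq_sym -subr_eq0; apply/eqP/norm1_eq0.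
  apply: le_trans (lip _ _ hx hy) _; rewrite Txy subrr /norm1 big1 ?mulr0 // => l _.
  by rewrite mxE normr0.
have uq x : box a q x -> jac T x \in unitmx.
  move=> hx; rewrite jac_slope.
  apply: unitmx_inj => v vA; apply: norm1_eq0.
  have [/(_ v)] := HC _ (qd _ _ hx hx); rewrite vA.
  by rewrite /norm1 [X in C * X]big1 ?mulr0 // => l _; rewrite mxE normr0.
have [cJ cJ0 HcJ] := entry_bound (jac T a).
have [cI cI0 HcI] := entry_bound (invmx (jac T a)).
(* The first Newton step is at most 3 cI * 3 r = q / 4. Later steps are halved each time, so the
   iterates stay within q / 2 of a. *)
pose b := T a; pose r := q / (36 * cI).
have r0 : 0 < r by rewrite divr_gt0 // mulr_gt0.
have surj y : box b r y -> exists2 x, box a q x & T x = y.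
  move=> hy.
  pose N x := x + (y - T x) *m invmx (jac T a).
  pose X n := iter n N a.
  have D0 : norm1 (X 1%N - X 0%N) <= q / 4.
    rewrite /X /= /N addrC addKr.
    apply: le_trans (norm1_mul _ (ltW cI0) HcI) _.
    have : norm1 (y - T a) <= 3 * r by apply: norm1_le => l; rewrite !mxE; apply/ltW/hy.
    have c3 : 0 <= 3 * cI by rewrite mulr_ge0 // ltW.
    move=> /(ler_wpM2l c3) /le_trans; apply.
    by rewrite le_eqVlt; apply/orP; left; apply/eqP; rewrite /r; field; rewrite gt_eqF.
  have NN x z : box a q x -> box a q z -> norm1 (N z - N x) <= 1 / 2 * norm1 (z - x).
    move=> hx hz; rewrite /N.
    have -> : z + (y - T z) *m invmx (jac T a) - (x + (y - T x) *m invmx (jac T a))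
        = (z - x) - (z - x) *m A x z *m invmx (jac T a).
      rewrite -qA // !mulmxBl; move: (y *m _) (T z *m _) (T x *m _) => p p' p''.
      by apply/rowP => l; rewrite !mxE; ring.
    by have [_] := HC _ (qd _ _ hx hz).
  have box_of x : norm1 (x - a) < q -> box a q x.
    by move=> H l; apply: le_lt_trans H; have := norm1_coord (x - a) l; rewrite !mxE.
  have X_bd n : [/\ norm1 (X n - a) <= q / 2 - q / 2 / 2 ^+ n,
      norm1 (X n.+1 - a) <= q / 2 - q / 2 / 2 ^+ n.+1 &
      norm1 (X n.+1 - X n) <= q / 4 / 2 ^+ n].
    have p0 m : 0 < q / 2 / 2 ^+ m by rewrite !divr_gt0 // exprn_gt0.
    have half p : 0 < p -> (q / 2 - p < q) by move=> ?; lra.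
    elim: n => [|n [B1 B2 B3]].
      have e1 : norm1 (X 0%N - a) <= q / 2 - q / 2 / 2 ^+ 0.
        by rewrite expr0 divr1 !subrr /norm1 big1 // => l _; rewrite mxE normr0.
      split=> //; last by rewrite expr0 divr1.
      rewrite expr1; apply: le_trans D0 _; lra.
    have b1 := box_of _ (le_lt_trans B1 (half _ (p0 _))).
    have b2 := box_of _ (le_lt_trans B2 (half _ (p0 _))).
    have B4 : norm1 (X n.+2 - X n.+1) <= q / 4 / 2 ^+ n.+1.
      apply: le_trans (NN _ _ b1 b2) _; rewrite exprS.
      have : (2 ^+ n : R) != 0 by rewrite expf_neq0.
      move: B3; move: (norm1 _) (2 ^+ n : R) => u p H pn0.
      have -> : q / 4 / (2 * p) = 1 / 2 * (q / 4 / p) by field.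
      by apply: ler_wpM2l => //; lra.
    split=> //.
    have -> : X n.+2 - a = (X n.+2 - X n.+1) + (X n.+1 - a) by rewrite subrKA.
    apply: le_trans (norm1D _ _) _; apply: le_trans (lerD B4 B2) _.
    rewrite !exprS; have : (2 ^+ n : R) != 0 by rewrite expf_neq0.
    move: (2 ^+ n : R) => p pn0.
    rewrite le_eqVlt; apply/orP; left; apply/eqP; field.
    exact: pn0.
  have q4 : 0 <= q / 4 by rewrite divr_ge0 // ltW.
  have Hl l : exists p : R, forall n, `|X n 0 l - p| <= 2 * (q / 4) / 2 ^+ n.
    apply: (@geometric_limit R (fun n => X n 0 l) (q / 4)) => // n.
    by have [_ _] := X_bd n; apply: le_trans; have := norm1_coord (X n.+1 - X n) l;
      rewrite !mxE.
  have [p Hp] := choice Hl; pose x : E := \row_l p l.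
  have Xx n : norm1 (X n - x) <= 3 * (2 * (q / 4) / 2 ^+ n).
    by apply: norm1_le => l; rewrite !mxE; exact: Hp.
  have hX n : box a q (X n).
    apply: box_of; have [B1 _ _] := X_bd n; apply: le_lt_trans B1 _.
    have : 0 < q / 2 / 2 ^+ n by rewrite !divr_gt0 // exprn_gt0.
    by lra.
  have hx : box a q x.
    move=> l; rewrite mxE; have := Hp l 0%N; rewrite /X /= expr0 divr1 distrC.
    by move=> /le_lt_trans; apply; lra.
  exists x => //; apply/eqP; rewrite -subr_eq0; apply/eqP/norm1_eq0.
  (* The residual y - T (X n) is the next step times the Jacobian, and T x - T (X n) is controlled
     by x - X n; both decay like 2^-n. *)
  have step n : norm1 (T x - y) <= (3 * (d + cJ) * (3 * (2 * (q / 4))) + 3 * cJ * (q / 4)) / 2 ^+ n.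
    have -> : T x - y = (T x - T (X n)) - (y - T (X n)).
      by rewrite opprB addrA subrK.
    apply: le_trans (norm1D _ _) _; rewrite norm1N mulrDl; apply: lerD.
      rewrite qA //; apply: le_trans (norm1_mul _ (_ : 0 <= d + cJ) _) _.
      - by rewrite addr_ge0 // ltW.
      - move=> i l; rewrite -[A _ _ i l](subrK (jac T a i l)).
        by apply: le_trans (ler_normD _ _) _; apply: lerD => //; exact: qd.
      rewrite -[leRHS]mulrA; apply: ler_wpM2l; last by rewrite -mulrA -norm1N opprB.
      by rewrite mulr_ge0 // addr_ge0 // ltW.
    have -> : y - T (X n) = (X n.+1 - X n) *m jac T a.
      have -> : X n.+1 = X n + (y - T (X n)) *m invmx (jac T a) by [].
      by rewrite (addrC (X n)) addrK mulmxKV.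
    apply: le_trans (norm1_mul _ (ltW cJ0) HcJ) _; rewrite -[leRHS]mulrA.
    by apply: ler_wpM2l; [rewrite mulr_ge0 // ltW|case: (X_bd n)].
  apply/ler_addgt0Pr => e e0; rewrite add0r.
  have K0 : 0 <= 3 * (d + cJ) * (3 * (2 * (q / 4))) + 3 * cJ * (q / 4).
    have := ltW cJ0; have := ltW d0 => d0' cJ0'.
    by move: (q / 4) q4 => p' p0'; do ?[apply: addr_ge0|apply: mulr_ge0].
  have [n Hn] := geometric_small K0 e0.
  exact: le_trans (step n) Hn.
have [S HS] : exists S : E -> E, forall y, box b r y -> box a q (S y) /\ T (S y) = y.
  have H y : exists x, box b r y -> box a q x /\ T x = y.
    have [hy|ny] := pselect (box b r y); last by exists a.
    by have [x hx Tx] := surj y hy; exists x.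
  by have [S HS] := choice H; exists S.
have cT l x : U x -> {for x, continuous (fun z => T z 0 l : R^o)}.
  exact: (Ck_continuous (sT l 0%N)).
pose V := [set x | box a q x /\ box b r (T x)].
have oV : open V.
  rewrite openE => x [bx bT]; have [s s0 Hs] := box_sub bx; have [t t0 Ht] := box_sub bT.
  have [p p0 Hp] : exists2 p : R, 0 < p & forall z, box x p z ->
      forall l, `|T z 0 l - T x 0 l| < t.
    apply: box_forall => l.
    by have /continuous_boxP/(_ t t0) := cT l x (qU _ bx).
  apply/nbhs_boxP; exists (Num.min s p); first by rewrite lt_min s0.
  move=> z hz; split; first by apply: Hs; apply: boxS hz; rewrite ge_min lexx.
  by apply: Ht; apply: Hp; apply: boxS hz; rewrite ge_min lexx orbT.
have Slip y z : box b r y -> box b r z -> norm1 (S z - S y) <= C * norm1 (z - y).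
  move=> hy hz; have [b1 e1] := HS y hy; have [b2 e2] := HS z hz.
  by rewrite -{2}e1 -{2}e2; exact: lip.
have Scont l y : box b r y -> {for y, continuous (fun z => S z 0 l : R^o)}.
  move=> hy; apply/continuous_boxP => e e0; have [s s0 Hs] := box_sub hy.
  exists (Num.min s (e / (3 * C + 1))).
    by rewrite lt_min s0 divr_gt0 // ltr_wpDl // mulr_ge0 // ltW.
  move=> z hz; have hz1 : box b r z.
    by apply: Hs; apply: boxS hz; rewrite ge_min lexx.
  have hz2 : norm1 (z - y) <= 3 * (e / (3 * C + 1)).
    apply: norm1_le => k; rewrite !mxE; have := hz k; rewrite lt_min => /andP[_].
    exact: ltW.
  have := norm1_coord (S z - S y) l; rewrite !mxE => /le_lt_trans; apply.
  apply: le_lt_trans (Slip _ _ hy hz1) _.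
  apply: le_lt_trans (ler_wpM2l (ltW C0) hz2) _.
  rewrite mulrA mulrA ltr_pdivrMr; last by rewrite ltr_wpDl // mulr_ge0 // ltW.
  rewrite (_ : C * (3 * e) = e * (3 * C)); last by ring.
  by rewrite ltr_pM2l // ltrDl.
have Spart i l y : box b r y -> derivable (fun z => S z 0 l : R^o) y (e_ i) /\
    partial i (fun z => S z 0 l : R^o) y = invmx (jac T (S y)) i l.
  move=> hy; have [hx Tx] := HS y hy; have ux := uq _ hx.
  apply: partial_epsilon => e e0.
  have [c c0 Hc] := entry_bound (invmx (jac T (S y))).
  (* Two matrix products cost 3 c and 3 times this number, and S is C-Lipschitz: the total is e
     |h|. *)
  have e1 : 0 < e / (9 * c * C) by rewrite divr_gt0 // !mulr_gt0.
  have [p p0 Hp] := A_close (qU _ hx) e1.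
  have [s s0 Hs] := box_sub hy.
  exists (Num.min s (p / C)); first by rewrite lt_min s0 divr_gt0.
  move=> h; rewrite lt_min => /andP[hs hp].
  set z := upd y i (h + y 0 i).
  have zy : z - y = h *: e_ i.
    by rewrite /z -add_e_upd addrK.
  have nzy : norm1 (z - y) = `|h|.
    rewrite zy /norm1 (bigD1 i) //= big1 ?addr0 => [|k ki].
      by rewrite !mxE !eqxx mulr1.
    by rewrite !mxE (negbTE ki) andbF mulr0 normr0.
  have hz : box b r z.
    apply: Hs => k; have := norm1_coord (z - y) k; rewrite nzy !mxE => H.
    exact: le_lt_trans hs.
  have [hw Tw] := HS z hz.
  have nS : norm1 (S z - S y) <= C * `|h| by rewrite -nzy; exact: Slip.
  have hwp : box (S y) p (S z).
    move=> k; have := norm1_coord (S z - S y) k; rewrite !mxE => H.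
    apply: le_lt_trans H _; apply: le_lt_trans nS _.
    by rewrite mulrC -ltr_pdivlMr.
  have E1 : (S z - S y) *m A (S y) (S z) = h *: e_ i by rewrite -qA // Tx Tw zy.
  have AJ : forall i0 l0, `|(jac T (S y) - A (S y) (S z)) i0 l0| <= e / (9 * c * C).
    move=> i0 l0; rewrite mxE [X in _ + X]mxE distrC.
    by apply: Hp => //; exact: box_center.
  pose u := h *: row i (invmx (jac T (S y))).
  (* The increment of S times the slope matrix is h e_i, so the error of linearization is the
     increment times the gap between Jacobian and slopes. *)
  have E2 : S z - S y - u = (S z - S y) *m (jac T (S y) - A (S y) (S z))
      *m invmx (jac T (S y)).
    rewrite mulmxBr mulmxBl mulmxK // E1; congr (_ - _).
    by rewrite /u -scalemxAl rowE.
  have := norm1_coord (S z - S y - u) l; rewrite {1}/u !mxE => /le_trans; apply.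
  rewrite E2; apply: le_trans (norm1_mul _ (ltW c0) Hc) _.
  have c3 : 0 <= 3 * c by rewrite mulr_ge0 // ltW.
  have H3 := norm1_mul (S z - S y) (ltW e1) AJ.
  apply: le_trans (ler_wpM2l c3 H3) _.
  have e3 : 0 <= 3 * (e / (9 * c * C)) by rewrite mulr_ge0 // ltW.
  apply: le_trans (ler_wpM2l c3 (ler_wpM2l e3 nS)) _.
  rewrite le_eqVlt; apply/orP; left; apply/eqP; field.
  by rewrite !gt_eqF.
have oW : open (box b r) by exact: box_open.
exists V, r, S; split; split => //.
- by split; [exact: box_center|exact: box_center].
- by move=> x [/qU].
- move=> x [hx hTx]; split => //; have [h1 h2] := HS _ hTx; exact: Tinj.
- move=> y hy; have [h1 h2] := HS y hy; split => //; split => //.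
  by rewrite h2.
- move=> l n; elim: n l => [|n IH] l; first by split => // y; exact: Scont.
  apply: Ck_step => // [y|i]; first exact: Scont.
  (* The derivative of S is a smooth expression in S itself, so a C^n inverse is C^(n+1). *)
  exists (fun y => invmx (jac T (S y)) i l); split; first by move=> y /Spart.
  apply: Ck_invmx => // [p p'|y /HS[/uq]]; last by rewrite unitmxE unitfE.
  apply: (@eq_Ck _ _ n _ (fun y => partial p (fun z => T z 0 p' : R^o) (S y))) => //.
    by move=> y _; rewrite mxE.
  apply: (@Ck_comp _ n (box b r) (box a q)) => //; first exact: box_open.
    by move=> y /HS[].
  apply: Ck_partial; apply: Ck_subset (sT p' n.+1); exact: qU.
- by move=> x [/uq].
Qed.

End Local.

(* [g] sends a point to the initial value of the integral curve through it. *)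
Lemma first_integral j k a U (m : E -> R^o) : j != k -> open U -> U a ->
  smooth U m -> exists r (g : E -> R^o), [/\ 0 < r, smooth (box a r) g,
    forall y, box a r y -> U y /\ partial k g y + m y * partial j g y = 0 &
    partial j g a != 0].
Proof.
move=> jk oU Ua Sm.
have [rho [h [rho0 Sh h0 hU hk]]] := scalar_ode jk oU Ua Sm.
(* T replaces the initial value by the current value of the solution; the coordinate j of its
   inverse is the first integral sought. *)
pose T x : E := upd x j (h x).
have ha : h a = a 0 j by rewrite -{1}(upd_id a k) h0.
have Ta : T a = a by rewrite /T ha upd_id.
have oB := @box_open R a rho.
have ba : box a rho a by exact: box_center.
have Tl l : (fun z => T z 0 l : R^o) = if l == j then h else coord l.
  apply/funext => z; rewrite /T updE; by case: (l == j).
have sT l : smooth (box a rho) (fun z => T z 0 l : R^o).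
  by rewrite Tl; case: (l == j) => // n; exact: Ck_coord.
have dT i l x : box a rho x -> is_derive x (e_ i) (fun z => T z 0 l : R^o)
    (if l == j then partial i h x else (l == i)%:R).
  move=> bx; rewrite Tl; case: (l == j).
    by apply: derivableP; exact: (Ck_derivable (i := i) (Sh 1%N)).
  by have [D <-] := partial_coord i l x; exact: derivableP.
have jT i l x : box a rho x ->
    jac T x i l = if l == j then partial i h x else (l == i)%:R.
  by move=> bx; rewrite mxE; have [_] := dT i l x bx.
have hja : partial j h a = 1.
  have D : is_derive (a 0 j : R^o) (1 : R^o) (fun s : R^o => h (upd a j s)) 1.
    rewrite (_ : (fun _ => _) = (id : R^o -> R^o)); first exact: is_derive_id.
    apply/funext => s /=; rewrite -{1}(upd_id a k) upd_comm 1?eq_sym //.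
    by rewrite h0 upd_same.
  by have [_] := is_derive_partial D.
have uJ : jac T a \in unitmx.
  (* Apart from the column j, [jac T a] is the identity, and its entry (j, j) is 1 because h at time
     a_k is the initial value. *)
  apply: unitmx_inj => v vJ.
  have vl l : l != j -> v 0 l = 0.
    move=> lj; have := congr1 (fun w : E => w 0 l) vJ; rewrite !mxE (bigD1 l) //=.
    rewrite jT // (negbTE lj) eqxx mulr1 big1 ?addr0 // => i il.
    by rewrite jT // (negbTE lj) eq_sym (negbTE il) mulr0.
  apply/rowP => l; rewrite mxE; have [->|/vl//] := eqVneq l j.
  have := congr1 (fun w : E => w 0 j) vJ; rewrite !mxE (bigD1 j) //=.
  rewrite jT // eqxx hja mulr1 big1 ?addr0 // => i ij.
  by rewrite vl // mul0r.
have [V [r [S [[oV Va VU r0] [VT HS sS _]]]]] := inverse_function oB ba sT uJ.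
rewrite Ta in VT HS sS.
pose g (y : E) : R^o := S y 0 j.
(* Differentiate g (T x) = x_j. For i = k the result is the equation of a first integral, since
   [partial k h] is m at T x; for i = j it shows that [partial j g a] is not 0. *)
have chain i x : V x -> \sum_l jac T x i l * partial l g (T x) = (j == i)%:R.
  move=> Vx; have [bTx _] := VT x Vx; have bx := VU x Vx.
  have C1 : C1at g (T x) by exact: C1at_Ck (@box_open R a r) (sS j 1%N) bTx.
  have D := @is_derive_comp3 _ g T x (e_ i) _ C1 (fun l => dT i l x bx).
  have [_ <-] := partial_coord i j x.
  have -> : partial i (coord j : E -> R^o) x = partial i (fun z => g (T z)) x.
    apply: near_eq_derive; have : nbhs x V by exact: open_nbhs_nbhs.
    by apply: filterS => z Vz; rewrite /g (VT z Vz).2.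
  have [_ D2] := D; rewrite /partial; apply: etrans (esym D2).
  by apply: eq_bigr => l _; rewrite jT.
have chain2 i x : V x -> partial i h x * partial j g (T x) +
    (if i == j then 0 else partial i g (T x)) = (j == i)%:R.
  move=> Vx; rewrite -(chain i x Vx) (bigD1 j) //= jT ?eqxx; last exact: VU.
  congr (_ + _); have bx := VU x Vx; have [ij|ij] := eqVneq i j.
    rewrite big1 // => l lj.
    by rewrite jT // ij (negbTE lj) mul0r.
  rewrite (bigD1 i) //= big1 ?addr0.
    by rewrite jT // (negbTE ij) eqxx mul1r.
  by move=> l /andP[lj li]; rewrite jT // (negbTE lj) (negbTE li) mul0r.
exists r, g; split => //.
- exact: sS.
- move=> y hy; have [Vx Tx] := HS y hy; have bx := VU _ Vx.
  split; first by rewrite -Tx; exact: hU.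
  have := chain2 k _ Vx; rewrite eq_sym (negbTE jk) hk // -/(T _) Tx addrC.
  by [].
- apply/eqP => g0; have := chain2 j a Va; rewrite eqxx Ta g0 mulr0 addr0.
  by move=> /eqP; rewrite eq_sym oner_eq0.
Qed.

End InverseFunction.

(** * Germs of functions and fields, brackets, local coordinate systems *)

Section Germs.
Context {R : realType}.
Notation E := 'rV[R]_3.
Implicit Types (a x y z : E) (i j k l : 'I_3) (r s t e h : R) (f g F : E -> R^o).
Implicit Types (X Y Z T u : E -> E) (P Q : E -> Prop).

(** Neighbourhoods without named radii. By [ev_ev], an identity valid near [a] holds near each
    nearby point, and so can be differentiated there. *)
Definition ev a P := exists2 r : R, 0 < r & forall x, box a r x -> P x.

Lemma evS a P Q : (forall x, P x -> Q x) -> ev a P -> ev a Q.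
Proof. by move=> PQ [r r0 H]; exists r => // x /H/PQ. Qed.

Lemma evI a P Q : ev a P -> ev a Q -> ev a (fun x => P x /\ Q x).
Proof.
move=> [r r0 Hr] [s s0 Hs]; exists (Num.min r s); first by rewrite lt_min r0.
move=> x bx; split; [apply: Hr|apply: Hs]; apply: boxS bx;
  by rewrite ge_min lexx ?orbT.
Qed.

Lemma evS2 a P Q (S : E -> Prop) : (forall x, P x -> Q x -> S x) ->
  ev a P -> ev a Q -> ev a S.
Proof. by move=> H p q; apply: evS (evI p q) => x [/H]. Qed.

Lemma ev_pt a P : ev a P -> P a.
Proof. by move=> [r r0]; apply; exact: box_center. Qed.

Lemma ev_open a P U : open U -> U a -> (forall x, U x -> P x) -> ev a P.
Proof.
move=> oU Ua UP; have /nbhs_boxP[r r0 H] : nbhs a U by exact: open_nbhs_nbhs.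
by exists r => // x /H/UP.
Qed.

Lemma ev_ev a P : ev a P -> ev a (fun y => ev y P).
Proof.
move=> [r r0 H]; exists r => // y /box_sub[s s0 Hs].
by exists s => // x /Hs/H.
Qed.

Lemma ev_all3 a (P : 'I_3 -> E -> Prop) : (forall l, ev a (P l)) ->
  ev a (fun x => forall l, P l x).
Proof. exact: box_forall. Qed.

Definition sm a f := exists2 r : R, 0 < r & smooth (box a r) f.
Definition smv a X := forall l, sm a (fun y => X y 0 l : R^o).

Lemma sm_ev a f : sm a f -> ev a (fun y => sm y f).
Proof.
move=> [r r0 H]; exists r => // y /box_sub[s s0 Hs].
by exists s => // n; apply: Ck_subset (H n).
Qed.

Lemma smv_ev a X : smv a X -> ev a (fun y => smv y X).
Proof. by move=> H; apply: ev_all3 => l; exact: sm_ev (H l). Qed.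

Lemma sm_open a f U : open U -> U a -> smooth U f -> sm a f.
Proof.
move=> oU Ua Sf; have /nbhs_boxP[r r0 H] : nbhs a U by exact: open_nbhs_nbhs.
by exists r => // n; apply: Ck_subset (Sf n).
Qed.

Lemma smI a f g : sm a f -> sm a g ->
  exists r : R, [/\ 0 < r, smooth (box a r) f & smooth (box a r) g].
Proof.
move=> [r r0 Hr] [s s0 Hs]; exists (Num.min r s); split.
- by rewrite lt_min r0.
- by move=> n; apply: Ck_subset (Hr n); apply: boxS; rewrite ge_min lexx.
- by move=> n; apply: Ck_subset (Hs n); apply: boxS; rewrite ge_min lexx orbT.
Qed.

Lemma sm_eq a f g : ev a (fun y => f y = g y) -> sm a f -> sm a g.
Proof.
move=> [r r0 Hr] [s s0 Hs]; exists (Num.min r s); first by rewrite lt_min r0.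
move=> n; apply: (@eq_Ck _ _ n _ f); first exact: box_open.
  by move=> y by_; apply: Hr; apply: boxS by_; rewrite ge_min lexx.
by apply: Ck_subset (Hs n); apply: boxS; rewrite ge_min lexx orbT.
Qed.

Lemma sm_C1at a f : sm a f -> C1at f a.
Proof.
by move=> [r r0 H]; apply: C1at_Ck (H 1%N) (box_center _ r0); exact: box_open.
Qed.

Lemma sm_derivable a f i : sm a f -> derivable f a (e_ i).
Proof.
move=> [r r0 H].
by apply: (Ck_derivable (i := i) (H 1%N)); exact: box_center.
Qed.

Lemma sm_continuous a f : sm a f -> {for a, continuous f}.
Proof. by move=> [r r0 H]; apply: (Ck_continuous (H 0%N)); exact: box_center. Qed.

Lemma ev_neq0 a f : sm a f -> f a != 0 -> ev a (fun y => f y != 0).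
Proof.
move=> /sm_continuous/continuous_boxP H f0.
have c0 : 0 < `|f a| by rewrite normr_gt0.
have [d d0 Hd] := H _ c0; exists d => // y /Hd; apply: contraTneq => ->.
by rewrite sub0r normrN ltxx.
Qed.

Lemma sm_cst a (c : R) : sm a (fun=> c).
Proof. by exists 1 => // n; exact: Ck_cst. Qed.

Lemma sm_coord a l : sm a (coord l).
Proof. by exists 1 => // n; apply: Ck_coord; exact: box_open. Qed.

Lemma smD a f g : sm a f -> sm a g -> sm a (fun y => f y + g y).
Proof.
move=> sf sg; have [r [r0 Cf Cg]] := smI sf sg; exists r => // n.
by apply: CkD => //; exact: box_open.
Qed.

Lemma smM a f g : sm a f -> sm a g -> sm a (fun y => f y * g y).
Proof.
move=> sf sg; have [r [r0 Cf Cg]] := smI sf sg; exists r => // n.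
by apply: CkM => //; exact: box_open.
Qed.

Lemma smN a f : sm a f -> sm a (fun y => - f y).
Proof. by move=> [r r0 H]; exists r => // n; apply: CkN => //; exact: box_open. Qed.

Lemma smB a f g : sm a f -> sm a g -> sm a (fun y => f y - g y).
Proof. by move=> sf sg; apply: smD sf (smN sg). Qed.

Lemma smV a f : sm a f -> f a != 0 -> sm a (fun y => (f y)^-1).
Proof.
move=> sf f0; have [s s0 Hs] := ev_neq0 sf f0; have [r r0 H] := sf.
exists (Num.min r s); first by rewrite lt_min r0.
move=> n; apply: CkV; first exact: box_open.
  by move=> y by_; apply: Hs; apply: boxS by_; rewrite ge_min lexx orbT.
by apply: Ck_subset (H n); apply: boxS; rewrite ge_min lexx.
Qed.

Lemma sm_div a f g : sm a f -> sm a g -> g a != 0 -> sm a (fun y => f y / g y).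
Proof. by move=> sf sg g0; apply: smM sf (smV sg g0). Qed.

Lemma sm_sum3 a (F : 'I_3 -> E -> R^o) : (forall l, sm a (F l)) ->
  sm a (fun y => \sum_l F l y).
Proof.
move=> H; apply: (@sm_eq a (fun y => F 0 y + F 1 y + F 2 y)).
  by exists 1 => // y _; rewrite sum3.
by apply: smD => //; exact: smD.
Qed.

Lemma sm_partial a f i : sm a f -> sm a (partial i f).
Proof. by move=> [r r0 H]; exists r => // n; exact: Ck_partial. Qed.

Lemma ev_comp a T P : smv a T -> ev (T a) P -> ev a (fun y => P (T y)).
Proof.
move=> sT [r r0 H].
have : ev a (fun y => forall l, `|T y 0 l - T a 0 l| < r).
  apply: ev_all3 => l; have /continuous_boxP/(_ r r0)[d d0 Hd] := sm_continuous (sT l).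
  by exists d.
by apply: evS => y hy; apply: H.
Qed.

Lemma smv_box a X : smv a X ->
  exists2 r : R, 0 < r & forall l, smooth (box a r) (fun y => X y 0 l : R^o).
Proof.
move=> sX.
have [p0 p00 h0] := sX 0; have [p1 p10 h1] := sX 1; have [p2 p20 h2] := sX 2.
exists (Num.min p0 (Num.min p1 p2)); first by rewrite !lt_min p00 p10.
apply: ord3P => n; [apply: Ck_subset (h0 n)|apply: Ck_subset (h1 n)|
  apply: Ck_subset (h2 n)]; apply: boxS; by rewrite !ge_min lexx ?orbT.
Qed.

Lemma sm_comp a f T : smv a T -> sm (T a) f -> sm a (fun y => f (T y)).
Proof.
move=> sT [s s0 Hs].
have [r1 r10 H1] := ev_comp sT (ex_intro2 _ _ s s0 (fun x bx => bx)).
have [r2 r20 H2] := smv_box sT.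
exists (Num.min r1 r2); first by rewrite lt_min r10.
move=> n; apply: (@Ck_comp _ n _ (box (T a) s)) => //; try exact: box_open.
  by move=> y by_; apply: H1; apply: boxS by_; rewrite ge_min lexx.
by move=> l; apply: Ck_subset (H2 l n); apply: boxS; rewrite ge_min lexx orbT.
Qed.

Lemma partial_near i a f g : ev a (fun y => f y = g y) ->
  partial i f a = partial i g a.
Proof. by move=> H; apply: near_eq_derive; apply/nbhs_boxP. Qed.

Lemma partial_cst i a (c : R) : partial i (fun=> c : R^o) a = 0.
Proof. exact: derive_cst. Qed.

Lemma partialD i a f g : sm a f -> sm a g ->
  partial i (fun y => f y + g y) a = partial i f a + partial i g a.
Proof.
by move=> sf sg; exact: (deriveD (sm_derivable (i := i) sf) (sm_derivable (i := i) sg)).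
Qed.

Lemma partialM i a f g : sm a f -> sm a g ->
  partial i (fun y => f y * g y) a = f a * partial i g a + g a * partial i f a.
Proof.
by move=> sf sg; exact: (deriveM (sm_derivable (i := i) sf) (sm_derivable (i := i) sg)).
Qed.

Lemma partialN i a f : sm a f -> partial i (fun y => - f y) a = - partial i f a.
Proof. by move=> sf; exact: (deriveN (sm_derivable (i := i) sf)). Qed.

Lemma partialV i a f : sm a f -> f a != 0 ->
  partial i (fun y => (f y)^-1) a = - (f a)^-1 * (f a)^-1 * partial i f a.
Proof.
move=> sf f0; apply: etrans (deriveV f0 (sm_derivable (i := i) sf)) _.
by rewrite expr2 invfM [in RHS]mulNr.
Qed.

Lemma partial_comp i a f T : smv a T -> sm (T a) f ->
  partial i (fun y => f (T y)) a =
  \sum_l partial i (fun y => T y 0 l : R^o) a * partial l f (T a).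
Proof.
move=> sT sf; have [_ E1] := @is_derive_comp3 _ f T a (e_ i) _ (sm_C1at sf)
  (fun l => derivableP (sm_derivable (i := i) (sT l))).
exact: E1.
Qed.

Definition dd X f : E -> R^o := fun y => \sum_l X y 0 l * partial l f y.

Lemma derive_dd X f y : sm y f -> 'D_(X y) f y = dd X f y.
Proof. by move=> /sm_C1at/(is_derive_dir (X y))[_ ->]. Qed.

Lemma sm_dd a X f : smv a X -> sm a f -> sm a (dd X f).
Proof. by move=> sX sf; apply: sm_sum3 => l; apply: smM => //; exact: sm_partial. Qed.

Lemma dd_near a X f g : ev a (fun y => f y = g y) -> dd X f a = dd X g a.
Proof. by move=> H; apply: eq_bigr => l _; rewrite (partial_near l H). Qed.

Lemma dd_at a X Y f : X a = Y a -> dd X f a = dd Y f a.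
Proof. by rewrite /dd => ->. Qed.

Lemma dd_lin a X Y Z f (p q : R) : X a = p *: Y a + q *: Z a ->
  dd X f a = p * dd Y f a + q * dd Z f a.
Proof.
move=> e; rewrite /dd e !mulr_sumr -big_split; apply: eq_bigr => l _.
by rewrite !mxE mulrDl !mulrA.
Qed.

Lemma dd_cst a X (c : R) : dd X (fun=> c) a = 0.
Proof. by apply: big1 => l _; rewrite partial_cst mulr0. Qed.

Lemma ddD a X f g : sm a f -> sm a g ->
  dd X (fun y => f y + g y) a = dd X f a + dd X g a.
Proof.
move=> sf sg; rewrite /dd -big_split; apply: eq_bigr => l _.
by rewrite partialD // mulrDr.
Qed.

Lemma ddM a X f g : sm a f -> sm a g ->
  dd X (fun y => f y * g y) a = f a * dd X g a + g a * dd X f a.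
Proof.
move=> sf sg; rewrite /dd !mulr_sumr -big_split; apply: eq_bigr => l _.
by rewrite partialM // mulrDr /= mulrCA; congr (_ + _); rewrite mulrCA.
Qed.

Lemma ddN a X f : sm a f -> dd X (fun y => - f y) a = - dd X f a.
Proof.
move=> sf; rewrite /dd -sumrN; apply: eq_bigr => l _.
by rewrite partialN // mulrN.
Qed.

Lemma ddB a X f g : sm a f -> sm a g ->
  dd X (fun y => f y - g y) a = dd X f a - dd X g a.
Proof. by move=> sf sg; rewrite ddD ?ddN //; exact: smN. Qed.

Lemma ddV a X f : sm a f -> f a != 0 ->
  dd X (fun y => (f y)^-1) a = - (f a)^-1 * (f a)^-1 * dd X f a.
Proof.
move=> sf f0; rewrite /dd mulr_sumr; apply: eq_bigr => l _.
by rewrite partialV // mulrCA.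
Qed.

Lemma dd_div a X f g : sm a f -> sm a g -> g a != 0 ->
  dd X (fun y => f y / g y) a = (dd X f a * g a - f a * dd X g a) / (g a * g a).
Proof.
move=> sf sg g0; rewrite ddM //; last exact: smV.
rewrite ddV //; move: (g a) (f a) (dd X g a) (dd X f a) g0 => w p q s w0.
by field.
Qed.

Lemma dd_comp a X f T : smv a T -> sm (T a) f ->
  dd X (fun y => f (T y)) a =
  \sum_l dd X (fun y => T y 0 l : R^o) a * partial l f (T a).
Proof.
move=> sT sf; rewrite /dd.
under eq_bigr do rewrite (partial_comp _ sT sf) mulr_sumr.
rewrite exchange_big; apply: eq_bigr => l _ /=.
by rewrite mulr_suml; apply: eq_bigr => i _; rewrite mulrA.
Qed.

Lemma sm_partial_comm a f i j : sm a f ->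
  partial i (partial j f) a = partial j (partial i f) a.
Proof.
move=> [r r0 H]; apply: partial_comm (H 2) _; first exact: box_open.
exact: box_center.
Qed.

Definition bracket X Y : E -> E := fun y =>
  \row_l (dd X (fun z => Y z 0 l : R^o) y - dd Y (fun z => X z 0 l : R^o) y).

Lemma smv_bracket a X Y : smv a X -> smv a Y -> smv a (bracket X Y).
Proof.
move=> sX sY l; apply: (@sm_eq a (fun y => dd X (fun z => Y z 0 l : R^o) y
   - dd Y (fun z => X z 0 l : R^o) y)).
  by exists 1 => // y _; rewrite mxE.
by apply: smB; apply: sm_dd.
Qed.

Lemma partial_dd a i Y f : smv a Y -> sm a f -> partial i (dd Y f) a =
  \sum_l (Y a 0 l * partial i (partial l f) a +
          partial l f a * partial i (fun z => Y z 0 l : R^o) a).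
Proof.
move=> sY sf; have sp l := sm_partial l sf.
rewrite (@partial_near _ _ _ (fun y => Y y 0 0 * partial 0 f y +
   Y y 0 1 * partial 1 f y + Y y 0 2 * partial 2 f y)); last first.
  by exists 1 => // y _; rewrite /dd sum3.
have s3 l : sm a (fun y => Y y 0 l * partial l f y) by exact: smM.
rewrite (partialD i (smD (s3 0) (s3 1)) (s3 2)) (partialD i (s3 0) (s3 1)).
have PM l : partial i (fun y => Y y 0 l * partial l f y) a =
    Y a 0 l * partial i (partial l f) a +
    partial l f a * partial i (fun z => Y z 0 l : R^o) a.
  exact: partialM.
by rewrite sum3; congr (_ + _ + _); exact: PM.
Qed.

(** Each iterated derivative has a second-order part, which is the same for both orders by the
    symmetry of second derivatives, and a first-order part; the first-order parts differ by the
    bracket. *)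
Lemma dd_bracket a X Y f : smv a X -> smv a Y -> sm a f ->
  dd (bracket X Y) f a = dd X (dd Y f) a - dd Y (dd X f) a.
Proof.
move=> sX sY sf.
have A Z Z' : smv a Z' -> dd Z (dd Z' f) a =
    \sum_i \sum_l Z a 0 i * Z' a 0 l * partial i (partial l f) a +
    \sum_l dd Z (fun z => Z' z 0 l : R^o) a * partial l f a.
  move=> sZ'; rewrite {1}/dd.
  transitivity (\sum_i (\sum_l Z a 0 i * Z' a 0 l * partial i (partial l f) a +
    \sum_l Z a 0 i * partial i (fun z => Z' z 0 l : R^o) a * partial l f a)).
    apply: eq_bigr => i _; rewrite partial_dd // mulr_sumr -big_split.
    by apply: eq_bigr => l _ /=; rewrite mulrDr mulrA -!mulrA (mulrC (partial l f a)).
  rewrite big_split; congr (_ + _); rewrite exchange_big; apply: eq_bigr => l _ /=.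
  by rewrite /dd mulr_suml.
rewrite !A // [X in _ = _ - (X + _)]exchange_big /=.
have C : \sum_i \sum_l X a 0 i * Y a 0 l * partial i (partial l f) a =
    \sum_i \sum_l Y a 0 l * X a 0 i * partial l (partial i f) a.
  apply: eq_bigr => i _; apply: eq_bigr => l _.
  by rewrite (sm_partial_comm i l sf) (mulrC (X a 0 i)).
have fin (S1 S2 T1 T2 L : R) : S1 = S2 -> L = T1 - T2 -> L = S1 + T1 - (S2 + T2).
  by move=> -> ->; ring.
apply: fin; first exact: C.
rewrite -sumrB {1}/dd.
by apply: eq_bigr => l _; rewrite mxE mulrBl.
Qed.

(** A condition at the single point [a]; by [inverse_function] it makes u a coordinate system near
    [a]. *)
Definition coords a u := smv a u /\ jac u a \in unitmx.

Lemma jac_dd a X u l : dd X (fun y => u y 0 l : R^o) a = (X a *m jac u a) 0 l.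
Proof. by rewrite mxE; apply: eq_bigr => i _; rewrite mxE. Qed.

Lemma sm_jac a u i l : smv a u -> sm a (fun y => jac u y i l).
Proof.
move=> su; apply: (@sm_eq a (partial i (fun y => u y 0 l : R^o))).
  by exists 1 => // y _; rewrite mxE.
exact: sm_partial.
Qed.

Lemma sm_sum a (I : Type) (q : seq I) (p : pred I) (F : I -> E -> R^o) :
  (forall c, sm a (F c)) -> sm a (fun y => \sum_(c <- q | p c) F c y).
Proof.
move=> H; elim: q => [|c q IH].
  by apply: sm_eq (sm_cst a 0); exists 1 => // y _; rewrite big_nil.
case pc : (p c).
  by apply: sm_eq (smD (H c) IH); exists 1 => // y _; rewrite big_cons pc.
by apply: sm_eq IH; exists 1 => // y _; rewrite big_cons pc.
Qed.

Lemma sm_prod a (I : Type) (q : seq I) (F : I -> E -> R^o) :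
  (forall c, sm a (F c)) -> sm a (fun y => \prod_(c <- q) F c y).
Proof.
move=> H; elim: q => [|c q IH].
  by apply: sm_eq (sm_cst a 1); exists 1 => // y _; rewrite big_nil.
by apply: sm_eq (smM (H c) IH); exists 1 => // y _; rewrite big_cons.
Qed.

Lemma sm_det a n (A : E -> 'M[R]_n) : (forall p q, sm a (fun y => A y p q : R^o)) ->
  sm a (fun y => \det (A y)).
Proof.
move=> H; rewrite /determinant; apply: sm_sum => c.
by apply: smM; [exact: sm_cst|exact: sm_prod].
Qed.

Lemma sm_invmx a (A : E -> 'M[R]_3) i l :
  (forall i l, sm a (fun y => A y i l : R^o)) -> A a \in unitmx ->
  sm a (fun y => invmx (A y) i l).
Proof.
move=> H uA; rewrite unitmxE unitfE in uA.
have sd := sm_det H.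
apply: (@sm_eq a (fun y => (\det (A y))^-1 * ((-1) ^+ (l + i) *
   \det (row' l (col' i (A y)))))).
  by apply: evS (ev_neq0 sd uA) => y d0; rewrite /invmx unitmxE unitfE d0 !mxE.
apply: smM; first exact: smV.
apply: smM; first exact: sm_cst.
apply: sm_det => i' l'; apply: sm_eq (H (lift l i') (lift i l')).
by exists 1 => // y _; rewrite !mxE.
Qed.

Lemma coords_ev a u : coords a u -> ev a (fun y => coords y u).
Proof.
move=> [su uu].
have uu' : \det (jac u a) != 0 by move: uu; rewrite unitmxE unitfE.
apply: evS2 (smv_ev su) (ev_neq0 (sm_det (fun i l => sm_jac i l su)) uu').
by move=> x sx dx; split => //; rewrite unitmxE unitfE.
Qed.

Lemma coords_inv a u : coords a u -> exists S : E -> E,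
  [/\ smv (u a) S, ev a (fun y => S (u y) = y) & ev (u a) (fun z => u (S z) = z)].
Proof.
move=> [su uu].
have [r r0 sr] := smv_box su.
have [V [q [S [[oV Va _ q0] [VT HS sS _]]]]] :=
  inverse_function (@box_open R a r) (box_center a r0) sr uu.
exists S; split.
- by move=> l; exists q.
- by apply: (ev_open oV Va) => x /VT[].
- by exists q => // z /HS[].
Qed.

Lemma ord3_distinct i j k l : j != k -> j != l -> k != l ->
  i != j -> i != k -> i != l -> False.
Proof.
by move: i j k l => [[|[|[|//]]] ?] [[|[|[|//]]] ?] [[|[|[|//]]] ?] [[|[|[|//]]] ?].
Qed.

(* Frobenius in coordinates: [G] turns the coordinate of index [j] into a first
   integral of [X], which is tangent to the planes where the third coordinate is
   constant. *)
Lemma first_integral_coords a u X j k l : coords a u -> smv a X ->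
  j != k -> j != l -> k != l ->
  ev a (fun y => dd X (fun z => u z 0 l : R^o) y = 0) ->
  dd X (fun z => u z 0 k : R^o) a != 0 ->
  exists G, [/\ sm (u a) G, partial j G (u a) != 0 &
    ev a (fun y => dd X (fun z => G (u z)) y = 0)].
Proof.
move=> cu sX jk jl kl Xl Xk; have su := cu.1.
have [S [sS Su uS]] := coords_inv cu.
have Sa : S (u a) = a by exact: ev_pt Su.
(* In the coordinates u, X has no component l and is proportional to d_k + m0 d_j: a scalar equation
   with time k and parameter l. *)
pose m0 y : R^o := dd X (fun z => u z 0 j : R^o) y / dd X (fun z => u z 0 k : R^o) y.
have sm0 : sm a m0 by apply: sm_div => //; exact: sm_dd.
have [p p0 sp] : sm (u a) (fun z => m0 (S z)) by apply: sm_comp => //; rewrite Sa.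
have [r [G [r0 sG HG Gj]]] :=
  first_integral jk (@box_open R (u a) p) (box_center (u a) p0) sp.
have sG' : sm (u a) G by exists r.
exists G; split => //.
have e1 : ev a (fun y => box (u a) r (u y)) by apply: ev_comp => //; exists r.
have e2 := evI e1 (evI Su (evI Xl (evI (ev_neq0 (sm_dd sX (su k)) Xk)
  (evI (smv_ev su) (ev_comp su (sm_ev sG')))))).
apply: evS e2 => y [by_ [Sy [Xly [Xky [suy sGy]]]]].
rewrite dd_comp // (bigD1 j) //= (bigD1 k) 1?eq_sym //= (bigD1 l) /=; last first.
  by rewrite eq_sym jl eq_sym kl.
rewrite Xly mul0r add0r big1 ?addr0; last first.
  move=> i /andP[/andP[ij ik] il]; exfalso.
  exact: ord3_distinct jk jl kl ij ik il.
have [_ /eqP] := HG _ by_; rewrite Sy /m0 => /eqP H.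
move: Xky H; move: (dd X _ y) (dd X _ y) (partial j G _) (partial k G _).
by move=> p1 q1 p2 q2 q0 H; rewrite -[RHS](mulr0 q1) -H; field.
Qed.

(** A vector that kills the new coordinates kills all u_l with l != j, hence also u_j because d_j G
    is not 0. *)
Lemma coords_upd a u j G : coords a u -> sm (u a) G -> partial j G (u a) != 0 ->
  coords a (fun y => upd (u y) j (G (u y))).
Proof.
move=> [su uu] sG Gj.
have El l : (fun y => upd (u y) j (G (u y)) 0 l : R^o) =
    if l == j then (fun y => G (u y)) else (fun y => u y 0 l).
  by apply/funext => y; rewrite updE; case: (l == j).
split; first by move=> l; rewrite El; case: (l == j) => //; exact: sm_comp.
apply: unitmx_inj => v vJ.
have H l : l != j -> (v *m jac u a) 0 l = 0.
  move=> lj; have := congr1 (fun w : E => w 0 l) vJ; rewrite [RHS]mxE => <-.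
  by rewrite !mxE; apply: eq_bigr => i _; rewrite !mxE El (negbTE lj).
have Hj : (v *m jac u a) 0 j = 0.
  have := congr1 (fun w : E => w 0 j) vJ; rewrite [RHS]mxE -(jac_dd a (fun=> v) (fun y => upd (u y) j (G (u y)))).
  rewrite El eqxx dd_comp // (bigD1 j) //= big1 ?addr0 => [/eqP|l lj].
    by rewrite mulf_eq0 (negbTE Gj) orbF jac_dd => /eqP.
  by rewrite jac_dd H // mul0r.
have v0 : v *m jac u a = 0.
  by apply/rowP => l; rewrite [RHS]mxE; have [->|/H] := eqVneq l j.
by rewrite -[v](mulmxK uu) v0 mul0mx.
Qed.

End Germs.

(** * Splitting of the density, Frobenius' theorem, normalization of the volume *)

Section Straightening.
Context {R : realType}.
Notation E := 'rV[R]_3.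
Implicit Types (a b x y z w : E) (i j k l : 'I_3) (f g F : E -> R^o).
Implicit Types (X Y Z T u p : E -> E).

(** The determinant of the matrix with rows u, v, w ([det3]), expanded so that [ring] can decide
    identities. *)
Definition vol3 (u v w : E) : R :=
  u 0 0 * (v 0 1 * w 0 2 - v 0 2 * w 0 1)
  - u 0 1 * (v 0 0 * w 0 2 - v 0 2 * w 0 0)
  + u 0 2 * (v 0 0 * w 0 1 - v 0 1 * w 0 0).

Lemma det3 (A : 'M[R]_3) : \det A = vol3 (row 0 A) (row 1 A) (row 2 A).
Proof.
have d2 (B : 'M[R]_2) : \det B = B 0 0 * B 1 1 - B 0 1 * B 1 0.
  rewrite (expand_det_row _ 0) !big_ord_recl big_ord0 addr0 /cofactor !det_mx11 !mxE /=.
  rewrite expr0 expr1 mul1r mulN1r mulrN.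
  by congr (B _ _ * B _ _ - B _ _ * B _ _); apply/val_inj.
rewrite (expand_det_row _ 0) sum3 /cofactor !d2 /vol3 !mxE /= expr0 expr1 sqrrN expr1n.
rewrite !mul1r mulN1r mulrN.
by congr (_ * (A _ _ * A _ _ - A _ _ * A _ _) - _ * (A _ _ * A _ _ - A _ _ * A _ _)
  + _ * (A _ _ * A _ _ - A _ _ * A _ _)); apply/val_inj.
Qed.

Lemma smv_upd b k (c : R) : smv b (fun w => upd w k c).
Proof.
move=> l; have [->|lk] := eqVneq l k.
  by apply: sm_eq (sm_cst b c); exists 1 => // w _; rewrite upd_same.
by apply: sm_eq (sm_coord b l); exists 1 => // w _; rewrite upd_other.
Qed.

Lemma sm_freeze b k f : sm b f -> sm b (fun w => f (upd w k (b 0 k))).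
Proof. by move=> sf; apply: sm_comp; rewrite ?upd_id //; exact: smv_upd. Qed.

Lemma ev_freeze b k (P : E -> Prop) : ev b P -> ev b (fun w => P (upd w k (b 0 k))).
Proof.
move=> eP; apply: (@ev_comp _ b (fun w => upd w k (b 0 k))).
  exact: smv_upd.
by rewrite upd_id.
Qed.

Lemma partial_freeze w k (c : R) f l : sm (upd w k c) f ->
  partial l (fun w => f (upd w k c)) w =
  if l == k then 0 else partial l f (upd w k c).
Proof.
move=> sf; rewrite (@partial_comp _ l w f (fun w => upd w k c)) //; last exact: smv_upd.
have H i : partial l (fun y => upd y k c 0 i : R^o) w =
    if i == k then 0 else (i == l)%:R.
  have [->|ik] := eqVneq i k.
    rewrite (@partial_near _ _ _ _ (fun=> c)) ?partial_cst //.
    by exists 1 => // y _; rewrite upd_same.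
  rewrite (@partial_near _ _ _ _ (coord i)).
    by have [_ ->] := partial_coord l i w.
  by exists 1 => // y _; rewrite upd_other.
under eq_bigr do rewrite H.
rewrite (bigD1 l) //= big1 ?addr0 ?eqxx => [|i il].
  by case: (l == k); rewrite ?mul0r ?mul1r.
by rewrite (negbTE il); case: (i == k); rewrite mul0r.
Qed.

(** Mean value theorem in direction k: a cube contains the whole path from w to its frozen point. *)
Lemma frozen b k f : sm b f -> ev b (fun w => partial k f w = 0) ->
  ev b (fun w => f w = f (upd w k (b 0 k))).
Proof.
move=> sf e0; have [r r0 H] := evI (sm_ev sf) e0; exists r => // w bw.
have [t bt|t bt] := @mvt_upd _ f w k (b 0 k) (w 0 k).
  by have [st _] := H _ (box_upd bw bt); exact: (sm_derivable (i := k) st).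
have [_ ->] := H _ (box_upd bw bt); rewrite upd_id mul0r => /eqP.
by rewrite subr_eq0 => /eqP.
Qed.

Lemma sm_primitive b k f : sm b f ->
  exists F, sm b F /\ ev b (fun w => partial k F w = f w).
Proof.
move=> [r r0 sf]; have r2 : 0 < r / 2 by rewrite divr_gt0.
have rr : r / 2 < r by rewrite ltr_pdivrMr // ltr_pMr // ltr1n.
have cf := continuous_clampb (ltW r2) rr (Ck_continuous (sf 0%N)).
have [F [F0 dF]] := parametric_primitive k b cf.
have dF' x : box b (r / 2) x -> derivable F x (e_ k) /\ partial k F x = f x.
  by move=> bx; have := dF x; rewrite clampb_id //; exact: box_cbox.
exists F; split; exists (r / 2) => //; last by move=> x /dF'[].
move=> n; apply: (Ck_primitive r2 dF') => //; apply: Ck_subset (sf n).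
exact: boxS (ltW rr).
Qed.

Lemma partial_div i a f g : sm a f -> sm a g -> g a != 0 ->
  partial i (fun y => f y / g y) a =
  (partial i f a * g a - f a * partial i g a) / (g a * g a).
Proof.
move=> sf sg g0; rewrite partialM //; last exact: smV.
rewrite partialV //; move: (g a) (f a) (partial i g a) (partial i f a) g0 => w c q s w0.
by field.
Qed.

(* If d1 d2 log r = 0 then r is a product A(w0, w1) B(w0, w2); the functions v1
   and v2 are primitives of A and of B. *)
Lemma split_density b (r : E -> R^o) : sm b r -> r b != 0 ->
  ev b (fun w => partial 1 (fun y => partial 2 r y / r y) w = 0) ->
  exists v1 v2 : E -> R^o, [/\ sm b v1, sm b v2 &
    ev b (fun w => [/\ partial 2 v1 w = 0, partial 1 v2 w = 0 &
      partial 1 v1 w * partial 2 v2 w = r w])].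
Proof.
move=> sr r0 H.
(* A is r restricted to w_2 = b_2, so it is independent of w_2; it remains to see that r / A is
   independent of w_1. *)
pose A w : R^o := r (upd w 2 (b 0 2)).
pose Bf w : R^o := r w / A w.
have Ab : A b = r b by rewrite /A upd_id.
have sA : sm b A by exact: sm_freeze.
have A0 : A b != 0 by rewrite Ab.
have sB : sm b Bf by exact: sm_div.
(* The logarithmic derivative of r along 1. It does not depend on w_2, so it equals its value at w_2
   = b_2, which is that of A; thus r / A has derivative 0 along 1. *)
pose c w : R^o := partial 1 r w / r w.
have sc : sm b c by apply: sm_div => //; exact: sm_partial.
have er0 := ev_neq0 sr r0.
have c0 : ev b (fun w => partial 2 c w = 0).
  apply: evS (evI H (evI (sm_ev sr) er0)) => w [Hw [sw rw]]; rewrite -[RHS]Hw.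
  have E1 := partial_div 2 (sm_partial 1 sw) sw rw.
  have E2 := partial_div 1 (sm_partial 2 sw) sw rw.
  apply: etrans E1 (etrans _ (esym E2)).
  by rewrite (sm_partial_comm 2 1 sw) [partial 1 r w * _]mulrC.
have cE := frozen sc c0.
have B1 : ev b (fun w => partial 1 Bf w = 0).
  apply: evS (evI cE (evI (sm_ev sr) (evI er0 (evI (ev_neq0 sA A0)
    (evI (sm_ev sA) (evI (ev_freeze 2 er0) (ev_freeze 2 (sm_ev sr))))))))
    => w [cw [sw [rw [Aw [sAw [rfw sfw]]]]]].
  have E1 := partial_div 1 sw sAw Aw.
  have E2 : partial 1 A w = partial 1 r (upd w 2 (b 0 2)).
    by rewrite /A (partial_freeze 1 sfw).
  apply: etrans E1 _; rewrite E2.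
  move: cw; rewrite /c -/(A w); move: rw Aw.
  move: (r w) (A w) (partial 1 r w) (partial 1 r (upd w 2 (b 0 2))) => p q s t p0 q0 e.
  have -> : s = t / q * p by rewrite -e divfK.
  by field.
have BE := frozen sB B1.
have [F1 [sF1 dF1]] := sm_primitive 1 sA.
have [F2 [sF2 dF2]] := sm_primitive 2 sB.
exists (fun w => F1 (upd w 2 (b 0 2))), (fun w => F2 (upd w 1 (b 0 1))).
split; try exact: sm_freeze.
apply: evS (evI BE (evI (ev_neq0 sA A0) (evI (ev_freeze 2 (evI (sm_ev sF1) dF1))
  (ev_freeze 1 (evI (sm_ev sF2) dF2))))) => w [Bw [Aw [[s1 e1] [s2 e2]]]].
rewrite !partial_freeze //=; split=> //.
rewrite e1 e2 -Bw /Bf /A upd_upd -/(A w) mulrC divfK //.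
Qed.

Lemma smv_linear a (M : 'M[R]_3) : smv a (fun y => y *m M).
Proof.
move=> l; apply: (@sm_eq _ a (fun y => \sum_i (coord i y * M i l))).
  by exists 1 => // y _; rewrite mxE.
by apply: sm_sum3 => i; apply: smM; [exact: sm_coord|exact: sm_cst].
Qed.

Lemma jac_linear a (M : 'M[R]_3) : jac (fun y => y *m M) a = M.
Proof.
apply/matrixP => i l; rewrite mxE.
have s3 k : sm a (fun y => coord k y * M k l).
  by apply: smM; [exact: sm_coord|exact: sm_cst].
rewrite (@partial_near _ _ _ _ (fun y => coord 0 y * M 0 l + coord 1 y * M 1 l
   + coord 2 y * M 2 l)); last by exists 1 => // y _; rewrite mxE sum3.
rewrite (partialD i (smD (s3 0) (s3 1)) (s3 2)) (partialD i (s3 0) (s3 1)).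
have H k : partial i (fun y => coord k y * M k l) a = (k == i)%:R * M k l.
  rewrite partialM ?partial_cst ?mulr0 ?add0r; [|exact: sm_coord|exact: sm_cst].
  by have [_ ->] := partial_coord i k a; rewrite mulrC.
rewrite !H -(sum3 (fun k => (k == i)%:R * M k l)) (bigD1 i) //= eqxx mul1r.
by rewrite big1 ?addr0 // => k ki; rewrite (negbTE ki) mul0r.
Qed.

(* In the coordinates [p], the field [Y1] is a multiple of d_2 and [Y2] is a
   multiple of d_1. *)
Definition rectified (Y1 Y2 p : E -> E) y :=
  [/\ dd Y1 (fun y => p y 0 0 : R^o) y = 0, dd Y1 (fun y => p y 0 1 : R^o) y = 0,
      dd Y2 (fun y => p y 0 0 : R^o) y = 0 & dd Y2 (fun y => p y 0 2 : R^o) y = 0].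

Definition in_span X Y Z y := exists p q : R, Z y = p *: X y + q *: Y y.

Section Frobenius.
Variables (Y1 Y2 : E -> E) (a : E) (N : 'M[R]_3).
Hypotheses (sY1 : smv a Y1) (sY2 : smv a Y2) (uN : N \in unitmx)
  (N1 : row 1 N = Y2 a) (N2 : row 2 N = Y1 a)
  (involutive : forall X Y, smv a X -> smv a Y -> ev a (in_span Y1 Y2 X) ->
     ev a (in_span Y1 Y2 Y) -> ev a (in_span Y1 Y2 (bracket X Y))).

(** In the linear coordinates u the vectors [Y1 a] and [Y2 a] are the basis vectors of index 2 and
    1. *)
Let M := invmx N.
Let u y := y *m M.
Let ul l y : R^o := u y 0 l.

Let su : smv a u. Proof. exact: smv_linear. Qed.
Let cu : coords a u.
Proof. by split; [exact: su|rewrite jac_linear unitmx_inv]. Qed.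

Let Y1u l : dd Y1 (ul l) a = (l == 2)%:R.
Proof. by rewrite /ul jac_dd jac_linear -N2 -row_mul mulmxV // row1 mxE. Qed.

Let Y2u l : dd Y2 (ul l) a = (l == 1)%:R.
Proof. by rewrite /ul jac_dd jac_linear -N1 -row_mul mulmxV // row1 mxE. Qed.

(** These coefficients are chosen so that Z annihilates u_2 and W annihilates u_1. At [a], Z is Y2
    and W is Y1, so the two still span the plane nearby. *)
Let zp y : R^o := - dd Y2 (ul 2) y.
Let zq y : R^o := dd Y1 (ul 2) y.
Let wp y : R^o := dd Y2 (ul 1) y.
Let wq y : R^o := - dd Y1 (ul 1) y.
Let Z y := zp y *: Y1 y + zq y *: Y2 y.
Let W y := wp y *: Y1 y + wq y *: Y2 y.

Let szp : sm a zp.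
Proof. by apply: smN; apply: sm_dd => //; exact: (su 2). Qed.

Let szq : sm a zq.
Proof. by apply: sm_dd => //; exact: (su 2). Qed.

Let swp : sm a wp.
Proof. by apply: sm_dd => //; exact: (su 1). Qed.

Let swq : sm a wq.
Proof. by apply: smN; apply: sm_dd => //; exact: (su 1). Qed.

Let smv_lin (p q : E -> R^o) : sm a p -> sm a q -> smv a (fun y => p y *: Y1 y + q y *: Y2 y).
Proof.
move=> sp sq l; apply: (@sm_eq _ a (fun y => p y * Y1 y 0 l + q y * Y2 y 0 l)).
  by exists 1 => // y _; rewrite !mxE.
by apply: smD; apply: smM.
Qed.

Let sZ : smv a Z. Proof. exact: smv_lin. Qed.
Let sW : smv a W. Proof. exact: smv_lin. Qed.

Let ZE f y : dd Z f y = zp y * dd Y1 f y + zq y * dd Y2 f y.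
Proof. exact: dd_lin. Qed.

Let WE f y : dd W f y = wp y * dd Y1 f y + wq y * dd Y2 f y.
Proof. exact: dd_lin. Qed.

Let Zu2 y : dd Z (ul 2) y = 0.
Proof. by rewrite ZE /zp /zq mulNr mulrC addNr. Qed.

Let Wu1 y : dd W (ul 1) y = 0.
Proof. by rewrite WE /wp /wq mulNr mulrC subrr. Qed.

Let det_ZW y : R^o := zp y * wq y - zq y * wp y.

Let det_ZW0 : ev a (fun y => det_ZW y != 0).
Proof.
apply: ev_neq0; first by apply: smB; apply: smM.
rewrite /det_ZW /zp /zq /wp /wq !Y1u !Y2u /= oppr0 !mul0r mulr1 add0r.
by rewrite oppr_eq0 oner_eq0.
Qed.

(* Modulo the fields themselves, the bracket [Z, W] acts on functions as a
   combination of [Z] and [W]. *)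
Let bracket_ZW : ev a (fun y => exists p q : R, forall f, sm y f ->
  dd Z (dd W f) y - dd W (dd Z f) y = p * dd Z f y + q * dd W f y).
Proof.
have e1 : ev a (in_span Y1 Y2 Z) by exists 1 => // y _; exists (zp y), (zq y).
have e2 : ev a (in_span Y1 Y2 W) by exists 1 => // y _; exists (wp y), (wq y).
apply: evS (evI (involutive sZ sW e1 e2) (evI det_ZW0 (evI (smv_ev sZ) (smv_ev sW))))
  => y [[p [q e]] [d0 [sz sw]]].
(* Cramer's rule, from the components on Y1, Y2 to those on Z, W. *)
exists ((p * wq y - q * wp y) / det_ZW y), ((q * zp y - p * zq y) / det_ZW y) => f sf.
rewrite -dd_bracket // (dd_lin f e) ZE WE.
move: d0; rewrite /det_ZW.
move: (dd Y1 f y) (dd Y2 f y) (zp y) (zq y) (wp y) (wq y) => A B c1 c2 c3 c4 d0.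
by field.
Qed.

Let Zu1 : dd Z (ul 1) a = 1.
Proof. by rewrite ZE /zp /zq !Y1u !Y2u /= oppr0 mul0r add0r mulr1. Qed.

Let Wu2 : dd W (ul 2) a = 1.
Proof. by rewrite WE /wp /wq !Y1u !Y2u /= oppr0 mul0r addr0 mulr1. Qed.

Let ZW0 f y : det_ZW y != 0 -> dd Z f y = 0 -> dd W f y = 0 ->
  dd Y1 f y = 0 /\ dd Y2 f y = 0.
Proof.
rewrite ZE WE /det_ZW.
move: (dd Y1 f y) (dd Y2 f y) (zp y) (zq y) (wp y) (wq y) => A B c1 c2 c3 c4 d0 e1 e2.
split; apply: (mulfI d0); rewrite mulr0.
  have -> : (c1 * c4 - c2 * c3) * A =
    c4 * (c1 * A + c2 * B) - c2 * (c3 * A + c4 * B) by ring.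
  by rewrite e1 e2 !mulr0 subrr.
have -> : (c1 * c4 - c2 * c3) * B =
  c1 * (c3 * A + c4 * B) - c3 * (c1 * A + c2 * B) by ring.
by rewrite e1 e2 !mulr0 subrr.
Qed.

(** With u_0 replaced by a first integral z_0 of Z, the field Z is a multiple of d_1 and W has
    components along d_0 and d_2 only. A function of z_0 and z_2 alone is then killed by Z, and can
    be adjusted to be killed by W. *)
Lemma common_first_integral : exists p0 : E -> R^o, [/\ sm a p0,
  coords a (fun y => upd (u y) 0 (p0 y)) &
  ev a (fun y => dd Y1 p0 y = 0 /\ dd Y2 p0 y = 0)].
Proof.
have [||G [sG Gj G0]] := @first_integral_coords _ a u Z 0 1 2 cu sZ isT isT isT.
- by exists 1 => // y _; exact: Zu2.
- by rewrite Zu1 oner_eq0.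
pose z y := upd (u y) 0 (G (u y)).
have cz : coords a z by exact: coords_upd.
have sz := cz.1.
have z0E y : z y 0 0 = G (u y) by rewrite /z upd_same.
have z1E y : z y 0 1 = ul 1 y by rewrite /z upd_other.
have z2E y : z y 0 2 = ul 2 y by rewrite /z upd_other.
pose zl l y : R^o := z y 0 l.
have zl1 : zl 1 = ul 1 by apply/funext.
have zl2 : zl 2 = ul 2 by apply/funext.
have Zz0 : ev a (fun y => dd Z (zl 0) y = 0).
  apply: evS G0 => y <-; congr (dd Z _ y); apply/funext => y'; exact: z0E.
(* The slope dz_0 / dz_2 along W. *)
pose Q y : R^o := dd W (zl 0) y / dd W (ul 2) y.
have W0 : dd W (ul 2) a != 0 by rewrite Wu2 oner_eq0.
have Z0 : dd Z (ul 1) a != 0 by rewrite Zu1 oner_eq0.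
have sWz : sm a (dd W (zl 0)) := sm_dd sW (sz 0).
have sWu : sm a (dd W (ul 2)) := sm_dd sW (su 2).
have sZu : sm a (dd Z (ul 1)) := sm_dd sZ (su 1).
have sQ : sm a Q := sm_div sWz sWu W0.
have eW := ev_neq0 sWu W0.
have eZ := ev_neq0 sZu Z0.
(* Involutivity enters here. Z kills z_0 and u_2, so [bracket_ZW] multiplies W z_0 and W u_2 by the
   same factor q when Z is applied, and their quotient is constant along Z. *)
have ZQ : ev a (fun y => dd Z Q y = 0).
  apply: evS (evI bracket_ZW (evI eW (evI (ev_ev Zz0) (evI (smv_ev sW)
    (evI (smv_ev sz) (smv_ev su))))))
    => y [[p [q Hpq]] [Wy [Zy [swy [szy suy]]]]].
  have s0 : sm y (dd W (zl 0)) := sm_dd swy (szy 0).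
  have s2 : sm y (dd W (ul 2)) := sm_dd swy (suy 2).
  have H0 : dd Z (dd W (zl 0)) y = q * dd W (zl 0) y.
    have := Hpq (zl 0) (szy 0).
    by rewrite (dd_near (g := fun=> 0) W Zy) dd_cst (ev_pt Zy) subr0 mulr0 add0r.
  have H2 : dd Z (dd W (ul 2)) y = q * dd W (ul 2) y.
    have := Hpq (ul 2) (suy 2); rewrite Zu2 mulr0 add0r.
    have e : ev y (fun y => dd Z (ul 2) y = 0) by exists 1 => // y' _; exact: Zu2.
    by rewrite (dd_near (g := fun=> 0) W e) dd_cst subr0.
  apply: etrans (dd_div Z s0 s2 Wy) _; rewrite H0 H2.
  move: (dd W (zl 0) y) (dd W (ul 2) y) => A B.
  have -> : q * A * B - A * (q * B) = 0 by ring.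
  exact: mul0r.
have ddz X f y : smv y z -> sm (z y) f -> dd X (fun y => f (z y)) y =
    dd X (zl 0) y * partial 0 f (z y) + dd X (ul 1) y * partial 1 f (z y) +
    dd X (ul 2) y * partial 2 f (z y).
  by move=> s1 s2; rewrite -zl1 -zl2; apply: etrans (dd_comp X s1 s2) _; rewrite sum3.
have [S [sS Sz zS]] := coords_inv cz.
have Sa : S (z a) = a by exact: ev_pt Sz.
pose b := z a; pose Qt w : R^o := Q (S w).
have sQt : sm b Qt by apply: sm_comp; rewrite ?Sa.
have dQt : ev b (fun w => partial 1 Qt w = 0).
  have e : ev a (fun y => partial 1 Qt (z y) = 0).
    apply: evS (evI ZQ (evI (ev_ev Sz) (evI eZ (evI (smv_ev sz)
      (evI Zz0 (ev_comp sz (sm_ev sQt))))))) => y [Zy [Sy [Z1y [szy [Z0y sQy]]]]].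
    have : dd Z (fun y => Qt (z y)) y = 0.
      by rewrite -Zy; apply: dd_near; apply: evS Sy => y' Sy'; rewrite /Qt Sy'.
    rewrite ddz // Z0y Zu2.
    have aux (A B C D : R) : B != 0 -> 0 * A + B * C + 0 * D = 0 -> C = 0.
      by rewrite !mul0r add0r addr0 => B0 /eqP; rewrite mulf_eq0 (negbTE B0) => /eqP.
    exact: aux.
  have e' : ev (S b) (fun y => partial 1 Qt (z y) = 0) by rewrite Sa.
  by apply: evS (evI (ev_comp sS e') zS) => w [H zw]; rewrite -[w in LHS]zw.
have QE := frozen sQt dQt.
have [q q0 sq] := sQt.
(* The equation dz_0 / dz_2 = Qt: time z_2, unknown z_0, parameter z_1. *)
have [r [H [r0 sH HH Hj]]] := @first_integral _ 0 2 b _ Qt isT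
  (@box_open R b q) (box_center b q0) sq.
have sH' : sm b H by exists r.
have eH : ev b (fun w => partial 2 H w + Qt w * partial 0 H w = 0).
  by exists r => // w /HH[].
(* H may depend on z_1 although Qt does not; freezing z_1 keeps the equation and makes H' invariant
   under Z too. *)
pose H' w : R^o := H (upd w 1 (b 0 1)).
have sH1 : sm b H' by exact: sm_freeze.
have dH l : ev b (fun w => partial l H' w =
    if l == 1 then 0 else partial l H (upd w 1 (b 0 1))).
  apply: evS (ev_freeze 1 (sm_ev sH')) => w sw; exact: partial_freeze.
have eH' : ev b (fun w => partial 2 H' w + Qt w * partial 0 H' w = 0).
  apply: evS (evI (ev_freeze 1 eH) (evI QE (evI (dH 0) (dH 2))))
    => w [e1 [e2 [e3 e4]]].
  by rewrite e3 e4 /= e2.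
pose p0 y : R^o := H' (z y).
have sp0 : sm a p0 by exact: sm_comp.
exists p0; split; first exact: sp0.
  have : coords a (fun y => upd (z y) 0 (H' (z y))).
    apply: coords_upd => //; rewrite (ev_pt (dH 0)) /= upd_id.
    exact: Hj.
  congr (coords a _); apply/funext => y.
  by rewrite /z upd_upd.
apply: evS (evI det_ZW0 (evI (ev_comp sz (evI eH' (evI (dH 1) (sm_ev sH1))))
  (evI Zz0 (evI eW (evI (ev_ev Sz) (smv_ev sz))))))
  => y [d0 [[e1 [e2 sHy]] [Z0y [Wy [Sy szy]]]]].
have Ez (A B D : R) : 0 * A + B * 0 + 0 * D = 0 by ring.
have Ew (A P C S' : R) : C != 0 -> S' + A / C * P = 0 -> A * P + 0 * 0 + C * S' = 0.
  by move=> C0 e; rewrite mul0r addr0 -[RHS](mulr0 C) -e; field.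
have e3 : partial 1 H' (z y) = 0 by rewrite e2.
have HZ := ddz Z H' y szy sHy; rewrite e3 Z0y (Zu2 y) in HZ.
have HW := ddz W H' y szy sHy; rewrite e3 (Wu1 y) in HW.
apply: (ZW0 d0); first exact: etrans HZ (Ez _ _ _).
apply: (etrans HW); apply: (Ew _ _ _ _ Wy).
by move: e1; rewrite /Qt (ev_pt Sy).
Qed.

Lemma straighten : exists p, coords a p /\
  ev a (rectified Y1 Y2 p).
Proof.
have [p0 [sp0 cc ep0]] := common_first_integral.
pose c y := upd (u y) 0 (p0 y).
have sc := cc.1.
pose cl l y : R^o := c y 0 l.
have cl0 : cl 0 = p0 by apply/funext => y; rewrite /cl /c upd_same.
have cl1 : cl 1 = ul 1 by apply/funext => y; rewrite /cl /c upd_other.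
have cl2 : cl 2 = ul 2 by apply/funext => y; rewrite /cl /c upd_other.
have [||G1 [sG1 G1j G10]] := @first_integral_coords _ a c Y1 1 2 0 cc sY1 isT isT isT.
- by apply: evS ep0 => y [e _]; rewrite -/(cl 0) cl0.
- by rewrite -/(cl 2) cl2 Y1u /= oner_eq0.
have [||G2 [sG2 G2j G20]] := @first_integral_coords _ a c Y2 2 1 0 cc sY2 isT isT isT.
- by apply: evS ep0 => y [_ e]; rewrite -/(cl 0) cl0.
- by rewrite -/(cl 1) cl1 Y2u /= oner_eq0.
(* Both first integrals are functions of the same coordinates c, so [coords_upd] cannot simply be
   applied twice; independence is checked directly below. *)
pose p y := upd (upd (c y) 1 (G1 (c y))) 2 (G2 (c y)).
have p0E : (fun y => p y 0 0 : R^o) = cl 0.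
  by apply/funext => y; rewrite /p upd_other // upd_other.
have p1E : (fun y => p y 0 1 : R^o) = (fun y => G1 (c y)).
  by apply/funext => y; rewrite /p upd_other // upd_same.
have p2E : (fun y => p y 0 2 : R^o) = (fun y => G2 (c y)).
  by apply/funext => y; rewrite /p upd_same.
have sp : smv a p.
  apply: ord3P; rewrite ?p0E ?p1E ?p2E; [exact: (sc 0)|exact: sm_comp|exact: sm_comp].
exists p; split; last first.
  apply: evS (evI ep0 (evI G10 G20)) => y [[e1 e2] [e3 e4]].
  by rewrite /rectified p0E p1E p2E cl0.
split => //; apply: unitmx_inj => v vJ.
have D l : dd (fun=> v) (fun y => p y 0 l : R^o) a = 0 by rewrite jac_dd vJ mxE.
have c0 : dd (fun=> v) (cl 0) a = 0 by rewrite -p0E D.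
have ddc X f : sm (c a) f -> dd X (fun y => f (c y)) a =
    dd X p0 a * partial 0 f (c a) + dd X (ul 1) a * partial 1 f (c a) +
    dd X (ul 2) a * partial 2 f (c a).
  by move=> s2; rewrite -cl0 -cl1 -cl2; apply: etrans (dd_comp X sc s2) _; rewrite sum3.
have E2 (A B C : R) : 0 * A + 0 * B + 1 * C = 0 -> C = 0.
  by rewrite !mul0r !add0r mul1r.
have E1 (A B C : R) : 0 * A + 1 * B + 0 * C = 0 -> B = 0.
  by rewrite !mul0r addr0 add0r mul1r.
(* At [a] the field Y1 is d_2 in the coordinates c, and Y2 is d_1. With [G21], the Jacobian of p
   relative to c is triangular with nonzero diagonal. *)
have G12 : partial 2 G1 (c a) = 0.
  have := ev_pt G10; rewrite ddc // !Y1u (ev_pt ep0).1; exact: E2.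
have G21 : partial 1 G2 (c a) = 0.
  have := ev_pt G20; rewrite ddc // !Y2u (ev_pt ep0).2; exact: E1.
have E3 (A B C P : R) : P != 0 -> 0 * A + B * P + C * 0 = 0 -> B = 0.
  by rewrite mul0r mulr0 add0r addr0 => P0 /eqP; rewrite mulf_eq0 (negbTE P0) orbF => /eqP.
have E4 (A B C P : R) : P != 0 -> 0 * A + B * 0 + C * P = 0 -> C = 0.
  by rewrite mul0r mulr0 !add0r => P0 /eqP; rewrite mulf_eq0 (negbTE P0) orbF => /eqP.
rewrite cl0 in c0.
have c1 : dd (fun=> v) (ul 1) a = 0.
  have := D 1; rewrite p1E ddc // c0 G12; exact: E3.
have c2 : dd (fun=> v) (ul 2) a = 0.
  have := D 2; rewrite p2E ddc // c0 G21; exact: E4.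
have v0 : v *m jac c a = 0.
  apply/rowP; apply: ord3P; rewrite -(jac_dd a (fun=> v)) mxE.
  - by rewrite -/(cl 0) cl0.
  - by rewrite -/(cl 1) cl1.
  - by rewrite -/(cl 2) cl2.
by rewrite -[v](mulmxK cc.2) v0 mul0mx.
Qed.

End Frobenius.

(* The density of the volume in the coordinates [p] becomes 1 in the new ones. *)
Lemma adapt_volume (Y1 Y2 : E -> E) a p S (omega : E -> R^o) :
  coords a p -> smv (p a) S -> ev a (fun y => S (p y) = y) ->
  sm a omega -> omega a != 0 ->
  ev (p a) (fun w => partial 1 (fun w =>
    partial 2 (fun w => omega (S w) / \det (jac p (S w)) : R^o) w /
      (omega (S w) / \det (jac p (S w))) : R^o) w = 0) ->
  ev a (rectified Y1 Y2 p) ->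
  exists P, smv a P /\
  ev a (rectified Y1 Y2 P) /\ ev a (fun y => \det (jac P y) = omega y).
Proof.
move=> cp sS Sp so o0 ed eY; have sp := cp.1.
have Sa : S (p a) = a by exact: ev_pt Sp.
pose r w : R^o := omega (S w) / \det (jac p (S w)).
have d0 : \det (jac p a) != 0 by have := cp.2; rewrite unitmxE unitfE.
have sdet : sm a (fun y => \det (jac p y)).
  by apply: sm_det => i l; exact: sm_jac.
have sr : sm (p a) r.
  have : sm a (fun y => omega y / \det (jac p y)) by exact: sm_div.
  by move=> H; apply: (sm_comp sS (f := fun y => omega y / \det (jac p y))); rewrite Sa.
have r0 : r (p a) != 0 by rewrite /r Sa mulf_neq0 // invr_neq0.
have [v1 [v2 [sv1 sv2 ev12]]] := split_density sr r0 ed.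
pose P y := upd (upd (p y) 1 (v1 (p y))) 2 (v2 (p y)).
have P0E : (fun y => P y 0 0 : R^o) = (fun y => p y 0 0).
  by apply/funext => y; rewrite /P upd_other // upd_other.
have P1E : (fun y => P y 0 1 : R^o) = (fun y => v1 (p y)).
  by apply/funext => y; rewrite /P upd_other // upd_same.
have P2E : (fun y => P y 0 2 : R^o) = (fun y => v2 (p y)).
  by apply/funext => y; rewrite /P upd_same.
exists P; split.
  apply: ord3P; rewrite ?P0E ?P1E ?P2E; [exact: (sp 0)|exact: sm_comp|exact: sm_comp].
suff H : ev a (fun y => rectified Y1 Y2 P y /\ \det (jac P y) = omega y).
  by split; apply: evS H => y [].
apply: evS (evI eY (evI (smv_ev sp) (evI (ev_comp sp (evI ev12 (evI (sm_ev sv1) (sm_ev sv2))))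
  (evI Sp (ev_neq0 sdet d0))))) => y [[e1 e2 e3 e4] [spy [[[f1 f2 f3] [s1 s2]] [Sy dy]]]].
rewrite /rectified P0E P1E P2E; split; [split => //|].
- by rewrite dd_comp // sum3 e1 e2 f1 !mul0r mulr0 !addr0.
- by rewrite dd_comp // sum3 e3 e4 f2 !mul0r mulr0 !addr0.
(* The Jacobian of P relative to p. Its determinant is d_1 v1 d_2 v2 = r, so that [jac P] has
   determinant det (jac p) r = omega. *)
pose K : 'M[R]_3 := \matrix_(i, l) partial i
  (if l == 0 then coord 0 else if l == 1 then v1 else v2) (p y).
have -> : jac P y = jac p y *m K.
  apply/matrixP => i l; rewrite mxE [RHS]mxE.
  have PC (f : E -> R^o) : sm (p y) f ->
      partial i (fun y => f (p y)) y = \sum_j jac p y i j * partial j f (p y).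
    by move=> sf; rewrite partial_comp //; apply: eq_bigr => j _; rewrite mxE.
  under [RHS]eq_bigr do rewrite [K _ _]mxE.
  move: l; apply: ord3P => /=; rewrite ?P0E ?P1E ?P2E; apply: PC => //.
  exact: sm_coord.
rewrite det_mulmx.
have -> : \det K = r (p y).
  rewrite det3 /vol3 !mxE /= f1 f2 -f3.
  have [_ ->] := partial_coord 0 0 (p y); have [_ ->] := partial_coord 1 0 (p y).
  have [_ ->] := partial_coord 2 0 (p y); rewrite /=.
  by move: (partial 1 v1 _) (partial 2 v2 _) (partial 0 v1 _) (partial 0 v2 _) => *; ring.
by rewrite /r Sy mulrC divfK.
Qed.

End Straightening.

(** * Coordinate fields, divergence, and tau in coordinates *)

Section CoordinateFields.
Context {R : realType}.
Notation E := 'rV[R]_3.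
Implicit Types (a b y z w : E) (i j k l : 'I_3) (f g : E -> R^o).
Implicit Types (X Y Z p S : E -> E).

(** The field d/dp_i, obtained from p alone without naming an inverse map. *)
Definition coord_field p i : E -> E := fun y => row i (invmx (jac p y)).

Lemma smv_coord_field a p i : coords a p -> smv a (coord_field p i).
Proof.
move=> [sp up] l; apply: (@sm_eq _ a (fun y => invmx (jac p y) i l)).
  by exists 1 => // y _; rewrite mxE.
by apply: sm_invmx up => c d; exact: sm_jac.
Qed.

Lemma dd_coord_field y p i l : coords y p ->
  dd (coord_field p i) (fun z => p z 0 l : R^o) y = (i == l)%:R.
Proof. by move=> [_ up]; rewrite jac_dd -row_mul mulVmx // row1 mxE eqxx eq_sym. Qed.

Lemma coord_field_chain y p S i f : coords y p -> smv (p y) S ->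
  ev y (fun z => S (p z) = z) -> sm y f ->
  dd (coord_field p i) f y = partial i (fun w => f (S w)) (p y).
Proof.
move=> cp sS Sp sf; have Sy : S (p y) = y by exact: ev_pt Sp.
have e : ev y (fun z => f z = f (S (p z))) by apply: evS Sp => z ->.
rewrite (dd_near _ e).
have sfS : sm (p y) (fun w => f (S w)) by apply: sm_comp => //; rewrite Sy.
rewrite (@dd_comp _ y _ (fun w => f (S w)) p cp.1 sfS) (bigD1 i) //= big1 ?addr0.
  by rewrite dd_coord_field // eqxx mul1r.
by move=> l li; rewrite dd_coord_field // eq_sym (negbTE li) mul0r.
Qed.

(** Tested on the coordinate functions: their derivatives along coordinate fields are constants, so
    the commutator kills each of them. *)
Lemma coord_field_bracket a p i j : coords a p ->
  bracket (coord_field p i) (coord_field p j) a = 0.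
Proof.
move=> cp; have up := cp.2.
have si := smv_coord_field i cp; have sj := smv_coord_field j cp.
have H : bracket (coord_field p i) (coord_field p j) a *m jac p a = 0.
  apply/rowP => m; rewrite -jac_dd dd_bracket //; last exact: cp.1.
  have e k : ev a (fun y => dd (coord_field p k) (fun z => p z 0 m : R^o) y = (k == m)%:R).
    by apply: evS (coords_ev cp) => y cy; exact: dd_coord_field.
  by rewrite (dd_near _ (e i)) (dd_near _ (e j)) !dd_cst subrr mxE.
by rewrite -[LHS](mulmxK up) H mul0mx.
Qed.

Lemma coord_field_comm a p i j f : coords a p -> sm a f ->
  dd (coord_field p i) (dd (coord_field p j) f) a =
  dd (coord_field p j) (dd (coord_field p i) f) a.
Proof.
move=> cp sf; have := dd_bracket (smv_coord_field i cp) (smv_coord_field j cp) sf.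
rewrite /dd [in LHS]coord_field_bracket // big1 => [|l _]; last by rewrite mxE mul0r.
by move=> /eqP; rewrite eq_sym subr_eq0 => /eqP.
Qed.

Lemma coord_field_decomp y p (v : E) : coords y p ->
  v = \sum_i (v *m jac p y) 0 i *: coord_field p i y.
Proof.
move=> [_ up]; rewrite -[LHS](mulmxK up) mulmx_sum_row.
by apply: eq_bigr => i _.
Qed.

Lemma smv_eq a X Y : ev a (fun y => X y = Y y) -> smv a X -> smv a Y.
Proof. by move=> e sX l; apply: sm_eq (sX l); apply: evS e => y ->. Qed.

Lemma bracket_near a X X' Y Y' : ev a (fun y => X y = X' y) ->
  ev a (fun y => Y y = Y' y) -> bracket X Y a = bracket X' Y' a.
Proof.
move=> eX eY; apply/rowP => l; rewrite !mxE.
rewrite (@dd_near _ a X _ (fun z => Y' z 0 l)); last by apply: evS eY => y ->.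
rewrite (@dd_near _ a Y _ (fun z => X' z 0 l)); last by apply: evS eX => y ->.
by rewrite (dd_at _ (ev_pt eX)) (dd_at _ (ev_pt eY)).
Qed.

Lemma dd_scale X f (c : R) y Y : X y = c *: Y y -> dd X f y = c * dd Y f y.
Proof.
move=> e; rewrite (@dd_lin _ y X Y Y f c 0) ?mul0r ?addr0 //.
by rewrite scale0r addr0.
Qed.

Lemma bracket_scale a X Y f : smv a X -> sm a f ->
  bracket (fun y => f y *: X y) Y a = f a *: bracket X Y a - dd Y f a *: X a.
Proof.
move=> sX sf; apply/rowP => l; rewrite !mxE.
rewrite (@dd_scale _ _ (f a) a X) //.
rewrite (@dd_near _ a Y _ (fun z => f z * X z 0 l)); last first.
  by exists 1 => // y _; rewrite mxE.
rewrite (ddM Y sf (sX l)); ring.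
Qed.

Definition lie_vol (omega : E -> R^o) X Z1 Z2 Z3 y : R :=
  dd X (fun z => omega z * vol3 (Z1 z) (Z2 z) (Z3 z)) y
  - omega y * vol3 (bracket X Z1 y) (Z2 y) (Z3 y)
  - omega y * vol3 (Z1 y) (bracket X Z2 y) (Z3 y)
  - omega y * vol3 (Z1 y) (Z2 y) (bracket X Z3 y).

Definition divergence X y : R := \sum_i partial i (fun z => X z 0 i : R^o) y.

Lemma dd_minor X y f g h g' h' : sm y f -> sm y g -> sm y h -> sm y g' -> sm y h' ->
  sm y (fun z => f z * (g z * h z - g' z * h' z)) /\
  dd X (fun z => f z * (g z * h z - g' z * h' z)) y =
  dd X f y * (g y * h y - g' y * h' y) + f y * (dd X g y * h y + g y * dd X h y
    - dd X g' y * h' y - g' y * dd X h' y).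
Proof.
move=> sf sg sh sg' sh'.
have s1 : sm y (fun z => g z * h z - g' z * h' z).
  by apply: smB; [exact: (smM sg sh)|exact: (smM sg' sh')].
split; first exact: (smM sf s1).
rewrite (ddM X sf s1) (ddB X (smM sg sh) (smM sg' sh')) (ddM X sg sh) (ddM X sg' sh').
ring.
Qed.

Lemma sm_vol3 y Z1 Z2 Z3 : smv y Z1 -> smv y Z2 -> smv y Z3 ->
  sm y (fun z => vol3 (Z1 z) (Z2 z) (Z3 z)).
Proof.
move=> s1 s2 s3; rewrite /vol3; apply: smD; [apply: smB|];
  [apply: (dd_minor (fun=> 0) (s1 0) (s2 1) (s3 2) (s2 2) (s3 1)).1
  |apply: (dd_minor (fun=> 0) (s1 1) (s2 0) (s3 2) (s2 2) (s3 0)).1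
  |apply: (dd_minor (fun=> 0) (s1 2) (s2 0) (s3 1) (s2 1) (s3 0)).1].
Qed.

Lemma dd_vol3 X y Z1 Z2 Z3 : smv y Z1 -> smv y Z2 -> smv y Z3 ->
  let D (Z : E -> E) : E := \row_l dd X (fun z => Z z 0 l : R^o) y in
  dd X (fun z => vol3 (Z1 z) (Z2 z) (Z3 z)) y =
  vol3 (D Z1) (Z2 y) (Z3 y) + vol3 (Z1 y) (D Z2) (Z3 y) + vol3 (Z1 y) (Z2 y) (D Z3).
Proof.
move=> s1 s2 s3 D.
have [m0 e0] := dd_minor X (s1 0) (s2 1) (s3 2) (s2 2) (s3 1).
have [m1 e1] := dd_minor X (s1 1) (s2 0) (s3 2) (s2 2) (s3 0).
have [m2 e2] := dd_minor X (s1 2) (s2 0) (s3 1) (s2 1) (s3 0).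
apply: etrans (ddD X (smB m0 m1) m2) _; rewrite (ddB X m0 m1) e0 e1 e2.
have DE Z l : D Z 0 l = dd X (fun z => Z z 0 l : R^o) y by rewrite mxE.
rewrite -!DE /vol3; move: (D Z1) (D Z2) (D Z3) (Z1 y) (Z2 y) (Z3 y) => d1 d2 d3 u v w.
ring.
Qed.

(** The derivatives of the Z's along X cancel against the brackets; what remains of the brackets is
    the matrix of derivatives of X, acting on the determinant through its trace. *)
Lemma lie_volE omega X Z1 Z2 Z3 y : sm y omega -> smv y X ->
  smv y Z1 -> smv y Z2 -> smv y Z3 ->
  lie_vol omega X Z1 Z2 Z3 y =
  (dd X omega y + omega y * divergence X y) * vol3 (Z1 y) (Z2 y) (Z3 y).
Proof.
move=> so sX s1 s2 s3; rewrite /lie_vol (ddM X so (sm_vol3 s1 s2 s3)) dd_vol3 //.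
have B Z : bracket X Z y = (\row_l dd X (fun z => Z z 0 l : R^o) y : E) -
    (\row_l \sum_i (Z y 0 i * partial i (fun z => X z 0 l : R^o) y) : E).
  by apply/rowP => l; rewrite !mxE.
rewrite !B /divergence sum3.
pose D Z : E := \row_l dd X (fun z => Z z 0 l : R^o) y.
rewrite -/(D Z1) -/(D Z2) -/(D Z3).
move: (D Z1) (D Z2) (D Z3) (dd X omega y) (omega y) => d1 d2 d3 o' o.
pose q i l : R := partial i (fun z => X z 0 l : R^o) y.
rewrite -/(q 0 0) -/(q 1 1) -/(q 2 2).
have Q Z : (\row_l \sum_i (Z y 0 i * partial i (fun z => X z 0 l : R^o) y) : E) =
    \row_l (Z y 0 0 * q 0 l + Z y 0 1 * q 1 l + Z y 0 2 * q 2 l).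
  by apply/rowP => l; rewrite !mxE sum3.
rewrite !Q /vol3 !mxE.
move: (q 0 0) (q 0 1) (q 0 2) (q 1 0) (q 1 1) (q 1 2) (q 2 0) (q 2 1) (q 2 2).
move=> q00 q01 q02 q10 q11 q12 q20 q21 q22.
move: (Z1 y 0 0) (Z1 y 0 1) (Z1 y 0 2) (Z2 y 0 0) (Z2 y 0 1) (Z2 y 0 2)
  (Z3 y 0 0) (Z3 y 0 1) (Z3 y 0 2) => u0 u1 u2 v0 v1 v2 w0 w1 w2.
ring.
Qed.

Lemma vol3_coord_field p y :
  vol3 (coord_field p 0 y) (coord_field p 1 y) (coord_field p 2 y) = (\det (jac p y))^-1.
Proof. by rewrite -det_inv det3. Qed.

(* The divergence of [f E2] in the coordinates [p], where the density of the
   volume is [omega / det (jac p)]. *)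
Lemma divergence_coords a p f omega X h : coords a p -> sm a f -> sm a omega ->
  ev a (fun y => X y = f y *: coord_field p 2 y) ->
  h * omega a = dd X omega a + omega a * divergence X a ->
  let rho y : R^o := omega y / \det (jac p y) in
  h * rho a = f a * dd (coord_field p 2) rho a + rho a * dd (coord_field p 2) f a.
Proof.
move=> cp sf so eX he rho.
have sE i := smv_coord_field i cp.
pose E i := coord_field p i.
have sX : smv a X.
  apply: smv_eq (evS (fun y => @esym _ _ _) eX) _ => l.
  apply: (@sm_eq _ a (fun y => f y * coord_field p 2 y 0 l)).
    by exists 1 => // y _; rewrite [RHS]mxE.
  by apply: smM => //; exact: sE.
(* Evaluate on the coordinate fields: [f E_2, E_i] = - E_i(f) E_2, and only i = 2 survives in the
   determinant, the others repeating E_2. *)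
have := lie_volE so sX (sE 0) (sE 1) (sE 2); rewrite -he vol3_coord_field.
rewrite -mulrA -/(rho a) => <-; rewrite /lie_vol.
have -> : (fun z => omega z * vol3 (coord_field p 0 z) (coord_field p 1 z)
    (coord_field p 2 z)) = rho.
  by apply/funext => z; rewrite vol3_coord_field.
have B i : bracket X (coord_field p i) a =
    - dd (coord_field p i) f a *: coord_field p 2 a.
  rewrite (@bracket_near a X (fun y => f y *: coord_field p 2 y) _ (coord_field p i)) //.
    by rewrite bracket_scale // coord_field_bracket // scaler0 add0r scaleNr.
  by exists 1.
rewrite !B (dd_scale _ (ev_pt eX)) [rho a]/rho -vol3_coord_field.
rewrite /vol3 !mxE.
move: (dd _ rho a) (dd _ f a) (dd _ f a) (dd _ f a) (omega a) (f a) => c1 c2 c3 c4 o c5.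
ring.
Qed.

(** [al], [be] and [h] are given by identities near [a], not by formulas. The bracket applied to p_2
    and to p_1 yields [al] and [be], and the volume of density 1 yields [h], on a neighbourhood, so
    that they can be differentiated. *)
Lemma tau_coords a p f g (Y1 Y2 : E -> E) (al be h omega : E -> R^o) :
  coords a p -> sm a f -> sm a g -> f a != 0 -> g a != 0 -> sm a omega ->
  ev a (fun y => Y1 y = f y *: coord_field p 2 y) ->
  ev a (fun y => Y2 y = g y *: coord_field p 1 y) ->
  ev a (fun y => \det (jac p y) = omega y) ->
  ev a (fun y => bracket Y1 Y2 y = al y *: Y1 y + be y *: Y2 y) ->
  ev a (fun y => h y * omega y = dd Y1 omega y + omega y * divergence Y1 y) ->
  dd Y1 al a + dd Y2 h a + al a * h a - al a * be a = 0.
Proof.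
move=> cp sf sg f0 g0 so e1 e2 eo eb eh.
pose E1 := coord_field p 1; pose E2 := coord_field p 2.
have sE1 : smv a E1 by exact: smv_coord_field.
have sE2 : smv a E2 by exact: smv_coord_field.
have sY (Y : E -> E) (c : E -> R^o) X : smv a X -> sm a c ->
    ev a (fun y => Y y = c y *: X y) -> smv a Y.
  move=> sX sc e; apply: smv_eq (evS (fun y => @esym _ _ _) e) _ => l.
  apply: (@sm_eq _ a (fun y => c y * X y 0 l)).
    by exists 1 => // y _; rewrite [RHS]mxE.
  exact: (smM sc (sX l)).
have sY1 := sY _ _ _ sE2 sf e1; have sY2 := sY _ _ _ sE1 sg e2.
have d1 c : ev a (fun y => dd Y1 c y = f y * dd E2 c y).
  by apply: evS e1 => y e; exact: dd_scale.
have d2 c : ev a (fun y => dd Y2 c y = g y * dd E1 c y).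
  by apply: evS e2 => y e; exact: dd_scale.
pose pl l y : R^o := p y 0 l.
have pE l i : ev a (fun y => dd (coord_field p i) (pl l) y = (i == l)%:R).
  by apply: evS (coords_ev cp) => y cy; exact: dd_coord_field.
have p12 : ev a (fun y => dd Y1 (pl 2) y = f y).
  by apply: evS2 (d1 (pl 2)) (pE 2 2) => y -> ->; rewrite mulr1.
have p11 : ev a (fun y => dd Y1 (pl 1) y = 0).
  by apply: evS2 (d1 (pl 1)) (pE 1 2) => y -> ->; rewrite mulr0.
have p22 : ev a (fun y => dd Y2 (pl 2) y = 0).
  by apply: evS2 (d2 (pl 2)) (pE 2 1) => y -> ->; rewrite mulr0.
have p21 : ev a (fun y => dd Y2 (pl 1) y = g y).
  by apply: evS2 (d2 (pl 1)) (pE 1 1) => y -> ->; rewrite mulr1.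
have br l : ev a (fun y => al y * dd Y1 (pl l) y + be y * dd Y2 (pl l) y =
    dd Y1 (dd Y2 (pl l)) y - dd Y2 (dd Y1 (pl l)) y).
  apply: evS (evI eb (evI (smv_ev sY1) (evI (smv_ev sY2) (smv_ev cp.1))))
    => y [e [s1 [s2 sp]]].
  by rewrite -(dd_lin _ e); exact: (dd_bracket s1 s2 (sp l)).
have alE : ev a (fun y => al y = - (g y * dd E1 f y) / f y).
  apply: evS (evI (br 2) (evI (ev_ev p12) (evI (ev_ev p22) (evI (d2 f)
    (ev_neq0 sf f0))))) => y [e [e12 [e22 [df fy]]]].
  move: e; rewrite (dd_near _ e12) (dd_near _ e22) (ev_pt e12) (ev_pt e22) dd_cst df.
  by rewrite mulr0 addr0 sub0r => <-; rewrite mulfK.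
have beE : ev a (fun y => be y = f y * dd E2 g y / g y).
  apply: evS (evI (br 1) (evI (ev_ev p11) (evI (ev_ev p21) (evI (d1 g)
    (ev_neq0 sg g0))))) => y [e [e11 [e21 [dg gy]]]].
  move: e; rewrite (dd_near _ e11) (dd_near _ e21) (ev_pt e11) (ev_pt e21) dd_cst dg.
  by rewrite mulr0 add0r subr0 => <-; rewrite mulfK.
have hE : ev a (fun y => h y = dd E2 f y).
  have od : ev a (fun y => \det (jac p y) != 0).
    by apply: evS (coords_ev cp) => y [_]; rewrite unitmxE unitfE.
  apply: evS (evI eh (evI (coords_ev cp) (evI (sm_ev sf) (evI (sm_ev so)
    (evI (ev_ev e1) (ev_ev (evI eo od))))))) => y [he [cy [sfy [soy [e1y eoy]]]]].
  have := divergence_coords cy sfy soy e1y he; rewrite /=.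
  have r1 : ev y (fun z => omega z / \det (jac p z) = 1).
    by apply: evS eoy => z [<- dz]; rewrite divff.
  rewrite (dd_near _ r1) dd_cst (ev_pt r1) mulr1 mulr0 add0r mul1r.
  by [].
have s1f : sm a (dd E1 f) by exact: sm_dd.
have s2f : sm a (dd E2 f) by exact: sm_dd.
have sn : sm a (fun y => - (g y * dd E1 f y)) by apply/smN/smM.
rewrite (dd_near _ hE) (ev_pt alE) (ev_pt beE) (ev_pt hE).
rewrite (dd_near _ alE) (ev_pt (d1 _)) (ev_pt (d2 _)).
(* The second-order terms of Y1(al) and Y2(h) cancel because E1 and E2 commute; the rest is a
   rational identity. *)
have F1 := dd_div E2 sn sf f0; have F2 := ddN E2 (smM sg s1f).
have F3 := ddM E2 sg s1f; have F4 := coord_field_comm 1 2 cp sf.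
rewrite -/E1 -/E2 in F4.
rewrite F1 F2 F3 F4.
move: (dd E2 (dd E1 f) a) (dd E2 f a) (dd E1 f a) (dd E2 g a) (f a) (g a) f0 g0.
by move=> c1 c2 c3 c4 c5 c6 n5 n6; field; rewrite n5 n6.
Qed.

(** [divergence_coords] with f = 1 gives h = d_2 rho / rho; composition with S turns coordinate
    fields into partial derivatives, hence d_1 h = 0 into the hypothesis of [split_density]. *)
Lemma density_split_coords a p S (omega h : E -> R^o) : coords a p ->
  smv (p a) S -> ev a (fun y => S (p y) = y) -> ev (p a) (fun w => p (S w) = w) ->
  sm a omega -> omega a != 0 ->
  ev a (fun y => h y * omega y = dd (coord_field p 2) omega y +
    omega y * divergence (coord_field p 2) y) ->
  ev a (fun y => dd (coord_field p 1) h y = 0) ->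
  ev (p a) (fun w => partial 1 (fun w =>
    partial 2 (fun w => omega (S w) / \det (jac p (S w)) : R^o) w /
      (omega (S w) / \det (jac p (S w))) : R^o) w = 0).
Proof.
move=> cp sS Sp pS so o0 eh e1h.
have Sa : S (p a) = a by exact: ev_pt Sp.
pose rho y : R^o := omega y / \det (jac p y).
have sdet : sm a (fun y => \det (jac p y)).
  by apply: sm_det => i l; exact: (sm_jac i l cp.1).
have d0 : \det (jac p a) != 0 by have := cp.2; rewrite unitmxE unitfE.
have sr : sm a rho by exact: (sm_div so sdet d0).
have r0 : rho a != 0 by rewrite /rho mulf_neq0 // invr_neq0.
have hE : ev a (fun y => h y = dd (coord_field p 2) rho y / rho y).
  apply: evS (evI eh (evI (coords_ev cp) (evI (sm_ev so) (ev_neq0 sr r0))))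
    => y [he [cy [soy ry]]].
  have e : ev y (fun z => coord_field p 2 z = (1 : R^o) *: coord_field p 2 z).
    by exists 1 => // z _; rewrite scale1r.
  have := divergence_coords cy (sm_cst y 1) soy e he; rewrite /= -/rho dd_cst mulr0 addr0.
  by rewrite mul1r -/(rho y) => <-; rewrite mulfK.
have sh : sm a h.
  apply: sm_eq (evS (fun y => @esym _ _ _) hE) _.
  by apply: sm_div => //; apply: sm_dd => //; exact: smv_coord_field.
have pull (Q : E -> Prop) : ev a Q -> ev (p a) (fun w => Q (S w)).
  by move=> eQ; apply: ev_comp => //; rewrite Sa.
have chain f i : sm a f -> ev (p a) (fun w =>
    dd (coord_field p i) f (S w) = partial i (fun z => f (S z)) w).
  move=> sf; apply: evS (evI (pull _ (evI (coords_ev cp) (evI (sm_ev sf) (ev_ev Sp))))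
    (evI pS (smv_ev sS))) => w [[cw [sw Sw]] [pw sSw]].
  by rewrite (coord_field_chain i cw _ Sw sw) pw.
have C := evI (pull _ hE) (chain rho 2 sr).
apply: evS (evI (pull _ e1h) (evI (chain h 1 sh) (ev_ev C))) => w [e1 [e2 eC]].
rewrite -[RHS]e1 e2; apply: partial_near; apply: evS eC => z [-> ->].
by [].
Qed.

End CoordinateFields.

(** * Passage between the body and its chart *)

Section Transfer.
Context {R : realType}.
Notation E := 'rV[R]_3.
Implicit Types (U : set E) (F : E -> E) (i l : 'I_3).

Lemma partial_row i l F y : derivable F y (e_ i) ->
  partial i F y 0 l = partial i (fun z => F z 0 l : R^o) y.
Proof. by move=> dF; rewrite /partial (derive_mx dF) mxE. Qed.

Lemma Ck_row n U F l : open U -> Ck n U F -> Ck n U (fun y => F y 0 l : R^o).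
Proof.
move=> oU; elim: n F => [|n IH] F [cF H].
  split=> // y Uy; exact: (@continuous_comp _ _ _ F (fun M : E => M 0 l : R^o) y
    (cF y Uy) (@coord_continuous _ 1 3 0 l _)).
split=> [y Uy|i].
  exact: (@continuous_comp _ _ _ F (fun M : E => M 0 l : R^o) y
    (cF y Uy) (@coord_continuous _ 1 3 0 l _)).
have [dF CF] := H i; split=> [y Uy|]; first by have /derivable_mxP/(_ 0 l) := dF y Uy.
apply: eq_Ck (IH _ CF) => // y Uy; exact: partial_row (dF y Uy).
Qed.

Lemma Ck_rowP n U F : open U -> (forall l, Ck n U (fun y => F y 0 l : R^o)) -> Ck n U F.
Proof.
have cont (G : E -> E) y : (forall l, {for y, continuous (fun z => G z 0 l : R^o)}) ->
    {for y, continuous G}.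
  move=> H A /nbhs_boxP[r r0 Hr].
  have [d d0 Hd] : ev y (fun z => forall l, `|G z 0 l - G y 0 l| < r).
    apply: ev_all3 => l; have /continuous_boxP/(_ r r0)[d d0 Hd] := H l.
    by exists d.
  by apply/nbhs_boxP; exists d => // z /Hd bz; apply: Hr.
move=> oU; elim: n F => [|n IH] F H.
  by split=> // y Uy; apply: cont => l; have [+ _] := H l; apply.
split=> [y Uy|i]; first by apply: cont => l; have [+ _] := H l; apply.
have dF y : U y -> derivable F y (e_ i).
  move=> Uy; apply/derivable_mxP => c l; rewrite (ord1 c).
  by have [_ /(_ i)[+ _]] := H l; apply.
split=> //; apply: IH => l; have [_ /(_ i)[_ CF]] := H l.
by apply: eq_Ck CF => // y Uy; rewrite -partial_row //; exact: dF.
Qed.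

Context {B : body R}.
Local Notation ch := (@chart R B).
Implicit Types (x : B) (V : set B) (f : B -> R^o) (X Y Z : vector_field B).

Lemma ev_chart V x (P : E -> Prop) : open V -> V x ->
  (forall y, V y -> P (ch y)) -> ev (ch x) P.
Proof.
move=> oV Vx H; apply: (ev_open (chart_open oV)); first by exists x.
by move=> _ [y Vy <-]; exact: H.
Qed.

(** The image of the chart is open, so the default value 0 of [in_chart] does not occur near
    [ch x]. *)
Lemma ev_in_chart {W : normedModType R} (F : E -> W) x :
  ev (ch x) (fun y => F y = in_chart (fun z => F (ch z)) y).
Proof. by apply: (@ev_chart setT) => // [|z _]; [exact: openT|rewrite in_chartE]. Qed.

Lemma chart_ev x (P : E -> Prop) : ev (ch x) P ->
  exists V, [/\ open V, V x & forall y, V y -> P (ch y)].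
Proof.
move=> [r r0 H]; exists (ch @^-1` box (ch x) r); split.
- by apply: open_comp; [move=> y _; exact: chart_continuous|exact: box_open].
- exact: box_center.
- by move=> y; exact: H.
Qed.

Lemma sm_chart V x f : open V -> V x -> smooth_on V f -> sm (ch x) (in_chart f).
Proof. by move=> oV Vx; apply: sm_open; [exact: chart_open|exists x]. Qed.

Lemma smv_chart V x X : open V -> V x -> smooth_on V X -> smv (ch x) (in_chart X).
Proof.
move=> oV Vx sX l; apply: (@sm_open _ _ _ (ch @` V)); [exact: chart_open|by exists x|].
by move=> n; apply: Ck_row; [exact: chart_open|exact: sX].
Qed.

Lemma smooth_on_smv V X : (forall x, V x -> smv (ch x) (in_chart X)) -> open V ->
  smooth_on V X.
Proof.
move=> H oV n; apply: Ck_rowP => [|l]; first exact: chart_open.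
apply: Ck_local => _ [x Vx <-]; have [r r0 s] := H x Vx l.
by exists (box (ch x) r); split; [exact: box_open|exact: box_center|exact: s].
Qed.

Lemma vderE X f x : sm (ch x) (in_chart f) ->
  vder X f x = dd (in_chart X) (in_chart f) (ch x).
Proof.
by move=> sf; apply: etrans (derive_dd (in_chart X) sf); rewrite (in_chartE X x).
Qed.

Lemma derive_row (F : E -> E) y (v : E) l : smv y F ->
  ('D_v F y) 0 l = \sum_i v 0 i * partial i (fun z => F z 0 l : R^o) y.
Proof.
move=> sF; have H m := is_derive_dir v (sm_C1at (sF m)).
have dF : derivable F y v.
  by apply/derivable_mxP => c m; rewrite (ord1 c); case: (H m).
by rewrite (derive_mx dF) mxE; case: (H l).
Qed.

Lemma lie_bracketE x X Y : smv (ch x) (in_chart X) -> smv (ch x) (in_chart Y) ->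
  lie_bracket X Y x = bracket (in_chart X) (in_chart Y) (ch x).
Proof.
move=> sX sY; apply/rowP => l.
by rewrite !mxE /vder !derive_row // /dd !in_chartE.
Qed.

Lemma alternating_vol3 (T : E -> E -> E -> R) :
  (forall v w, scalar (fun u => T u v w)) -> (forall u w, scalar (fun v => T u v w)) ->
  (forall u v, scalar (fun w => T u v w)) -> (forall u w, T u u w = 0) ->
  (forall u v, T u v v = 0) -> (forall u v, T u v u = 0) ->
  forall u v w, T u v w = T (e_ 0) (e_ 1) (e_ 2) * vol3 u v w.
Proof.
move=> l1 l2 l3 a12 a23 a13.
have expand (g : E -> R) u : scalar g ->
    g u = u 0 0 * g (e_ 0) + u 0 1 * g (e_ 1) + u 0 2 * g (e_ 2).
  move=> lg; have g0 : g 0 = 0.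
    have := lg 1 0 0; rewrite scale1r add0r mul1r.
    by move/eqP; rewrite -subr_eq0 opprD addrA subrr add0r oppr_eq0 => /eqP.
  have {1}-> : u = u 0 0 *: e_ 0 + (u 0 1 *: e_ 1 + (u 0 2 *: e_ 2 + 0)).
    by rewrite addr0 addrA [LHS]row_sum_delta sum3.
  by rewrite !lg g0 addr0 addrA.
have anti (g : E -> E -> R) u v : (forall v, scalar (g^~ v)) -> (forall u, scalar (g u)) ->
    (forall u, g u u = 0) -> g u v = - g v u.
  move=> h1 h2 h; have /eqP := h (1 *: u + v).
  by rewrite h1 !h2 !h !mul1r add0r addr0 addr_eq0 => /eqP.
move=> u v w; rewrite /vol3.
have t12 p q r : T p q r = - T q p r by exact: (anti (fun p q => T p q r)).
have t23 p q r : T p q r = - T p r q by exact: (anti (fun q r => T p q r)).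
have x1 : T u v w = u 0 0 * T (e_ 0) v w + u 0 1 * T (e_ 1) v w + u 0 2 * T (e_ 2) v w
  by exact: (expand (fun u => T u v w) u (l1 v w)).
have x2 p : T p v w = v 0 0 * T p (e_ 0) w + v 0 1 * T p (e_ 1) w + v 0 2 * T p (e_ 2) w
  by exact: (expand (fun v => T p v w) v (l2 p w)).
have x3 p q : T p q w = w 0 0 * T p q (e_ 0) + w 0 1 * T p q (e_ 1) + w 0 2 * T p q (e_ 2)
  by exact: (expand (fun w => T p q w) w (l3 p q)).
rewrite x1 !x2 !x3 !a12 !a23 !a13.
have -> : T (e_ 0) (e_ 2) (e_ 1) = - T (e_ 0) (e_ 1) (e_ 2) by rewrite t23.
have -> : T (e_ 1) (e_ 0) (e_ 2) = - T (e_ 0) (e_ 1) (e_ 2) by rewrite t12.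
have -> : T (e_ 1) (e_ 2) (e_ 0) = T (e_ 0) (e_ 1) (e_ 2) by rewrite t23 t12 opprK.
have -> : T (e_ 2) (e_ 0) (e_ 1) = T (e_ 0) (e_ 1) (e_ 2) by rewrite t12 t23 opprK.
have -> : T (e_ 2) (e_ 1) (e_ 0) = - T (e_ 0) (e_ 1) (e_ 2) by rewrite t12 t23 t12 opprK.
move: (T _ _ _) (u 0 0) (u 0 1) (u 0 2) (v 0 0) (v 0 1) (v 0 2) (w 0 0) (w 0 1) (w 0 2).
by move=> t u0 u1 u2 v0 v1 v2 w0 w1 w2; clear; ring.
Qed.

Lemma vol3_frame (v1 v2 v3 : E) : vol3 v1 v2 v3 != 0 -> linear_frame v1 v2 v3.
Proof.
pose A : 'M[R]_3 := \matrix_(i, l) (tnth [tuple v1; v2; v3] i) 0 l.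
have rA i : row i A = tnth [tuple v1; v2; v3] i by apply/rowP => l; rewrite !mxE.
have dA : \det A = vol3 v1 v2 v3 by rewrite det3 !rA.
rewrite -dA => d0; have uA : A \in unitmx by rewrite unitmxE unitfE.
rewrite /linear_frame basisEfree subvf dimvf /= andbT.
apply/(@freeP _ _ _ [tuple v1; v2; v3]) => k e i.
have /rowP/(_ i) : (\row_i k i : E) = 0.
  have kA : (\row_i k i : E) *m A = 0.
    rewrite mulmx_sum_row -[RHS]e; apply: eq_bigr => j _.
    by rewrite mxE rA (tnth_nth 0).
  by rewrite -[LHS](mulmxK uA) kA mul0mx.
by rewrite !mxE.
Qed.

Section Volume.
Variable Omega : trilinear_form B.
Hypothesis hOmega : volume_form Omega.

(** The coefficient of Omega relative to the determinant in the global chart. *)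
Definition density : E -> R^o := in_chart (fun x => Omega x (e_ 0) (e_ 1) (e_ 2) : R^o).

Lemma vol_density x u v w : Omega x u v w = density (ch x) * vol3 u v w.
Proof.
rewrite /density in_chartE; case: hOmega => l1 l2 l3 a12 a23 a13 _ _.
exact: (@alternating_vol3 (Omega x)).
Qed.

Lemma sm_density x : sm (ch x) density.
Proof. by apply: (@sm_chart setT) => //; [exact: openT|case: hOmega]. Qed.

Lemma density_neq0 x : density (ch x) != 0.
Proof.
have [_ _ _ _ _ _ _ /(_ x)[u [v [w]]]] := hOmega.
by rewrite vol_density mulf_eq0 negb_or => /andP[].
Qed.

Lemma lie_derivativeE x X Z1 Z2 Z3 : smv (ch x) (in_chart X) ->
  smv (ch x) (in_chart Z1) -> smv (ch x) (in_chart Z2) -> smv (ch x) (in_chart Z3) ->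
  lie_derivative X Omega Z1 Z2 Z3 x =
  (dd (in_chart X) density (ch x) + density (ch x) * divergence (in_chart X) (ch x)) *
  vol3 (Z1 x) (Z2 x) (Z3 x).
Proof.
move=> sX s1 s2 s3.
have := lie_volE (sm_density x) sX s1 s2 s3; rewrite !in_chartE => <-.
have e : ev (ch x) (fun y => in_chart (eval_form Omega Z1 Z2 Z3) y =
    density y * vol3 (in_chart Z1 y) (in_chart Z2 y) (in_chart Z3 y)).
  apply: (@ev_chart setT) => // [|y _]; first exact: openT.
  by rewrite !in_chartE /eval_form vol_density.
have e' : ev (ch x) (fun y => density y *
    vol3 (in_chart Z1 y) (in_chart Z2 y) (in_chart Z3 y) =
    in_chart (eval_form Omega Z1 Z2 Z3) y) by apply: evS e.
rewrite /lie_derivative vderE; last first.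
  by apply: sm_eq e' _; apply: smM; [exact: sm_density|exact: sm_vol3].
by rewrite (dd_near _ e) /lie_vol /eval_form !lie_bracketE // !vol_density !in_chartE.
Qed.

(* Only the values on the constant fields are needed to recover [h]. *)
Lemma lie_derivative_eqP V X (h : B -> R^o) : open V -> smooth_on V X ->
  lie_derivative_eq V X Omega h <->
  forall x, V x -> h x * density (ch x) =
    dd (in_chart X) density (ch x) + density (ch x) * divergence (in_chart X) (ch x).
Proof.
move=> oV sX; split=> [H x Vx|H Z1 Z2 Z3 s1 s2 s3 x Vx].
  pose Zc i : vector_field B := fun=> e_ i.
  have smc i z : smv (ch z) (in_chart (Zc i)).
    move=> l; apply: sm_eq (sm_cst _ (e_ i 0 l)).
    by apply: (@ev_chart setT) => // [|y _]; [exact: openT|rewrite in_chartE].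
  have sZ i : smooth_on V (Zc i) by apply: smooth_on_smv.
  have := H _ _ _ (sZ 0) (sZ 1) (sZ 2) x Vx.
  rewrite lie_derivativeE //; last exact: smv_chart sX.
  have v1 : vol3 (e_ 0 : E) (e_ 1) (e_ 2) = 1.
    rewrite -(det1 R 3) det3; congr (vol3 _ _ _);
      by apply/rowP => l; rewrite !mxE eqxx /= eq_sym.
  by rewrite /eval_form vol_density /Zc v1 !mulr1 => ->.
rewrite lie_derivativeE; [|exact: smv_chart sX|exact: smv_chart s1|
  exact: smv_chart s2|exact: smv_chart s3].
by rewrite -H // /eval_form vol_density mulrA.
Qed.

End Volume.

(** Differentiating S (p y) = y shows that the Jacobians of p and S are inverse to each other; the
    coordinate fields are rows of the latter. *)
Lemma local_coordinates_jac V psi psi_inv x : local_coordinates V psi psi_inv -> V x ->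
  coords (ch x) (in_chart psi) /\
  forall i, coordinate_field psi psi_inv i x = coord_field (in_chart psi) i (ch x).
Proof.
move=> [oV oW can sp sS] Vx; set p := in_chart psi; set S := ch \o psi_inv.
have px : p (ch x) = psi x by exact: in_chartE.
have Wx : (psi @` V) (psi x) by exists x.
have sp' : smv (ch x) p by exact: smv_chart sp.
have sS' : smv (p (ch x)) S.
  move=> l; rewrite px; apply: (sm_open oW Wx) => n.
  by apply: Ck_row => //; exact: sS.
have Sp : ev (ch x) (fun y => S (p y) = y).
  apply: (ev_chart oV Vx) => y Vy.
  by rewrite /p in_chartE /S /= can // inE.
have J : jac p (ch x) *m jac S (p (ch x)) = 1%:M.
  apply/matrixP => i l; have := partial_comp i sp' (sS' l).
  rewrite (@partial_near _ i (ch x) _ (coord l)); last by apply: evS Sp => y ->.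
  have [_ ->] := partial_coord i l (ch x).
  by move=> e; rewrite [RHS]mxE eq_sym e mxE; apply: eq_bigr => c _; rewrite !mxE.
have [up _] := mulmx1_unit J; split=> // i.
have eS : invmx (jac p (ch x)) = jac S (p (ch x)) by rewrite -[LHS]mulmx1 -J mulKmx.
apply/rowP => l; rewrite /coord_field mxE eS mxE px /coordinate_field.
apply: partial_row; have [_ /(_ i)[+ _]] := sS 1%N; exact.
Qed.

End Transfer.

(** * From integrability to involutivity and the vanishing of tau *)

Section IntegrableImplies.
Context {R : realType} {B : body R}.
Notation E := 'rV[R]_3.
Local Notation ch := (@chart R B).
Implicit Types (x : B) (V : set B) (f : B -> R^o) (X Y Z : vector_field B).
Variables (L1 L2 : distribution B) (Omega : trilinear_form B).
Hypothesis hOmega : volume_form Omega.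

Definition adapted_coords p x :=
  [/\ L1 x = <[coord_field p 2 (ch x)]>%VS, L2 x = <[coord_field p 1 (ch x)]>%VS &
      \det (jac p (ch x)) = density Omega (ch x)].

Lemma sm_divergence (a : E) (X : E -> E) : smv a X -> sm a (divergence X).
Proof. by move=> sX; apply: sm_sum => i; apply: sm_partial. Qed.

Lemma integrable_coords x : integrable_structure (G2A_structure L1 L2 Omega) ->
  exists p V, [/\ open V, V x, coords (ch x) p & forall y, V y -> adapted_coords p y].
Proof.
move=> /(_ x)[V [psi [psi_inv [lc Vx H]]]].
exists (in_chart psi), V; split=> //.
- by case: lc.
- by have [] := local_coordinates_jac lc Vx.
move=> y Vy; have [cy Ey] := local_coordinates_jac lc Vy.
have [_ l1 l2] := H y Vy; move: l1 l2; rewrite !Ey => l1 l2.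
rewrite (vol_density hOmega) vol3_coord_field => /divr1_eq e.
by split.
Qed.

Lemma adapted_dd_section p y (X : E -> E) :
  coords (ch y) p -> adapted_coords p y -> X (ch y) \in (L1 y + L2 y)%VS ->
  dd X (fun z => p z 0 0 : R^o) (ch y) = 0.
Proof.
move=> cp [-> -> _] /memv_addP[u /vlineP[c ->] [v /vlineP[d ->] e]].
by rewrite (dd_lin _ e) !dd_coord_field // !mulr0 addr0.
Qed.

(** The sum of the two lines is the kernel of dp_0, and a bracket of fields that annihilate p_0
    annihilates p_0. *)
Lemma integrable_involutive :
  integrable_structure (G2A_structure L1 L2 Omega) ->
  involutive_distribution (dsum L1 L2).
Proof.
move=> H V X Y oV sX sY hX hY x Vx.
have [p [V' [oV' V'x cp ap]]] := integrable_coords x H.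
have sX' := smv_chart oV Vx sX; have sY' := smv_chart oV Vx sY.
have d0 Z : section_of V (dsum L1 L2) Z ->
    ev (ch x) (fun y => dd (in_chart Z) (fun z => p z 0 0 : R^o) y = 0).
  move=> hZ; have [V1 [oV1 V1x cV1]] := chart_ev (coords_ev cp).
  apply: (@ev_chart _ _ (V `&` (V' `&` V1))) => // [|y [Vy [V'y V1y]]].
    by apply: openI => //; exact: openI.
  apply: adapted_dd_section (cV1 _ V1y) (ap _ V'y) _.
  by rewrite in_chartE; exact: hZ.
have e0 : (lie_bracket X Y x *m jac p (ch x)) 0 0 = 0.
  rewrite lie_bracketE // -jac_dd dd_bracket //; last exact: (cp.1 0).
  by rewrite (dd_near _ (d0 _ hY)) (dd_near _ (d0 _ hX)) !dd_cst subrr.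
rewrite /dsum (coord_field_decomp (lie_bracket X Y x) cp) sum3 e0 scale0r add0r addrC.
have [-> -> _] := ap _ V'x.
by apply: memv_add; apply: memvZ; exact: memv_line.
Qed.

Lemma integrable_tau :
  integrable_structure (G2A_structure L1 L2 Omega) -> tau_vanishes L1 L2 Omega.
Proof.
move=> H V Y1 Y2 Y3 [[oV sY1 sY2 sY3 _] h1 h2 h3] al be h hbr hlie x Vx.
have [p [V' [oV' V'x cp ap]]] := integrable_coords x H.
have s1 := smv_chart oV Vx sY1; have s2 := smv_chart oV Vx sY2.
have so := sm_density hOmega x; have o0 := density_neq0 hOmega x.
pose f : E -> R^o := dd (in_chart Y1) (fun z => p z 0 2 : R^o).
pose g : E -> R^o := dd (in_chart Y2) (fun z => p z 0 1 : R^o).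
have sf : sm (ch x) f by apply: sm_dd => //; exact: (cp.1 2).
have sg : sm (ch x) g by apply: sm_dd => //; exact: (cp.1 1).
have oW : open (V `&` V') by exact: openI.
have Wx : (V `&` V') x by split.
have coef (Z : E -> E) i (y : E) (c : R) : coords y p -> Z y = c *: coord_field p i y ->
    dd Z (fun z => p z 0 i : R^o) y = c.
  by move=> cy e; rewrite (dd_scale _ e) dd_coord_field // eqxx mulr1.
have e1 : ev (ch x) (fun y => in_chart Y1 y = f y *: coord_field p 2 y).
  have : ev (ch x) (fun y => exists c : R, in_chart Y1 y = c *: coord_field p 2 y).
    apply: (ev_chart oW Wx) => y [Vy V'y]; rewrite in_chartE.
    by have := h1 y Vy; have [-> _ _] := ap _ V'y => /vlineP.
  by apply: evS2 (coords_ev cp) => y cy [c e]; rewrite /f (coef _ _ _ _ cy e).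
have e2 : ev (ch x) (fun y => in_chart Y2 y = g y *: coord_field p 1 y).
  have : ev (ch x) (fun y => exists c : R, in_chart Y2 y = c *: coord_field p 1 y).
    apply: (ev_chart oW Wx) => y [Vy V'y]; rewrite in_chartE.
    by have := h2 y Vy; have [_ -> _] := ap _ V'y => /vlineP.
  by apply: evS2 (coords_ev cp) => y cy [c e]; rewrite /g (coef _ _ _ _ cy e).
(* The normalization Omega (Y1, Y2, Y3) = 1 is what prevents Y1 and Y2, hence f and g, from
   vanishing. *)
have v0 : vol3 (Y1 x) (Y2 x) (Y3 x) != 0.
  have := h3 x Vx; rewrite (vol_density hOmega) => e.
  by apply: contraTneq isT => e'; move: e; rewrite e' mulr0 => /eqP; rewrite eq_sym oner_eq0.
have f0 : f (ch x) != 0.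
  apply: contraNneq v0 => e; have := ev_pt e1; rewrite in_chartE e scale0r => ->.
  by rewrite /vol3 !mxE !mul0r subrr addr0.
have g0 : g (ch x) != 0.
  apply: contraNneq v0 => e; have := ev_pt e2; rewrite in_chartE e scale0r => ->.
  by rewrite /vol3 !mxE !mul0r !subrr !mulr0 subrr addr0.
have ed : ev (ch x) (fun y => \det (jac p y) = density Omega y).
  by apply: (ev_chart oV' V'x) => y /ap[].
have eb : ev (ch x) (fun y => bracket (in_chart Y1) (in_chart Y2) y =
    in_chart al y *: in_chart Y1 y + in_chart be y *: in_chart Y2 y).
  apply: (ev_chart oV Vx) => y Vy.
  rewrite -lie_bracketE; [|exact: smv_chart sY1|exact: smv_chart sY2].
  by rewrite hbr // !in_chartE.
have eh : ev (ch x) (fun y => in_chart h y * density Omega y =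
    dd (in_chart Y1) (density Omega) y + density Omega y * divergence (in_chart Y1) y).
  apply: (ev_chart oV Vx) => y Vy; rewrite in_chartE.
  exact: ((lie_derivative_eqP hOmega h oV sY1).1 hlie).
(* [al] is only known pointwise; its smoothness, needed to expand [vder], is read off al =
   [Y1, Y2](p_2) / f. *)
have sal : sm (ch x) (in_chart al).
  apply: (@sm_eq _ _ (fun y => dd (bracket (in_chart Y1) (in_chart Y2))
      (fun z => p z 0 2 : R^o) y / f y)); last first.
    by apply: sm_div => //; apply: sm_dd; [exact: smv_bracket|exact: (cp.1 2)].
  have := evI (evI eb e2) (evI (ev_neq0 sf f0) (coords_ev cp)).
  apply: evS => y [[by_ e2y] [fy cy]].
  rewrite (dd_lin _ by_) (dd_scale _ e2y) dd_coord_field // !mulr0 addr0.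
  by rewrite -/(f y) mulfK.
have sh : sm (ch x) (in_chart h).
  apply: (@sm_eq _ _ (fun y => (dd (in_chart Y1) (density Omega) y +
     density Omega y * divergence (in_chart Y1) y) / density Omega y)); last first.
    apply: sm_div => //; apply: smD; first exact: sm_dd.
    by apply: smM => //; exact: sm_divergence.
  apply: evS2 eh (ev_neq0 so o0) => y e oy.
  by rewrite -e mulfK.
rewrite /tau !vderE //.
have := tau_coords cp sf sg f0 g0 so e1 e2 ed eb eh.
by rewrite !in_chartE.
Qed.

End IntegrableImplies.

(** * From involutivity and the vanishing of tau to integrability *)

Section InvolutiveImplies.
Context {R : realType}.
Notation E := 'rV[R]_3.

(** Otherwise the cross product of u and w vanishes, so that w_k u = u_k w for each k; independence
    then forces u = 0, which is again a dependence. *)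
Lemma frame_completion (u w : E) :
  (forall c d : R, c *: u = d *: w -> c = 0 /\ d = 0) ->
  exists v, vol3 v u w != 0.
Proof.
move=> H; apply: contrapT => /forallNP N.
have z (v : E) : vol3 v u w = 0 by apply/eqP/negP => /negP /N.
have m0 := z (e_ 0); have m1 := z (e_ 1); have m2 := z (e_ 2).
move: m0 m1 m2; rewrite /vol3 !mxE /= !mul1r !mul0r !subr0 !add0r ?addr0 => m0 m1 m2.
have aux (p q r t : R) : p * q - r * t = 0 -> p * q = t * r /\ r * t = q * p.
  by move/eqP; rewrite subr_eq0 => /eqP e; rewrite [t * r]mulrC [q * p]mulrC.
have cross k : w 0 k *: u = u 0 k *: w.
  apply/rowP => l; rewrite !mxE; move: k l; move: m0 m1 m2.
  move=> /aux[a0 b0] /eqP; rewrite oppr_eq0 => /eqP/aux[a1 b1] /aux[a2 b2].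
  by apply: ord3P; apply: ord3P; first [exact: mulrC|symmetry].
have u0 k : u 0 k = 0 by case: (H _ _ (cross k)).
have e : (1 : R) *: u = 0 *: w by apply/rowP => l; rewrite !mxE u0 mulr0 mul0r.
by have [/eqP] := H _ _ e; rewrite oner_eq0.
Qed.

Lemma vol3_rev (u v w : E) (c : R) : vol3 u v (c *: w) = - c * vol3 w v u.
Proof.
rewrite /vol3 !mxE.
move: (u 0 0) (u 0 1) (u 0 2) (v 0 0) (v 0 1) (v 0 2) (w 0 0) (w 0 1) (w 0 2).
by move=> *; ring.
Qed.

Lemma vline_scale (v w : E) (c : R) : v = c *: w -> v != 0 -> <[v]>%VS = <[w]>%VS.
Proof.
move=> -> ; rewrite scaler_eq0 negb_or => /andP[c0 _]; apply/eqP.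
rewrite eqEsubv -!memvE memvZ ?memv_line //=.
by rewrite -{1}[w]scale1r -(mulVf c0) -scalerA memvZ ?memv_line.
Qed.

Context {B : body R}.
Local Notation ch := (@chart R B).
Implicit Types (x : B) (V : set B) (f : B -> R^o) (X Y Z : vector_field B).

Lemma line_section (L : distribution B) x : smooth_distribution 1 L ->
  exists V Y, [/\ open V, V x, smooth_on V Y &
    forall y, V y -> L y = <[Y y]>%VS /\ Y y != 0].
Proof.
move=> [dL /(_ x)[V [X [oV Vx sX HX]]]]; exists V, (X ord0); split=> // y Vy.
have e : L y = <[X ord0 y]>%VS by rewrite HX // big_ord_recl big_ord0 addv0.
by split=> //; have := dL y; rewrite e dim_vline; case: eqP.
Qed.

(** Turns an invertible germ in the chart into a chart of the body with an actual domain and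
    inverse. *)
Lemma local_coordinates_of V0 x (P : E -> E) : open V0 -> V0 x -> coords (ch x) P ->
  exists V psi psi_inv, [/\ local_coordinates V psi psi_inv, V x, V `<=` V0 &
    forall y, V y -> forall i,
      coordinate_field psi psi_inv i y = coord_field P i (ch y)].
Proof.
move=> oV0 V0x [sP uP]; set a := ch x.
have [q q0 sU] := smv_box sP; pose U := box a q.
have oU : open U by exact: box_open.
have Ua : U a by exact: box_center.
have [W [r [S [[oW Wa WU r0] [PW SW sS uW]]]]] := inverse_function oU Ua sU uP.
pose V := V0 `&` ch @^-1` W.
have oV : open V.
  apply: openI => //; apply: open_comp => // y _; exact: chart_continuous.
have Vx : V x by split.
pose psi y := P (ch y).
pose psi_inv z : B := xget x [set y | ch y = S z].
have psiK y : V y -> psi_inv (psi y) = y.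
  move=> [_ Wy]; have [_ e] := PW _ Wy.
  rewrite /psi_inv; case: xgetP => [y' _ /=|/(_ y)[]]; last by rewrite /= e.
  by rewrite /psi e => /chart_inj.
have oP : open (psi @` V).
  (* Openness of the image: it is a preimage under the continuous local inverse S. *)
  have -> : psi @` V = [set z | box (P a) r z /\ (ch @` V) (S z)].
    apply/seteqP; split=> [_ [y [V0y Wy] <-]|z [bz [y [V0y Wy] e]]].
      have [b e] := PW _ Wy; split=> //; by exists y.
    have [_ e'] := SW _ bz; exists y; first by split.
    by rewrite /psi; move: e => /= ->.
  rewrite openE => z [bz hz]; apply/nbhs_boxP.
  have sSz : smv z S by move=> l; apply: (sm_open (@box_open _ _ _) bz (sS l)).
  have [r1 r10 H1] := box_sub bz.
  have [r2 r20 H2] : ev z (fun z' => (ch @` V) (S z')).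
    apply: ev_comp => //; apply: (ev_open (chart_open oV)) => //.
  exists (Num.min r1 r2); first by rewrite lt_min r10.
  move=> z' bz'; split; [apply: H1|apply: H2]; apply: boxS bz';
    by rewrite ge_min lexx ?orbT.
have spsi : smooth_on V psi.
  apply: smooth_on_smv => // y Vy.
  apply: (@smv_eq _ _ P).
    by apply: (ev_chart oV Vy) => z _; rewrite in_chartE.
  by move=> l; apply: (sm_open oU) => //; apply: WU; case: Vy.
have sinv : smooth (psi @` V) (ch \o psi_inv).
  have e z : (psi @` V) z -> S z = (ch \o psi_inv) z.
    by move=> [y Vy <-] /=; rewrite psiK //; have [_ ->] := PW _ Vy.2.
  move=> n; apply: (eq_Ck oP e); apply: Ck_rowP => // l.
  apply: Ck_subset (sS l n) => _ [y Vy <-].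
  by have [b _] := PW _ Vy.2.
have lc : local_coordinates V psi psi_inv.
  split=> //.
  by move=> y; rewrite inE => /psiK.
exists V, psi, psi_inv; split=> //; first by move=> y [].
move=> y Vy i; have [_ ->] := local_coordinates_jac lc Vy.
rewrite /coord_field; congr (row i (invmx _)); apply/matrixP => c l.
rewrite !mxE; apply: partial_near.
by apply: (ev_chart oV Vy) => z _; rewrite in_chartE.
Qed.

Variables (L1 L2 : distribution B) (Omega : trilinear_form B).
Hypotheses (hL1 : smooth_distribution 1 L1) (hL2 : smooth_distribution 1 L2)
  (hL12 : transverse L1 L2) (hOmega : volume_form Omega)
  (hinv : involutive_distribution (dsum L1 L2)).

Let lines (p : E -> E) x :=
  L1 x = <[coord_field p 2 (ch x)]>%VS /\ L2 x = <[coord_field p 1 (ch x)]>%VS.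

Let spanned (Y1 Y2 : E -> E) x :=
  exists V, [/\ open V, V x & forall y, V y ->
    [/\ Y1 (ch y) != 0, Y2 (ch y) != 0, L1 y = <[Y1 (ch y)]>%VS &
        L2 y = <[Y2 (ch y)]>%VS]].

Lemma coord_field_line p y (Y : E -> E) i : coords y p ->
  (forall l, l != i -> dd Y (fun z => p z 0 l : R^o) y = 0) ->
  Y y != 0 -> <[Y y]>%VS = <[coord_field p i y]>%VS.
Proof.
move=> cp H; apply: (@vline_scale _ _ ((Y y *m jac p y) 0 i)).
rewrite {1}(coord_field_decomp (Y y) cp) (bigD1 i) //= big1 ?addr0 // => l li.
by rewrite -jac_dd H // scale0r.
Qed.

(** Involutivity speaks of fields on open sets of the body, [straighten] of germs in R^3: the germs
    are lifted to a common domain where they are smooth sections. *)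
Lemma involutive_in_span V Y1 Y2 x (X Y : E -> E) : open V -> V x ->
  (forall y, V y -> L1 y = <[Y1 y]>%VS) -> (forall y, V y -> L2 y = <[Y2 y]>%VS) ->
  smv (ch x) X -> smv (ch x) Y ->
  ev (ch x) (in_span (in_chart Y1) (in_chart Y2) X) ->
  ev (ch x) (in_span (in_chart Y1) (in_chart Y2) Y) ->
  ev (ch x) (in_span (in_chart Y1) (in_chart Y2) (bracket X Y)).
Proof.
move=> oV Vx l1 l2 sX sY iX iY.
have [V' [oV' V'x H]] :=
  chart_ev (evI (evI iX iY) (evI (smv_ev sX) (smv_ev sY))).
have oW : open (V `&` V') by exact: openI.
pose lift (Z : E -> E) : vector_field B := fun y => Z (ch y).
have eL (Z : E -> E) y : ev (ch y) (fun z => Z z = in_chart (lift Z) z).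
  exact: ev_in_chart.
have sL (Z : E -> E) : (forall y, (V `&` V') y -> smv (ch y) Z) -> smooth_on (V `&` V') (lift Z).
  move=> s; apply: smooth_on_smv => // y Wy.
  exact: smv_eq (eL Z y) (s y Wy).
have secL (Z : E -> E) : (forall y, (V `&` V') y -> in_span (in_chart Y1) (in_chart Y2) Z (ch y)) ->
    section_of (V `&` V') (dsum L1 L2) (lift Z).
  move=> s y Wy; have [c [d e]] := s y Wy; rewrite /dsum l1 ?l2; [|exact: Wy.1..].
  by rewrite /lift e !in_chartE; apply: memv_add; apply: memvZ; exact: memv_line.
apply: (ev_chart oW) => // y Wy.
have [[_ _] [sXy sYy]] := H y Wy.2.
have := @hinv _ (lift X) (lift Y) oW _ _ _ _ y Wy.
rewrite lie_bracketE; [|exact: smv_eq (eL _ _) _|exact: smv_eq (eL _ _) _].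
rewrite -(bracket_near (eL X y) (eL Y y)) /dsum l1 ?l2; [|exact: Wy.1..].
move=> Hm; have /memv_addP[u /vlineP[c ->] [w /vlineP[d ->] e]] :
    bracket X Y (ch y) \in (<[Y1 y]> + <[Y2 y]>)%VS.
  by apply: Hm; [apply: sL|apply: sL|apply: secL|apply: secL] => z [_ /H[[? ?] [? ?]]].
by exists c, d; rewrite !in_chartE.
Qed.

Lemma involutive_coords x : exists (Y1 Y2 : E -> E) p, [/\ coords (ch x) p,
  ev (ch x) (rectified Y1 Y2 p) & spanned Y1 Y2 x].
Proof.
have [V1 [Y1 [oV1 V1x s1 l1]]] := line_section x hL1.
have [V2 [Y2 [oV2 V2x s2 l2]]] := line_section x hL2.
have oV : open (V1 `&` V2) by exact: openI.
(* Transversality makes Y2 x and Y1 x independent; v completes them to the rows of the matrix N. *)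
have [v v0] : exists v, vol3 v (Y2 x) (Y1 x) != 0.
  apply: frame_completion => c d e.
  have [l1x Y1x] := l1 x V1x; have [l2x Y2x] := l2 x V2x.
  have : c *: Y2 x \in (L1 x :&: L2 x)%VS.
    by rewrite memv_cap {1}e l1x l2x !memvZ ?memv_line.
  rewrite hL12 memv0 => /eqP c0; have d0 := esym e; rewrite c0 in d0.
  by move/eqP: c0; move/eqP: d0; rewrite !scaler_eq0 (negbTE Y1x) (negbTE Y2x) !orbF
    => /eqP -> /eqP ->.
pose N : 'M[R]_3 := \matrix_(i, l) (tnth [tuple v; Y2 x; Y1 x] i) 0 l.
have rN i : row i N = tnth [tuple v; Y2 x; Y1 x] i by apply/rowP => l; rewrite !mxE.
have uN : N \in unitmx by rewrite unitmxE unitfE det3 !rN.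
have [||||||p [cp hp]] := @straighten _ (in_chart Y1) (in_chart Y2) (ch x) N.
- exact: smv_chart s1.
- exact: smv_chart s2.
- exact: uN.
- by rewrite rN in_chartE.
- by rewrite rN in_chartE.
- move=> X Y; apply: (@involutive_in_span (V1 `&` V2)) => // y [V1y V2y].
  + by case: (l1 y V1y).
  + by case: (l2 y V2y).
exists (in_chart Y1), (in_chart Y2), p; split=> //.
exists (V1 `&` V2); split=> // y [V1y V2y]; rewrite !in_chartE.
by have [? ?] := l1 y V1y; have [? ?] := l2 y V2y.
Qed.

Lemma lines_of_coords x (Y1 Y2 : E -> E) p : coords (ch x) p ->
  ev (ch x) (rectified Y1 Y2 p) ->
  spanned Y1 Y2 x ->
  exists V, [/\ open V, V x & forall y, V y -> coords (ch y) p /\ lines p y].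
Proof.
move=> cp hp [V [oV Vx HV]]; have [V' [oV' V'x H]] := chart_ev (evI (coords_ev cp) hp).
exists (V `&` V'); split=> [||y [Vy V'y]]; [exact: openI|by []|].
have [cy [e10 e11 e20 e22]] := H y V'y; split=> //.
have [y1 y2 l1 l2] := HV y Vy; split.
  by rewrite l1; apply: coord_field_line => //; apply: ord3P.
by rewrite l2; apply: coord_field_line => //; apply: ord3P.
Qed.

Lemma tau_density x p : tau_vanishes L1 L2 Omega -> coords (ch x) p ->
  (exists V, [/\ open V, V x & forall y, V y -> coords (ch y) p /\ lines p y]) ->
  let h y : R^o := (dd (coord_field p 2) (density Omega) y +
    density Omega y * divergence (coord_field p 2) y) / density Omega y in
  ev (ch x) (fun y => dd (coord_field p 1) h y = 0).
Proof.
move=> ht cp [V [oV Vx HV]] h.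
have aux (w d : R) : w != 0 -> d != 0 -> w * (- (- d / w) / d) = 1.
  by move=> w0 d0; rewrite !mulNr opprK mulrA (mulrC w) divfK // divff.
pose Z i : vector_field B := fun y => coord_field p i (ch y).
(* This factor gives the frame volume 1; the minus sign comes from the odd order (2, 1, 0) of the
   coordinate fields. *)
pose c y : R^o := - \det (jac p y) / density Omega y.
pose Z3 : vector_field B := fun y => c (ch y) *: coord_field p 0 (ch y).
have o0 := density_neq0 hOmega; have so := sm_density hOmega.
have eZ i y : ev (ch y) (fun z => coord_field p i z = in_chart (Z i) z).
  exact: ev_in_chart.
have sZE i y : V y -> smv (ch y) (in_chart (Z i)).
  move=> Vy; apply: smv_eq (eZ i y) _; apply: smv_coord_field.
  by case: (HV y Vy).
have sZ i : smooth_on V (Z i) by apply: smooth_on_smv => // y; exact: sZE.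
have sc y : V y -> sm (ch y) c.
  move=> /HV[[sp _] _]; apply: sm_div => //; apply: smN; apply: sm_det => i l.
  exact: sm_jac.
have sZ3 : smooth_on V Z3.
  apply: smooth_on_smv => // y Vy l.
  apply: (@sm_eq _ _ (fun z => c z * coord_field p 0 z 0 l)).
    apply: (@ev_chart _ _ setT) => // [|z _]; first exact: openT.
    by rewrite (in_chartE Z3 z) /Z3 [RHS]mxE.
  apply: smM; first exact: sc.
  by apply: smv_coord_field; case: (HV y Vy).
have vol1 y : V y -> Omega y (Z 2 y) (Z 1 y) (Z3 y) = 1.
  move=> Vy; have [[_ uy] _] := HV y Vy; move: uy; rewrite unitmxE unitfE => d0.
  rewrite (vol_density hOmega) /Z3 vol3_rev vol3_coord_field /c.
  exact: aux (o0 y) d0.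
have fr : adapted_local_frame L1 L2 Omega V (Z 2) (Z 1) Z3.
  split=> //.
  - split=> // y Vy; apply: vol3_frame; have := vol1 y Vy.
    rewrite (vol_density hOmega) => e.
    by apply: contraTneq isT => e'; move: e; rewrite e' mulr0 => /eqP; rewrite eq_sym oner_eq0.
  - by move=> y Vy; have [_ [-> _]] := HV y Vy; exact: memv_line.
  - by move=> y Vy; have [_ [_ ->]] := HV y Vy; exact: memv_line.
pose hb : B -> R^o := fun y => h (ch y).
have sh y : V y -> sm (ch y) h.
  move=> Vy; have [cy _] := HV y Vy; have s2 := smv_coord_field 2 cy.
  apply: sm_div => //; apply: smD; first exact: sm_dd.
  by apply: smM => //; exact: sm_divergence.
have ehb y : ev (ch y) (fun z => h z = in_chart hb z).
  exact: ev_in_chart.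
have lie : lie_derivative_eq V (Z 2) Omega hb.
  apply/(lie_derivative_eqP hOmega _ oV (sZ 2)) => y Vy.
  have e2 := eZ 2 y.
  have ed : divergence (in_chart (Z 2)) (ch y) = divergence (coord_field p 2) (ch y).
    rewrite /divergence; apply: eq_bigr => i _; apply: partial_near.
    by apply: evS e2 => z ->.
  by rewrite ed -(dd_at _ (ev_pt e2)) /hb /h divfK.
have br y : V y -> lie_bracket (Z 2) (Z 1) y = (0 : R) *: Z 2 y + (0 : R) *: Z 1 y.
  move=> Vy; rewrite !scale0r addr0 lie_bracketE; [|exact: sZE..].
  by rewrite -(bracket_near (eZ 2 y) (eZ 1 y)) coord_field_bracket //; case: (HV y Vy).
apply: (ev_chart oV Vx) => y Vy.
(* Coordinate fields commute, so alpha and beta are 0 and tau reduces to [Z 1] applied to h. *)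
pose o : B -> R^o := fun=> 0.
have := ht V _ _ _ fr o o hb br lie y Vy.
have e0 : ev (ch y) (fun z => (0 : R^o) = in_chart o z).
  exact: ev_in_chart.
rewrite /tau !mul0r subr0 addr0 !vderE; last 2 first.
- exact: sm_eq (ehb y) (sh y Vy).
- exact: sm_eq e0 (sm_cst _ 0).
rewrite -(dd_near _ e0) dd_cst add0r -(dd_near _ (ehb y)).
by rewrite -(dd_at _ (ev_pt (eZ 1 y))).
Qed.

Lemma involutive_integrable : tau_vanishes L1 L2 Omega ->
  integrable_structure (G2A_structure L1 L2 Omega).
Proof.
move=> ht x; have [Y1 [Y2 [p [cp hp hV]]]] := involutive_coords x.
have o0 := density_neq0 hOmega x; have so := sm_density hOmega x.
have e1 := tau_density ht cp (lines_of_coords cp hp hV).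
have [S [sS Sp pS]] := coords_inv cp.
have e2 := density_split_coords cp sS Sp pS so o0 _ e1.
have {}e2 := e2 (evS (fun y oy => divfK oy _) (ev_neq0 so o0)).
have [P [sP [rP eP]]] := adapt_volume cp sS Sp so o0 e2 hp.
(* The determinant of [jac P] is the density of Omega, which does not vanish; the same identity
   later gives the coordinate frame volume 1. *)
have uP : coords (ch x) P.
  by split=> //; rewrite unitmxE unitfE (ev_pt eP).
have [V1 [oV1 V1x H1]] := lines_of_coords uP rP hV.
have [V2 [oV2 V2x H2]] := chart_ev eP.
have oV0 : open (V1 `&` V2) by exact: openI.
have [V [psi [psi_inv [lc Vx VV0 H]]]] := local_coordinates_of oV0 (conj V1x V2x) uP.
exists V, psi, psi_inv; split=> // y Vy; rewrite !H //.
have [V1y V2y] := VV0 _ Vy; have [[_ uy] [l1 l2]] := H1 y V1y.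
move: uy; rewrite unitmxE unitfE => d0; have d := H2 y V2y.
split=> //.
- by apply: vol3_frame; rewrite vol3_coord_field invr_eq0.
- by rewrite (vol_density hOmega) vol3_coord_field -d divff.
Qed.

End InvolutiveImplies.

Theorem proposition6p9 (R : realType) (B : body R)
    (L1 L2 : distribution B) (Omega : trilinear_form B)
    (hL1 : smooth_distribution 1 L1) (hL2 : smooth_distribution 1 L2)
    (hL12 : transverse L1 L2) (hOmega : volume_form Omega) :
  integrable_structure (G2A_structure L1 L2 Omega) <->
  involutive_distribution (dsum L1 L2) /\ tau_vanishes L1 L2 Omega.
Proof.
split=> [H|[hinv ht]].
  by split; [exact: integrable_involutive H|exact: integrable_tau H].
exact: involutive_integrable.
Qed.
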